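(* Let $W:A^{\mathbb{Z}}\times\mathcal{B}^{\mathbb{Z}}\to\mathbb{C}$ be a stationary ergodic DIMA cq-channel. Then $C_{pp}(W)=C_{\mathrm{erg}}(W)$. Moreover, for each $\varepsilon>0$ and every code $\mathcal{C}_n=(u_i,b_i)_{i=1}^{M_n}$ of blocklength $n$ with $M_n\ge2^{n(C_{pp}(W)+\varepsilon)}$, $$\bar e(\mathcal{C}_n)\ge1-\frac{C_{pp}(W)+\frac1n}{C_{pp}(W)+\varepsilon}.$$
   Context: $A$ finite, $\mathcal{B}=\mathcal{L}(\mathcal{H})$ with $\mathcal{H}$ finite-dimensional, $\mathcal{B}^{\mathbb{Z}}$ the quasi-local algebra, $\mathcal{B}^{[n,m]}=\bigotimes_{i=n}^m\mathcal{B}$, $\mathcal{B}^n=\mathcal{B}^{[1,n]}$. A cq-channel $W$: $x\mapsto W(x,b)$ Borel measurable, $b\mapsto W(x,b)$ a state. Stationary: $W(T_{in}x,b)=W(x,T_{out}b)$. DIMA: for each $\varepsilon>0$ there are $m(\varepsilon),a(\varepsilon)\ge0$ such that for all $n\in\mathbb{Z}$, $k\in\mathbb{N}$, $b\in\mathcal{B}^{[n,n+k]}$ with $0\le b\le\mathbf{1}$, $m\ge m(\varepsilon)$, $a\ge a(\varepsilon)$: $|W(x,b)-W(x',b)|\le\varepsilon$ whenever $x_i=x'_i$ for $n-m\le i\le n+k+a$. Joint state $\psi_{p,W}(f\otimes b)=\int fW(\cdot,b)dp$ on $C(A^{\mathbb{Z}})\otimes\mathcal{B}^{\mathbb{Z}}\cong(\mathfrak{F}(A)\otimes\mathcal{B})^{\mathbb{Z}}$;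 $W$ ergodic if $\psi_{p,W}$ is ergodic (extreme among shift-invariant states) for every stationary ergodic $p$. $\psi_p$: $p$ as a state on $C(A^{\mathbb{Z}})$; $\psi_{q(p)}$: restriction of $\psi_{p,W}$ to $\mathcal{B}^{\mathbb{Z}}$. Entropy rate $s(\psi)=\lim_n\frac1nS(D_{\psi^n})$ ($\psi^n$ restriction to sites $1,\dots,n$, $S(D)=-\mathrm{tr}D\log D$); these limits exist for stationary states and for periodic (invariant under some power of the shift) states. $i(p,W)=s(\psi_p)+s(\psi_{q(p)})-s(\psi_{p,W})$. $C_{\mathrm{erg}}(W)=\sup\{i(p,W):p$ stationary ergodic$\}$; $C_{pp}(W)=\sup\{i(p,W):p$ periodic product$\}$, where $p$ is periodic product if for some $t\in\mathbb{N}$ and some distribution $\pi$ on $A^t$, $p$ is the product measure $\bigotimes_{k\in\mathbb{Z}}\pi$ over the blocks of coordinates $[kt+1,(k+1)t]$. A code $(u_i,b_i)_{i=1}^M$: $u_i\in A^n$, $0\le b_i\in\mathcal{B}^n$, $\sum b_i\le\mathbf{1}$; average error $\bar e=\frac1M\sum_i\sup_{x\in[u_i]}(1-W(x,b_i))$, $[u_i]$ the cylinder set. Logs base 2. *)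

(* Defs.v *)
From HB Require Import structures.
From mathcomp Require Import all_boot all_order all_algebra.
From mathcomp Require Import all_classical all_reals all_analysis.
From mathcomp Require Import complex.
Set Implicit Arguments. Unset Strict Implicit. Unset Printing Implicit Defensive.
Import Order.TTheory GRing.Theory Num.Theory numFieldNormedType.Exports.
Local Open Scope ring_scope.
Local Open Scope classical_set_scope.

(* Local configurations and operators.                                 *)
(* An orthonormal basis of the finite-dimensional Hilbert space H is   *)
(* indexed by a finite type I; B^{[n,n+k-1]} = L(H^{\otimes k}) is     *)
(* represented by matrices indexed by configurations {ffun 'I_k -> I}  *)
(* (site j of the window is the j-th tensor factor).                  *)

Definition cfg (X : finType) (k : nat) := {ffun 'I_k -> X}.

(* operators (matrices) on C^J, J finite, with complex entries R[i] *)
Definition op (R : realType) (J : finType) := J -> J -> R[i].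

(* operators on k sites *)
Definition bop (R : realType) (I : finType) (k : nat) := op R (cfg I k).

Section Ops.
Variables (R : realType).
Local Notation C := R[i].

Definition idop (J : finType) : op R J := fun s t => (s == t)%:R.
Definition zeroop (J : finType) : op R J := fun _ _ => 0.

(* positive semidefinite operator : 0 <= a *)
Definition psd (J : finType) (a : op R J) : Prop :=
  forall v : J -> C, 0 <= \sum_s \sum_t (v s)^* * a s t * v t.

(* a <= b in operator order *)
Definition ople (J : finType) (a b : op R J) : Prop :=
  psd (fun s t => b s t - a s t).

(* matrix unit |t><s| *)
Definition munit (J : finType) (t s : J) : op R J :=
  fun v u => ((v == t) && (u == s))%:R.

Definition log2 (x : R) : R := ln x / ln 2.

(* von Neumann entropy S(D) = - tr D log D, computed through a spectral
   decomposition D = \sum_j lam_j |e_j><e_j| with (e_j) orthonormal.   *)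
Definition vN_entropy (J : finType) (D : op R J) : R :=
  xget 0 [set r : R | exists (lam : J -> R) (e : J -> J -> C),
     (forall j j', \sum_u (e j u)^* * e j' u = (j == j')%:R) /\
     (forall s t, D s t = \sum_j (Complex (lam j) 0) * e j s * (e j t)^*) /\
     r = - \sum_j lam j * log2 (lam j)].
End Ops.

Section Sites.
Variables (X : finType).

(* restriction of a configuration on k+1 sites to the first k / last k *)
Definition cinit k (s : cfg X k.+1) : cfg X k :=
  [ffun i : 'I_k => s (widen_ord (leqnSn k) i)].
Definition ctail k (s : cfg X k.+1) : cfg X k :=
  [ffun i : 'I_k => s (lift ord0 i)].
End Sites.

Section Ext.
Variables (R : realType) (I : finType).

(* b (x) 1 and 1 (x) b *)
Definition extR k (b : bop R I k) : bop R I k.+1 :=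
  fun s t => b (cinit s) (cinit t) * (s ord_max == t ord_max)%:R.
Definition extL k (b : bop R I k) : bop R I k.+1 :=
  fun s t => (s ord0 == t ord0)%:R * b (ctail s) (ctail t).
End Ext.

(* States on the quasi-local algebra B^Z, given (equivalently) as      *)
(* consistent families of states on the local algebras: omega n k b is *)
(* the value on b in B^{[n, n+k-1]}.                                   *)
Section States.
Variables (R : realType) (I : finType).
Local Notation C := R[i].

Definition bfamily := int -> forall k : nat, bop R I k -> C.

Definition is_bstate (om : bfamily) : Prop :=
  forall (n : int) (k : nat),
    (forall (c : C) (b1 b2 : bop R I k),
        om n k (fun s t => c * b1 s t + b2 s t) = c * om n k b1 + om n k b2) /\
    (forall b, psd b -> 0 <= om n k b) /\
    om n k (@idop R _) = 1 /\
    (forall b, om n k b = om n k.+1 (extR b)) /\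
    (forall b, om n k b = om (n - 1) k.+1 (extL b)).

(* states on the joint quasi-local algebra (F(A) (x) B)^Z; a local      *)
(* element on k sites is a function A^k -> B^{(x) k}, i.e. a           *)
(* block-diagonal operator.                                            *)
Variable (A : finType).
Definition jop k := cfg A k -> bop R I k.
Definition jfamily := int -> forall k : nat, jop k -> C.

Definition is_jstate (ph : jfamily) : Prop :=
  forall (n : int) (k : nat),
    (forall (c : C) (F1 F2 : jop k),
        ph n k (fun a s t => c * F1 a s t + F2 a s t) = c * ph n k F1 + ph n k F2) /\
    (forall F : jop k, (forall a, psd (F a)) -> 0 <= ph n k F) /\
    ph n k (fun _ => @idop R _) = 1 /\
    (forall F : jop k, ph n k F = ph n k.+1 (fun a => extR (F (cinit a)))) /\
    (forall F : jop k, ph n k F = ph (n - 1) k.+1 (fun a => extL (F (ctail a)))).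

Definition shift_invariant (ph : jfamily) : Prop :=
  forall n k F, ph n k F = ph (n + 1) k F.

(* ergodic state: extreme point of the shift-invariant states *)
Definition ergodic_jstate (ph : jfamily) : Prop :=
  is_jstate ph /\ shift_invariant ph /\
  forall (ph1 ph2 : jfamily) (lam : R),
    is_jstate ph1 -> shift_invariant ph1 ->
    is_jstate ph2 -> shift_invariant ph2 ->
    0 < lam < 1 ->
    (forall n k F, ph n k F = (Complex lam 0) * ph1 n k F + (Complex (1 - lam) 0) * ph2 n k F) ->
    forall n k F, ph1 n k F = ph n k F.
End States.

(* The input space A^Z with its Borel (= cylinder) sigma-algebra.      *)
(* A, made a pointed type through the (irrelevant) point a0, so that the
   measure-theory library accepts A^Z as a measurable space *)
Definition Apt (A : finType) (a0 : A) : Type := A.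
HB.instance Definition _ (A : finType) (a0 : A) := Finite.on (@Apt A a0).
HB.instance Definition _ (A : finType) (a0 : A) := isPointed.Build (@Apt A a0) a0.
Definition seqA (A : finType) (a0 : A) := int -> @Apt A a0.

Definition window (A : finType) (x : int -> A) (n : int) (k : nat) : cfg A k :=
  [ffun i : 'I_k => x (n + (i : nat)%:Z)].

Definition cylinders (A : finType) (a0 : A) : set (set (seqA a0)) :=
  [set E | exists (n : int) (k : nat) (a : cfg A k),
       E = [set x | window x n k = a]].
Arguments cylinders {A} a0.

(* A^Z with the sigma-algebra generated by cylinder sets, which is the *)
(* Borel sigma-algebra of the product topology (A finite).             *)
Definition SA (A : finType) (a0 : A) := @g_sigma_algebraType (int -> @Apt A a0) (cylinders a0).

Definition shiftx (A : finType) (x : int -> A) : int -> A := fun i => x (i + 1).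

Section Channel.
Variables (R : realType) (A : finType) (a0 : A) (I : finType).
Local Notation C := R[i].
Local Notation SA := (SA a0).

Definition stationary (p : probability SA R) : Prop :=
  forall E : set SA, measurable E -> p (@shiftx A @^-1` E) = p E.

Definition ergodic (p : probability SA R) : Prop :=
  forall E : set SA, measurable E -> @shiftx A @^-1` E = E ->
    p E = 0%E \/ p E = 1%E.

(* a candidate channel: W x n k b = W(x, b) for b in B^{[n,n+k-1]} *)
Definition chan := (int -> A) -> bfamily R I.

Definition cq_channel (W : chan) : Prop :=
  (forall x, is_bstate (W x)) /\
  (forall n k b, measurable_fun [set: SA] (fun x : SA => complex.Re (W x n k b)) /\
                 measurable_fun [set: SA] (fun x : SA => complex.Im (W x n k b))).

(* W(T_in x, b) = W(x, T_out b), T_out moving site j to site j+1 *)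
Definition stationary_channel (W : chan) : Prop :=
  forall x n k b, W (@shiftx A x) n k b = W x (n + 1) k b.

(* DIMA; b in B^{[n,n+k]} i.e. k+1 sites *)
Definition dima (W : chan) : Prop :=
  forall eps : R, 0 < eps -> exists m0 a1 : nat,
    forall (n : int) (k : nat) (b : bop R I k.+1),
      psd b -> ople b (@idop R _) ->
      forall m a : nat, (m0 <= m)%N -> (a1 <= a)%N ->
      forall x x' : int -> A,
        (forall i : int, n - m%:Z <= i <= n + k%:Z + a%:Z -> x i = x' i) ->
        `|W x n k.+1 b - W x' n k.+1 b| <= (Complex eps 0).

(* complex integral w.r.t. p *)
Definition cint (p : probability SA R) (g : SA -> C) : C :=
  Complex (Rintegral p [set: SA] (fun x => complex.Re (g x)))
          (Rintegral p [set: SA] (fun x => complex.Im (g x))).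

(* the joint state psi_{p,W}: value on F in the local algebra at [n,n+k-1] *)
Definition psiPW (p : probability SA R) (W : chan) : jfamily R I A :=
  fun n k F => cint p (fun x : SA => W x n k (F (window x n k))).

Definition ergodic_channel (W : chan) : Prop :=
  forall p : probability SA R, stationary p -> ergodic p ->
    ergodic_jstate (psiPW p W).

(* density matrices of the restrictions to sites 1..n *)
Definition dens_joint (ph : jfamily R I A) (n : nat) : op R (cfg A n * cfg I n)%type :=
  fun u v => if u.1 == v.1 then
      ph 1 n (fun a => if a == u.1 then @munit R _ v.2 u.2 else @zeroop R _)
    else 0.
Definition dens_in (ph : jfamily R I A) (n : nat) : op R (cfg A n) :=
  fun a a' => if a == a' then
      ph 1 n (fun a'' => if a'' == a then @idop R _ else @zeroop R _)
    else 0.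
Definition dens_out (ph : jfamily R I A) (n : nat) : op R (cfg I n) :=
  fun s t => ph 1 n (fun _ => @munit R _ t s).

Arguments dens_joint ph n : clear implicits.
Arguments dens_in ph n : clear implicits.
Arguments dens_out ph n : clear implicits.
Arguments psiPW p W : clear implicits.

Definition entropy_rate (S : nat -> R) : R :=
  limn (fun n : nat => S n / n%:R).

Definition info (p : probability SA R) (W : chan) : R :=
  entropy_rate (fun n => @vN_entropy R _ (dens_in (psiPW p W) n))
  + entropy_rate (fun n => @vN_entropy R _ (dens_out (psiPW p W) n))
  - entropy_rate (fun n => @vN_entropy R _ (dens_joint (psiPW p W) n)).

(* periodic product measure: product of pi : A^t -> [0,1] over the
   blocks [kt+1, (k+1)t], k in Z *)
Definition periodic_product (p : probability SA R) : Prop :=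
  exists (t : nat) (pi : cfg A t -> R),
    (0 < t)%N /\ (forall a, 0 <= pi a) /\ \sum_a pi a = 1 /\
    forall (m : int) (N : nat) (a : nat -> A),
      p [set x : SA | forall j : nat, (j < N * t)%N ->
                       x (m * t%:Z + 1 + j%:Z) = a j]
      = (\prod_(k < N) pi [ffun j : 'I_t => a (k * t + j)%N])%:E.

Definition C_erg (W : chan) : R :=
  sup [set r : R | exists p : probability SA R,
         stationary p /\ ergodic p /\ r = info p W].

Definition C_pp (W : chan) : R :=
  sup [set r : R | exists p : probability SA R,
         periodic_product p /\ r = info p W].

(* codes of blocklength n: u_i in A^n (sites 1..n), b_i in B^n *)
Definition is_code (n M : nat) (u : 'I_M -> cfg A n) (b : 'I_M -> bop R I n) : Prop :=
  (forall i, psd (b i)) /\ ople (fun s t => \sum_i b i s t) (@idop R _).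

Definition avg_err (W : chan) (n M : nat) (u : 'I_M -> cfg A n) (b : 'I_M -> bop R I n) : R :=
  M%:R^-1 * \sum_(i < M)
    sup [set complex.Re (1 - W x 1 n (b i)) | x in [set x : int -> A | window x 1 n = u i]].
End Channel.
Arguments dens_joint {R A I} ph n.
Arguments dens_in {R A I} ph n.
Arguments dens_out {R A I} ph n.
Arguments psiPW {R A a0 I} p W.

(* Main.v *)
Require Import Defs.
From HB Require Import structures.
From mathcomp Require Import all_boot all_order all_algebra.
From mathcomp Require Import all_classical all_reals all_analysis.
From mathcomp Require Import measurable_realfun complex.
From mathcomp Require Import ring lra zify.
(** The tool is the monotonicity of relative entropy, which follows from the
    integral representation of the logarithm because the integrand at each
    parameter is a supremum over operators, and operators of a subsystem are
    among the competitors. It gives strong subadditivity, concavity and a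
    Fannes-type continuity bound; compared with a two-outcome measurement it
    shows that a test accepting the joint state with probability r and the
    product of its marginals with probability at most 1/M forces the mutual
    information to be at least r log M - 1.

    A code with words u_i gives the periodic product measure with block law
    pi(a) = #{i | u_i = a} / M, and its decoder is such a test with
    r >= 1 - avg_err. Independence of the input blocks makes the mutual
    information superadditive over blocks, so it is at most n C_pp.

    For C_erg <= C_pp, replace a stationary p by the product of its marginals
    on long blocks: by DIMA the output on all but a bounded part of each block
    changes by at most 2 eps, hence the entropy densities change by O(eps).
    For C_pp <= C_erg, average a t-periodic product measure over t shifts: the
    average is stationary, is ergodic since distant blocks are independent, and
    loses nothing in the information rate because the entropy of a mixture of
    t states is at least the mean entropy and at most that mean plus log t. *)
Set Implicit Arguments. Unset Strict Implicit. Unset Printing Implicit Defensive.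
Import Order.TTheory GRing.Theory Num.Theory numFieldNormedType.Exports.
Local Open Scope ring_scope.
Local Open Scope sesquilinear_scope.

(** The definitions force two preliminaries. [vN_entropy] picks an element of a set described by
    spectral decompositions, so it can be computed only once all decompositions of an operator give
    the same value; Klein's inequality for an operator against itself does this. [info], [C_pp] and
    [C_erg] use [limn] and [sup], which are informative only if the limits exist and the sets are
    nonempty and bounded: hence a Fekete lemma for periodic sequences, dimension bounds, and a
    construction of periodic product measures from Lebesgue measure. The classical input is embedded
    as block-diagonal matrices, so input, output and joint entropies obey the same matrix
    inequalities. Input and output windows vary independently, since DIMA controls only outputs well
    inside the input window. No integral over the parameter of the logarithm is formed: primitives
    are compared by the mean value theorem and their growth at infinity is bounded explicitly.
    Constants in the continuity bounds are crude, as they vanish after division by the window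
    length. *)

Section ComplexFacts.
Variable R : realType.
Local Notation C := R[i].
Local Notation toC := (real_complex R).
Implicit Types z w : C.

(** The squared modulus, valued in [R] so that it can serve as a weight next to real eigenvalues. *)
Definition nsq z : R := complex.Re z ^+ 2 + complex.Im z ^+ 2.

Lemma nsq_ge0 z : 0 <= nsq z. Proof. by rewrite addr_ge0 ?sqr_ge0. Qed.

Lemma conjCE z : z^* = Complex (complex.Re z) (- complex.Im z).
Proof. by case: z. Qed.

Lemma mulCJ z : z * z^* = toC (nsq z).
Proof.
rewrite conjCE; case: z => a b; rewrite /nsq /= /GRing.mul /= /real_complex_def.
congr Complex; ring.
Qed.

Lemma nsqJ z : nsq z^* = nsq z.
Proof. by rewrite conjCE /nsq /= sqrrN. Qed.

Lemma nsqM z w : nsq (z * w) = nsq z * nsq w.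
Proof.
case: z => a b; case: w => c d; rewrite /nsq /=; ring.
Qed.

Lemma cReD z w : complex.Re (z + w) = complex.Re z + complex.Re w.
Proof. by case: z w => a b []. Qed.
Lemma cImD z w : complex.Im (z + w) = complex.Im z + complex.Im w.
Proof. by case: z w => a b []. Qed.
Lemma cReB z w : complex.Re (z - w) = complex.Re z - complex.Re w.
Proof. by case: z w => a b []. Qed.
Lemma cReM z w : complex.Re (z * w) =
  complex.Re z * complex.Re w - complex.Im z * complex.Im w.
Proof. by case: z w => a b []. Qed.
Lemma cImM z w : complex.Im (z * w) =
  complex.Re z * complex.Im w + complex.Im z * complex.Re w.
Proof. by case: z w => a b []. Qed.
Lemma Re_toCl (x : R) z : complex.Re (toC x * z) = x * complex.Re z.
Proof. by rewrite cReM /= mul0r subr0. Qed.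
Lemma Im_toCl (x : R) z : complex.Im (toC x * z) = x * complex.Im z.
Proof. by rewrite cImM /= mul0r addr0. Qed.

Lemma cRe_sum (J : Type) (r : seq J) (P : pred J) (F : J -> C) :
  complex.Re (\sum_(j <- r | P j) F j) = \sum_(j <- r | P j) complex.Re (F j).
Proof. exact: (big_morph _ cReD). Qed.
Lemma cIm_sum (J : Type) (r : seq J) (P : pred J) (F : J -> C) :
  complex.Im (\sum_(j <- r | P j) F j) = \sum_(j <- r | P j) complex.Im (F j).
Proof. exact: (big_morph _ cImD). Qed.

Lemma ge0_toC z : 0 <= z -> z = toC (complex.Re z).
Proof. by rewrite lecE /= => /andP[/eqP h _]; case: z h => a b /= ->. Qed.

Lemma ge0_Re z : 0 <= z -> 0 <= complex.Re z.
Proof. by rewrite lecE /= => /andP[_ h]. Qed.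

Lemma toC_inj : injective toC. Proof. by move=> x y []. Qed.

Lemma toC_ge0 (x : R) : (0 <= toC x) = (0 <= x).
Proof. by rewrite lecE /= eqxx. Qed.

Lemma conj_toC (x : R) : (toC x)^* = toC x.
Proof. by rewrite conjCE /= oppr0. Qed.

Lemma conjC_eqP z w : complex.Re z = complex.Re w -> complex.Im z = complex.Im w -> z = w.
Proof. by case: z w => a b [c d] /= -> ->. Qed.

End ComplexFacts.

(** * Operators as matrices, and the spectral theorem for positive ones *)

Section OpAlgebra.
Variables (R : realType) (J : finType).
Local Notation C := R[i].
Local Notation toC := (real_complex R).
Implicit Types a b c : op R J.

Lemma opP a b : (forall s t, a s t = b s t) -> a = b.
Proof. by move=> h; apply/funext => s; apply/funext => t. Qed.

Definition opm a b : op R J := fun s t => \sum_u a s u * b u t.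
Definition adj a : op R J := fun s t => (a t s)^*.
Definition dg (r : J -> R) : op R J := fun s t => toC (r s) *+ (s == t).
Definition tr a : C := \sum_s a s s.

Lemma opmA a b c : opm a (opm b c) = opm (opm a b) c.
Proof.
apply: opP => s t; rewrite /opm.
under eq_bigr do rewrite mulr_sumr.
rewrite exchange_big /=; apply: eq_bigr => u _; rewrite mulr_suml.
by apply: eq_bigr => v _; rewrite mulrA.
Qed.

Lemma opm1l a : opm (@idop R J) a = a.
Proof.
apply: opP => s t; rewrite /opm /idop (bigD1 s) //= eqxx mul1r big1 ?addr0 //.
by move=> u /negbTE; rewrite eq_sym => ->; rewrite mul0r.
Qed.

Lemma opm1r a : opm a (@idop R J) = a.
Proof.
apply: opP => s t; rewrite /opm /idop (bigD1 t) //= eqxx mulr1 big1 ?addr0 //.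
by move=> u /negbTE ->; rewrite mulr0.
Qed.

Lemma adjM a b : adj (opm a b) = opm (adj b) (adj a).
Proof.
apply: opP => s t; rewrite /adj /opm rmorph_sum; apply: eq_bigr => u _.
by rewrite rmorphM mulrC.
Qed.

Lemma adjK a : adj (adj a) = a.
Proof. by apply: opP => s t; rewrite /adj conjCK. Qed.

Lemma adj_dg r : adj (dg r) = dg r.
Proof.
apply: opP => s t; rewrite /adj /dg eq_sym; case: eqP => [->|_] /=.
  by rewrite !mulr1n conj_toC.
by rewrite !mulr0n conjC0.
Qed.

Lemma tr_opmC a b : tr (opm a b) = tr (opm b a).
Proof.
rewrite /tr /opm exchange_big /=; apply: eq_bigr => s _.
by apply: eq_bigr => t _; rewrite mulrC.
Qed.

Lemma dgl r a s t : opm (dg r) a s t = toC (r s) * a s t.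
Proof.
rewrite /opm (bigD1 s) //= /dg eqxx mulr1n big1 ?addr0 // => u /negbTE.
by rewrite eq_sym => ->; rewrite mulr0n mul0r.
Qed.

Lemma dgr r a s t : opm a (dg r) s t = a s t * toC (r t).
Proof.
rewrite /opm (bigD1 t) //= /dg eqxx mulr1n big1 ?addr0 // => u /negbTE ->.
by rewrite mulr0n mulr0.
Qed.

Lemma trD a b : tr (fun s t => a s t + b s t) = tr a + tr b.
Proof. by rewrite /tr big_split. Qed.

Definition unitaryop (U : op R J) :=
  opm (adj U) U = @idop R J /\ opm U (adj U) = @idop R J.

(** Spectral data are carried as arguments, so that each proof may work in whichever eigenbasis it
    is given. Eigenvalues are real by type; their signs are separate hypotheses. *)
Definition rdec (D : op R J) (r : J -> R) (U : op R J) :=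
  unitaryop U /\ D = opm (opm U (dg r)) (adj U).

(* mathcomp's matrices supply the one-sided-inverse and spectral theorems *)
Definition mx_of a : 'M[C]_#|J| := \matrix_(i, j) a (enum_val i) (enum_val j).
Definition op_of (A : 'M[C]_#|J|) : op R J := fun s t => A (enum_rank s) (enum_rank t).

Lemma mx_ofK a : op_of (mx_of a) = a.
Proof. by apply: opP => s t; rewrite /op_of mxE !enum_rankK. Qed.
Lemma op_ofK A : mx_of (op_of A) = A.
Proof. by apply/matrixP => i j; rewrite mxE /op_of !enum_valK. Qed.

Lemma op_ofM A B : op_of (A *m B) = opm (op_of A) (op_of B).
Proof.
apply: opP => s t; rewrite /op_of mxE /opm.
by rewrite (reindex (@enum_rank J)) //=; apply: onW_bij; exact: enum_rank_bij.
Qed.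

Lemma op_of1 : op_of 1%:M = @idop R J.
Proof. by apply: opP => s t; rewrite /op_of mxE /idop (inj_eq enum_rank_inj). Qed.

Lemma mx_ofM a b : mx_of (opm a b) = mx_of a *m mx_of b.
Proof. by rewrite -[RHS]op_ofK op_ofM !mx_ofK. Qed.

Lemma opm_inv a b : opm a b = @idop R J -> opm b a = @idop R J.
Proof.
move=> h; have: mx_of a *m mx_of b = 1%:M by rewrite -mx_ofM h -op_of1 op_ofK.
by move/mulmx1C => h'; rewrite -[a]mx_ofK -[b]mx_ofK -op_ofM h' op_of1.
Qed.

Lemma unitaryopP U : opm (adj U) U = @idop R J -> unitaryop U.
Proof. by move=> h; split=> //; exact: opm_inv. Qed.

Definition qf (v : J -> C) a : C := \sum_s \sum_t (v s)^* * a s t * v t.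

(** Polarisation: [psd] only says that the quadratic form is nonnegative, but a form that is real at
    e_s, e_s + e_t and e_s + i e_t already determines each entry as the conjugate of its
    transpose. *)
Lemma psd_herm a : psd a -> adj a = a.
Proof.
move=> pa; have P v : complex.Im (qf v a) = 0.
  by rewrite [qf v a](ge0_toC (pa v)).
have Q s t (x y : C) : s != t ->
    qf (fun u => x *+ (u == s) + y *+ (u == t)) a =
    x^* * a s s * x + x^* * a s t * y + y^* * a t s * x + y^* * a t t * y.
  move=> st; rewrite /qf.
  have E (F : J -> C) : (forall u, u != s -> u != t -> F u = 0) -> \sum_u F u = F s + F t.
    move=> h; rewrite (bigD1 s) //= (bigD1 t) /=; last by rewrite eq_sym.
    by rewrite big1 ?addr0 // => u /andP[us ut]; exact: h.
  have ts : (t == s) = false by rewrite eq_sym (negbTE st).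
  rewrite E; last first.
    move=> u /negbTE us /negbTE ut; apply: big1 => v _.
    by rewrite us ut !mulr0n addr0 conjC0 !mul0r.
  rewrite !E; first last.
  - by move=> u /negbTE us /negbTE ut; rewrite us ut !mulr0n addr0 mulr0.
  - by move=> u /negbTE us /negbTE ut; rewrite us ut !mulr0n addr0 mulr0.
  by rewrite !eqxx ts (negbTE st) !mulr0n !mulr1n !addr0 !add0r !addrA.
have Dg s : complex.Im (a s s) = 0.
  have := P (fun u => 1 *+ (u == s)); rewrite /qf (bigD1 s) //= [X in _ + X]big1; last first.
    by move=> u /negbTE us; apply: big1 => v _; rewrite us mulr0n conjC0 !mul0r.
  rewrite (bigD1 s) //= [X in _ + X + _]big1; last first.
    by move=> v /negbTE us; rewrite us mulr0n !mulr0.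
  by rewrite eqxx mulr1n conjC1 mul1r mulr1 !addr0.
apply: opP => s t; have [<-|st] := eqVneq s t.
  by apply: conjC_eqP; rewrite /adj conjCE /= // Dg oppr0.
have := P (fun u => 1 *+ (u == s) + 1 *+ (u == t)).
have := P (fun u => 1 *+ (u == s) + 'i%C *+ (u == t)).
rewrite !Q // !conjCE /= ?cImD ?cImM /= ?cReM ?cImM /= ?Dg => h1 h2.
by apply: conjC_eqP; rewrite /adj conjCE /=; lra.
Qed.

Lemma psd_rdec a : psd a -> exists r U, rdec a r U /\ (forall j, 0 <= r j).
Proof.
move=> pa; have ha := psd_herm pa.
have hh : mx_of a \is normalmx.
  apply/normalmxP; suff -> : (mx_of a) ^t* = mx_of a by [].
  apply/matrixP => i j; rewrite !mxE.
  by have := congr1 (fun f => f (enum_val i) (enum_val j)) ha.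
have [[P d] /= Pu E] := orthomx_spectral_subproof hh.
pose U := op_of (P ^t*).
have UA : adj U = op_of P.
  by apply: opP => s t; rewrite /adj /U /op_of !mxE conjCK.
have uU : unitaryop U.
  apply: unitaryopP; rewrite UA -op_ofM -op_of1; congr op_of; exact/unitarymxP.
have aE s t : a s t = \sum_j U s j * d 0 (enum_rank j) * (U t j)^*.
  have -> : a s t = op_of (P ^t* *m diag_mx d *m P) s t.
    by rewrite -(invmx_unitary Pu) -E mx_ofK.
  rewrite op_ofM -UA /opm; apply: eq_bigr => j _; congr (_ * _).
  rewrite /op_of !mxE (bigD1 (enum_rank j)) //= !mxE eqxx mulr1n big1 ?addr0.
    by rewrite /U /op_of !mxE.
  by move=> i /negbTE h; rewrite !mxE h mulr0n mulr0.
(* The spectral theorem for normal matrices yields complex eigenvalues. Each is the value of the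
   quadratic form at its eigenvector, hence real and nonnegative. *)
have dE j : d 0 (enum_rank j) = qf (fun s => U s j) a.
  have := congr1 (fun f => opm (adj U) (opm f U) j j)
    (opP (b := opm (opm U (fun s t => d 0 (enum_rank s) *+ (s == t))) (adj U))
     (a := a) (fun s t => _)).
  move/(_ _) => H.
  have -> : qf (fun s => U s j) a = opm (adj U) (opm a U) j j.
    rewrite /qf /opm; apply: eq_bigr => s _; rewrite mulr_sumr.
    by apply: eq_bigr => t _; rewrite mulrA.
  rewrite H.
    by rewrite !opmA uU.1 opm1l -opmA uU.1 opm1r eqxx mulr1n.
  move=> s t; rewrite aE /opm; apply: eq_bigr => u _; congr (_ * _).
  rewrite (bigD1 u) //= eqxx mulr1n big1 ?addr0 // => v /negbTE ->.
  by rewrite mulr0n mulr0.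
have dge j : 0 <= d 0 (enum_rank j) by rewrite dE; exact: pa.
exists (fun j => complex.Re (d 0 (enum_rank j))), U; split; last by move=> j; exact: ge0_Re.
split=> //; apply: opP => s t; rewrite aE /opm; apply: eq_bigr => u _; congr (_ * _).
by rewrite -/(opm U _ s u) dgr; congr (_ * _); exact: ge0_toC.
Qed.

End OpAlgebra.

(** * Scalar form of the integral formula for relative entropy *)

Section RelativeEntropyIntegral.
Variable R : realType.

Lemma is_derive_bigsum (P : Type) (l : seq P) (F : P -> R -> R) (f : P -> R) (x : R) :
  (forall p, is_derive x 1 (F p) (f p)) ->
  is_derive x 1 (fun s => \sum_(p <- l) F p s) (\sum_(p <- l) f p).
Proof.
move=> h; elim: l => [|p l IH].
  rewrite big_nil.
  have -> : (fun s : R => \sum_(p <- [::]) F p s) = cst 0.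
    by apply/funext => s; rewrite big_nil.
  exact: is_derive_cst.
rewrite big_cons.
have -> : (fun s : R => \sum_(q <- p :: l) F q s) =
    F p + (fun s => \sum_(q <- l) F q s).
  by apply/funext => s; rewrite big_cons.
exact: is_deriveD.
Qed.

Lemma nondecreasing_of_derive (G g : R -> R) (b : R) : 0 < b ->
  (forall s : R, 0 <= s -> is_derive s 1 G (g s)) -> (forall s : R, 0 < s -> 0 <= g s) ->
  G 0 <= G b.
Proof.
move=> b0 dG g0.
have [||c] := @MVT R G g 0 b b0.
- by move=> x; rewrite in_itv /= => /andP[/ltW x0 _]; exact: dG.
- apply: derivable_within_continuous => x; rewrite in_itv /= => /andP[x0 _].
  by have [] := dG x x0.
rewrite in_itv /= => /andP[c0 _] E.
by rewrite -subr_ge0 E subr0 mulr_ge0 ?(ltW b0) ?g0.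
Qed.

Variable P : finType.
Implicit Types w x y : P -> R.

(** In use an index is a pair of eigenvectors, [w] is their squared overlap, and [x], [y] are the
    eigenvalues of the first and second operator. The last condition is the inclusion of
    supports. *)
Definition dinv_admissible w x y :=
  [/\ forall p, 0 <= w p, forall p, 0 <= x p, forall p, 0 <= y p &
      forall p, y p = 0 -> w p * x p = 0].

(** [dint] is the primitive of [dpart] vanishing at 0. Since ln (y + s x) - ln s tends to ln x,
    subtracting ln s times the mass from [dint] gives [dlog], the relative entropy, as s grows. *)
Definition dpart w x y (s : R) : R :=
  \sum_p w p * x p ^+ 2 / (y p + s * x p).
Definition dint w x y (s : R) : R :=
  \sum_p (w p * x p) * (ln (y p + s * x p) - ln (y p)).
Definition dlog w x y : R := \sum_p (w p * x p) * (ln (x p) - ln (y p)).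

Lemma dint_derive w x y (s : R) : dinv_admissible w x y -> 0 <= s ->
  is_derive s 1 (dint w x y) (dpart w x y s).
Proof.
case=> w0 x0 y0 k s0; apply: is_derive_bigsum => p.
have [z|nz] := eqVneq (w p * x p) 0.
  have -> : w p * x p ^+ 2 / (y p + s * x p) = 0.
    by rewrite expr2 mulrA z !mul0r.
  have -> : (fun s => w p * x p * (ln (y p + s * x p) - ln (y p))) = cst 0.
    by apply/funext => r; rewrite z mul0r.
  exact: is_derive_cst.
have yp : 0 < y p.
  by rewrite lt_neqAle y0 andbT eq_sym; apply: contra nz => /eqP /k ->.
have xp : 0 < x p.
  by rewrite lt_neqAle x0 andbT eq_sym; apply: contra nz => /eqP ->; rewrite mulr0.
have dp : 0 < y p + s * x p by rewrite ltr_pwDl ?mulr_ge0.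
have d1 : is_derive s 1 (fun s => y p + s * x p) (x p).
  have -> : (fun s => y p + s * x p) = (fun _ => y p) + (x p *: id).
    by apply/funext => r; rewrite /= mulrC.
  rewrite [X in is_derive _ _ _ X](_ : _ = 0 + x p *: 1); last first.
    by rewrite add0r /GRing.scale /= mulr1.
  by apply: is_deriveD; apply: is_deriveZ.
have d2 := @is_derive1_comp R (@ln R) (fun s => y p + s * x p) s _ _ (is_derive1_ln dp) d1.
have -> : (fun s => w p * x p * (ln (y p + s * x p) - ln (y p))) =
   (w p * x p) *: ((ln (R:=R) \o (fun s => y p + s * x p)) - cst (ln (y p))).
  by apply/funext.
have -> : w p * x p ^+ 2 / (y p + s * x p) =
   (w p * x p) *: ((y p + s * x p)^-1 * x p - 0).
  by rewrite subr0 /GRing.scale /= expr2; ring.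
apply: is_deriveZ; apply: is_deriveB.
Qed.

(** This lemma and [dint_le_dlog] stand in for the limit at infinity: termwise y + s x lies above s
    x, and exceeds it by a factor whose logarithm is at most y / (s x). *)
Lemma dlog_le_dint w x y s : dinv_admissible w x y -> 0 < s ->
  dlog w x y <= dint w x y s - ln s * \sum_p w p * x p.
Proof.
case=> w0 x0 y0 k s0; rewrite /dlog /dint mulr_sumr -sumrB.
apply: ler_sum => p _.
have [z|nz] := eqVneq (w p * x p) 0; first by rewrite z !mul0r mulr0 subr0.
have xp : 0 < x p.
  by rewrite lt_neqAle x0 andbT eq_sym; apply: contra nz => /eqP ->; rewrite mulr0.
rewrite [ln s * _]mulrC -mulrBr ler_wpM2l ?mulr_ge0 //.
have -> : ln (y p + s * x p) - ln (y p) - ln s = (ln (y p + s * x p) - ln s) - ln (y p).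
  by ring.
rewrite lerB // lerBrDr -lnM ?posrE //.
by rewrite ler_ln ?posrE ?mulr_gt0 ?ltr_wpDl ?mulr_gt0 // mulrC lerDr.
Qed.

Lemma dint_le_dlog w x y s : dinv_admissible w x y -> 0 < s ->
  dint w x y s - ln s * \sum_p w p * x p <= dlog w x y + (\sum_p w p * y p) / s.
Proof.
case=> w0 x0 y0 k s0; rewrite /dlog /dint mulr_sumr -sumrB mulr_suml -big_split /=.
apply: ler_sum => p _.
have [z|nz] := eqVneq (w p * x p) 0.
  by rewrite z !mul0r mulr0 subr0 add0r !mulr_ge0 // invr_ge0 ltW.
have yp : 0 < y p.
  by rewrite lt_neqAle y0 andbT eq_sym; apply: contra nz => /eqP /k ->.
have xp : 0 < x p.
  by rewrite lt_neqAle x0 andbT eq_sym; apply: contra nz => /eqP ->; rewrite mulr0.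
have sx : 0 < s * x p by rewrite mulr_gt0.
have yx : 0 < y p / (s * x p) by rewrite divr_gt0.
have E : ln (y p + s * x p) = ln s + ln (x p) + ln (1 + y p / (s * x p)).
  rewrite -!lnM ?posrE ?addr_gt0 //; congr ln.
  by rewrite mulrDr mulr1 [in RHS]mulrCA divff ?gt_eqF // mulr1 addrC.
have L : ln (1 + y p / (s * x p)) <= y p / (s * x p).
  by apply: le_ln1Dx; apply: lt_trans yx; rewrite oppr_lt0.
have -> : w p * y p / s = w p * x p * (y p / (s * x p)).
  by field; rewrite ?gt_eqF.
rewrite E [ln s * _]mulrC -mulrBr -mulrDr ler_wpM2l ?mulr_ge0 //.
by lra.
Qed.

End RelativeEntropyIntegral.

(* D(rho||sigma) = int_0^oo (f_s - tr rho/(1+s)) ds with f_s = dpart, so an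
   inequality between the f_s integrates to one between relative entropies. *)
Lemma dlog_mono (R : realType) (P P' : finType) (w x y : P -> R) (w' x' y' : P' -> R) :
  dinv_admissible w x y -> dinv_admissible w' x' y' ->
  \sum_p w' p * x' p = \sum_p w p * x p ->
  (forall s, 0 < s -> dpart w' x' y' s <= dpart w x y s) ->
  dlog w' x' y' <= dlog w x y.
Proof.
move=> a a' eT h; apply/ler_addgt0Pr => e e0.
set K := \sum_p w p * y p.
have K0 : 0 <= K.
  by case: a => w0 x0 y0 _; apply: sumr_ge0 => p _; rewrite mulr_ge0.
(* With this s the error K / s from [dint_le_dlog] is at most e; the summand 1 keeps s positive when
   K = 0. *)
pose s := K / e + 1; have s0 : 0 < s by rewrite ltr_wpDl // divr_ge0 // ltW.
apply: (le_trans (dlog_le_dint a' s0)).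
have Fle : dint w' x' y' s <= dint w x y s.
  have := @nondecreasing_of_derive R (dint w x y - dint w' x' y')
    (fun s => dpart w x y s - dpart w' x' y' s) s s0.
  have Z (Q : finType) (u v z : Q -> R) : dint u v z 0 = 0.
    by rewrite /dint big1 // => p _; rewrite mul0r addr0 subrr mulr0.
  have -> : (dint w x y - dint w' x' y') 0 = 0.
    by rewrite /GRing.add /GRing.opp /= !Z subrr.
  have -> : (dint w x y - dint w' x' y') s = dint w x y s - dint w' x' y' s by [].
  rewrite subr_ge0; apply.
    by move=> r r0; apply: is_deriveB; exact: dint_derive.
  by move=> r r0; rewrite subr_ge0 h.
rewrite eT; apply: le_trans (_ : dint w x y s - ln s * \sum_p w p * x p <= _).
  by rewrite lerD2r.
apply: le_trans (dint_le_dlog a s0) _; rewrite -/K lerD2l.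
rewrite ler_pdivrMr // /s mulrDr mulr1 mulrCA divff ?gt_eqF // mulr1.
by rewrite lerDl ltW.
Qed.

(** * Variational formula for the integrand, and Klein's inequality *)

Section Variational.
Variables (R : realType) (J : finType).
Local Notation toC := (real_complex R).
Implicit Types (rho sig Y : op R J) (r q : J -> R) (U V : op R J).

(** Its supremum over Y is [dpart] at s: in the two eigenbases it splits into one concave quadratic
    for each pair of eigenvectors. The expression itself mentions no eigenvectors, so it can be
    compared between different systems. *)
Definition vform rho sig (s : R) Y : R :=
  complex.Re (tr (opm rho Y)) *+ 2 - complex.Re (tr (opm sig (opm Y (adj Y))))
  - s * complex.Re (tr (opm rho (opm (adj Y) Y))).

(** A doubly stochastic matrix, which is why masses weighted by it come out as traces. *)
Definition ovl U V (p : J * J) : R := nsq (opm (adj U) V p.1 p.2).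

Lemma tr_conj D U : unitaryop U -> tr (opm (adj U) (opm D U)) = tr D.
Proof. by case=> _ h; rewrite tr_opmC -opmA h opm1r. Qed.

Lemma tr_dec r U Y : tr (opm (opm (opm U (dg r)) (adj U)) Y) =
  \sum_i toC (r i) * opm (adj U) (opm Y U) i i.
Proof.
rewrite -!opmA tr_opmC -!opmA /tr; apply: eq_bigr => i _.
by rewrite dgl.
Qed.

Lemma opm_adj_diag Y i : opm Y (adj Y) i i = toC (\sum_j nsq (Y i j)).
Proof.
rewrite /opm rmorph_sum; apply: eq_bigr => j _; exact: mulCJ.
Qed.

Lemma adj_opm_diag Y i : opm (adj Y) Y i i = toC (\sum_j nsq (Y j i)).
Proof.
rewrite /opm rmorph_sum; apply: eq_bigr => j _; rewrite mulrC; exact: mulCJ.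
Qed.

Lemma vformE rho sig r q U V s Y : rdec rho r U -> rdec sig q V ->
  vform rho sig s Y = \sum_(p : J * J)
   let z := opm (opm (adj V) Y) U p.2 p.1 in
   (r p.1 * complex.Re (opm (adj U) V p.1 p.2 * z) *+ 2 - (q p.2 + s * r p.1) * nsq z).
Proof.
move=> [uU ->] [uV ->]; rewrite /vform !tr_dec.
set Z := opm (opm (adj V) Y) U.
have E1 : opm (adj U) (opm Y U) = opm (opm (adj U) V) Z.
  by rewrite /Z -!opmA [opm V _]opmA uV.2 opm1l.
have E2 : opm (adj V) (opm (opm Y (adj Y)) V) = opm Z (adj Z).
  rewrite /Z !adjM adjK -!opmA; congr (opm _ (opm _ _)).
  by rewrite [opm U _]opmA uU.2 opm1l.
have E3 : opm (adj U) (opm (opm (adj Y) Y) U) = opm (adj Z) Z.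
  rewrite /Z !adjM adjK -!opmA; congr (opm _ (opm _ _)).
  by rewrite [opm V _]opmA uV.2 opm1l.
rewrite E1 E2 E3 !cRe_sum.
rewrite -(pair_bigA _ (fun i j => r i * complex.Re (opm (adj U) V i j * Z j i) *+ 2
   - (q j + s * r i) * nsq (Z j i))) /=.
have F1 : \sum_i complex.Re (toC (r i) * opm (opm (adj U) V) Z i i) =
   \sum_i \sum_j r i * complex.Re (opm (adj U) V i j * Z j i).
  by apply: eq_bigr => i _; rewrite Re_toCl cRe_sum mulr_sumr.
have F2 : \sum_j complex.Re (toC (q j) * opm Z (adj Z) j j) =
   \sum_i \sum_j q j * nsq (Z j i).
  rewrite exchange_big /=; apply: eq_bigr => j _.
  by rewrite Re_toCl opm_adj_diag mulr_sumr.
have F3 : \sum_i complex.Re (toC (r i) * opm (adj Z) Z i i) =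
   \sum_i \sum_j r i * nsq (Z j i).
  by apply: eq_bigr => i _; rewrite Re_toCl adj_opm_diag mulr_sumr.
rewrite F1 F2 F3 mulr_sumr -sumrMnl -!sumrB; apply: eq_bigr => i _.
rewrite mulr_sumr -sumrMnl -!sumrB; apply: eq_bigr => j _; ring.
Qed.

Lemma vform_le rho sig r q U V s Y : rdec rho r U -> rdec sig q V ->
  (forall i, 0 <= r i) -> (forall j, 0 <= q j) -> 0 < s ->
  vform rho sig s Y <= dpart (ovl U V) (fun p => r p.1) (fun p => q p.2) s.
Proof.
move=> dr ds r0 q0 s0; rewrite (vformE _ _ dr ds); apply: ler_sum => -[i j] _ /=.
rewrite /ovl /=; move: (opm (adj U) V i j) (opm _ U j i) => g z.
have d0 : 0 <= q j + s * r i by rewrite addr_ge0 // mulr_ge0 // ltW.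
(* A zero denominator with s > 0 forces [r i = 0], and both sides vanish. Otherwise the difference
   is a completed square. *)
have [d|nd] := eqVneq (q j + s * r i) 0.
  have : r i = 0.
    move: d; rewrite addrC => /eqP; rewrite addr_eq0 => /eqP h.
    have : s * r i <= 0 by rewrite h oppr_le0.
    by rewrite pmulr_rle0 // => h'; apply/le_anti; rewrite h' r0.
  by move=> ri; rewrite d ri invr0 !mul0r mulr0 mul0rn subrr.
have dp : 0 < q j + s * r i by rewrite lt_neqAle eq_sym nd.
rewrite ler_pdivlMr //; move: (q j + s * r i) dp => d dp.
rewrite -subr_ge0.
have -> : nsq g * r i ^+ 2 - (r i * complex.Re (g * z) *+ 2 - d * nsq z) * d =
  nsq (toC d * z - toC (r i) * g^*).
  rewrite conjCE /nsq; case: g z => a b [u v] /=; ring.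
exact: nsq_ge0.
Qed.

Lemma vform_attained rho sig r q U V s : rdec rho r U -> rdec sig q V ->
  exists Y, vform rho sig s Y = dpart (ovl U V) (fun p => r p.1) (fun p => q p.2) s.
Proof.
move=> dr ds; have [uU _] := dr; have [uV _] := ds.
(* The maximiser of each quadratic. Where the denominator is 0 the entry is 0, by the convention on
   division. *)
pose Z : op R J := fun j i => toC (r i / (q j + s * r i)) * (opm (adj U) V i j)^*.
exists (opm (opm V Z) (adj U)).
rewrite (vformE _ _ dr ds).
have -> : opm (opm (adj V) (opm (opm V Z) (adj U))) U = Z.
  by rewrite -!opmA uU.1 opm1r opmA uV.1 opm1l.
apply: eq_bigr => -[i j] _; rewrite /Z /ovl /=.
move: (opm (adj U) V i j) (q j + s * r i) => g d.
rewrite mulrCA mulCJ nsqM nsqJ Re_toCl /= {2}/nsq /= expr0n /= addr0.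
have [->|nd] := eqVneq d 0; first by rewrite invr0 !mulr0 !mul0r !mulr0 mul0rn subrr.
by field.
Qed.

Definition xdiag rho V j : R := complex.Re (opm (adj V) (opm rho V) j j).
Definition shan r : R := - \sum_i r i * ln (r i).
(** The cross entropy -tr (rho ln sigma) for sigma with eigenvalues [q] in the basis [V]. Because ln
    0 = 0 here, kernel vectors of sigma are silently ignored, so meaningful uses come with
    [supp_in]. *)
Definition xent rho q V : R := - \sum_j xdiag rho V j * ln (q j).

Lemma xdiagE rho r U V j : rdec rho r U ->
  xdiag rho V j = \sum_i ovl U V (i, j) * r i.
Proof.
case=> uU ->; rewrite /xdiag.
have -> : opm (adj V) (opm (opm (opm U (dg r)) (adj U)) V) =
  opm (adj (opm (adj U) V)) (opm (dg r) (opm (adj U) V)).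
  by rewrite adjM adjK -!opmA.
rewrite {1}/opm cRe_sum; apply: eq_bigr => i _.
rewrite dgl /adj /ovl /=; move: (opm (adj U) V i j) => g.
by rewrite mulrCA Re_toCl mulrC conjCE /nsq; case: g => a b /=; ring.
Qed.

Lemma xdiag_self rho r U j : rdec rho r U -> xdiag rho U j = r j.
Proof.
case=> uU ->; rewrite /xdiag.
rewrite -!opmA uU.1 opm1r opmA uU.1 opm1l.
by rewrite /dg eqxx mulr1n.
Qed.

Lemma ovl_ge0 U V p : 0 <= ovl U V p. Proof. exact: nsq_ge0. Qed.

Lemma ovl_suml U V i : unitaryop U -> unitaryop V -> \sum_j ovl U V (i, j) = 1.
Proof.
move=> uU uV; have := opm_adj_diag (opm (adj U) V) i.
rewrite adjM adjK -!opmA [opm V _]opmA uV.2 opm1l uU.1 /idop eqxx.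
by move=> h; apply: (@toC_inj R); rewrite -h.
Qed.

Lemma ovl_sumr U V j : unitaryop U -> unitaryop V -> \sum_i ovl U V (i, j) = 1.
Proof.
move=> uU uV; have := adj_opm_diag (opm (adj U) V) j.
rewrite adjM adjK -!opmA [opm U _]opmA uU.2 opm1l uV.1 /idop eqxx.
by move=> h; apply: (@toC_inj R); rewrite -h.
Qed.

Definition supp_in rho q V := forall j, q j = 0 -> xdiag rho V j = 0.

Lemma supp_admissible rho r U q V : rdec rho r U -> (forall i, 0 <= r i) ->
  (forall j, 0 <= q j) -> supp_in rho q V ->
  dinv_admissible (ovl U V) (fun p => r p.1) (fun p => q p.2).
Proof.
move=> dr r0 q0 h; split=> [p|p|p|[i j] /= /h] //; first exact: ovl_ge0.
rewrite (xdiagE _ _ dr) => /eqP; rewrite psumr_eq0.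
  by move/allP => /(_ i); rewrite mem_index_enum => /(_ isT) /eqP.
by move=> k _; rewrite mulr_ge0 // ovl_ge0.
Qed.

Lemma dlogE rho r U q V : rdec rho r U -> unitaryop V ->
  dlog (ovl U V) (fun p => r p.1) (fun p => q p.2) = xent rho q V - shan r.
Proof.
move=> dr uV; have [uU _] := dr.
rewrite /dlog; under eq_bigr do rewrite mulrBr; rewrite sumrB.
rewrite -(pair_bigA _ (fun i j => ovl U V (i, j) * r i * ln (r i))) /=.
rewrite -(pair_bigA _ (fun i j => ovl U V (i, j) * r i * ln (q j))) /=.
rewrite addrC /xent /shan opprK; congr (- _ + _).
  rewrite exchange_big /=; apply: eq_bigr => j _.
  by rewrite (xdiagE _ _ dr) mulr_suml.
apply: eq_bigr => i _; rewrite -[RHS]mul1r -(ovl_suml i uU uV) mulr_suml.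
by apply: eq_bigr => j _; rewrite mulrA.
Qed.

Lemma ovl_massl U V r : unitaryop U -> unitaryop V ->
  \sum_p ovl U V p * r p.1 = \sum_i r i.
Proof.
move=> uU uV; rewrite -(pair_bigA _ (fun i j => ovl U V (i, j) * r i)) /=.
by apply: eq_bigr => i _; rewrite -mulr_suml ovl_suml // mul1r.
Qed.

Lemma ovl_massr U V q : unitaryop U -> unitaryop V ->
  \sum_p ovl U V p * q p.2 = \sum_i q i.
Proof.
move=> uU uV; rewrite -(pair_bigA _ (fun i j => ovl U V (i, j) * q j)) /=.
rewrite exchange_big /=.
by apply: eq_bigr => i _; rewrite -mulr_suml ovl_sumr // mul1r.
Qed.

(** Termwise r (ln r - ln q) >= r - q, from ln (1 + u) <= u. Summing against the doubly stochastic
    overlaps turns the right side into the difference of the traces, which is kept since [q] need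
    not be normalised. *)
Lemma klein rho r U q V : rdec rho r U -> unitaryop V ->
  (forall i, 0 <= r i) -> (forall j, 0 <= q j) -> supp_in rho q V ->
  shan r <= xent rho q V + \sum_j q j - \sum_i r i.
Proof.
move=> dr uV r0 q0 h; have [uU _] := dr.
have [w0 x0 y0 k] := supp_admissible dr r0 q0 h.
suff : \sum_i r i - \sum_j q j <= xent rho q V - shan r by lra.
rewrite -(dlogE q dr uV) -(ovl_massl r uU uV) -(ovl_massr q uU uV) -sumrB.
apply: ler_sum => -[i j] _ /=.
have [z|nz] := eqVneq (ovl U V (i, j) * r i) 0.
  by rewrite z !mul0r sub0r oppr_le0 mulr_ge0 ?w0.
have qp : 0 < q j.
  by rewrite lt_neqAle q0 andbT eq_sym; apply: contra nz => /eqP /(k (i, j)) /= ->.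
have rp : 0 < r i.
  by rewrite lt_neqAle r0 andbT eq_sym; apply: contra nz => /eqP ->; rewrite mulr0.
rewrite -mulrA -mulrBr ler_wpM2l ?w0 //.
have L : ln (1 + (q j / r i - 1)) <= q j / r i - 1.
  by apply: le_ln1Dx; rewrite ltrBrDr addrC subrr divr_gt0.
rewrite addrC subrK ln_div ?posrE // in L.
have := ler_wpM2l (r0 i) L; rewrite !mulrBr mulr1 mulrCA divff ?gt_eqF // mulr1.
lra.
Qed.

End Variational.

(** The two systems are related only through the last hypothesis, which turns each operator on the
    second system into an at least equally good competitor on the first. Equal masses make the
    divergent ln s terms cancel. *)
Lemma relent_mono (R : realType) (J K : finType)
   (rho sig : op R J) (rho' sig' : op R K) r U q V r' U' q' V' :
  rdec rho r U -> rdec sig q V -> rdec rho' r' U' -> rdec sig' q' V' ->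
  (forall i, 0 <= r i) -> (forall i, 0 <= q i) ->
  (forall i, 0 <= r' i) -> (forall i, 0 <= q' i) ->
  supp_in rho q V -> supp_in rho' q' V' ->
  \sum_i r' i = \sum_i r i ->
  (forall s X, 0 < s -> exists Y, vform rho' sig' s X <= vform rho sig s Y) ->
  xent rho' q' V' - shan r' <= xent rho q V - shan r.
Proof.
move=> dr ds dr' ds' r0 q0 r0' q0' k k' eT h.
have [[uU _] [uV _]] := (dr, ds); have [[uU' _] [uV' _]] := (dr', ds').
rewrite -(dlogE q dr uV) -(dlogE q' dr' uV'); apply: dlog_mono.
- exact: supp_admissible k.
- exact: supp_admissible k'.
- by rewrite !ovl_massl.
move=> s s0; have [X <-] := vform_attained s dr' ds'.
have [Y le] := h s X s0; apply: le_trans le _.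
exact: vform_le.
Qed.

(** * Entropy of positive operators: concavity, mixing, dimension bounds *)

Section Entropy.
Variable R : realType.
Local Notation C := R[i].
Local Notation toC := (real_complex R).

(** Entropy in nats, for which the inequalities on [ln] hold without factors. *)
Definition ent (J : finType) (D : op R J) : R := vN_entropy D * ln 2.

Lemma ln2_gt0 : 0 < ln 2 :> R.
Proof. by rewrite ln_gt0 // ltr1n. Qed.

Lemma supp_self (J : finType) (D : op R J) r U : rdec D r U -> supp_in D r U.
Proof. by move=> d j rj; rewrite (xdiag_self _ d). Qed.

Lemma xent_self (J : finType) (D : op R J) r U : rdec D r U -> xent D r U = shan r.
Proof.
by move=> d; rewrite /xent /shan; congr (- _); apply: eq_bigr => j _; rewrite (xdiag_self _ d).
Qed.

Lemma tr_rdec (J : finType) (D : op R J) r U : rdec D r U -> complex.Re (tr D) = \sum_j r j.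
Proof.
case=> uU ->; rewrite -opmA tr_opmC -opmA uU.1 opm1r /tr cRe_sum.
by apply: eq_bigr => j _; rewrite /dg eqxx mulr1n.
Qed.

(** Klein's inequality for D against itself in a second eigenbasis. Used in both directions, it
    shows that the entropy is independent of the decomposition. *)
Lemma shan_le (J : finType) (D : op R J) r U q V : rdec D r U -> rdec D q V ->
  (forall j, 0 <= r j) -> (forall j, 0 <= q j) -> shan r <= shan q.
Proof.
move=> dr dq r0 q0; have [uV _] := dq.
have := klein dr uV r0 q0 (supp_self dq).
by rewrite (xent_self dq) -(tr_rdec dr) -(tr_rdec dq) addrK.
Qed.

Lemma xdiag_ge0 (J : finType) (D : op R J) r U V j : rdec D r U -> (forall i, 0 <= r i) ->
  0 <= xdiag D V j.
Proof.
by move=> d r0; rewrite (xdiagE _ _ d); apply: sumr_ge0 => i _; rewrite mulr_ge0 ?ovl_ge0.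
Qed.

(** [xget] chooses some element of the set in [vN_entropy]. The given decomposition shows that the
    set is nonempty, and any other has the same value by [shan_le], its eigenvalues being
    nonnegative as diagonal entries of D. *)
Lemma entE (J : finType) (D : op R J) r U : rdec D r U -> (forall j, 0 <= r j) ->
  ent D = shan r.
Proof.
move=> d r0; rewrite /ent /vN_entropy.
set S := (X in xget 0 X).
have H x : S x -> x * ln 2 = shan r.
  case=> lam [e [oe [De ->]]].
  pose V : op R J := fun s j => e j s.
  have uV : unitaryop V by apply: unitaryopP; apply: opP => j j'; exact: oe.
  have dV : rdec D lam V.
    split=> //; apply: opP => s t; rewrite De /opm; apply: eq_bigr => j _.
    by rewrite -/(opm V (dg lam) s j) dgr /V /adj [X in X * _]mulrC.
  have l0 j : 0 <= lam j by rewrite -(xdiag_self j dV); exact: xdiag_ge0 d r0.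
  have -> : shan r = shan lam.
    by apply/le_anti/andP; split; [exact: shan_le d dV _ _ | exact: shan_le dV d _ _].
  rewrite /shan mulNr; congr (- _); rewrite mulr_suml; apply: eq_bigr => j _.
  by rewrite /log2 -mulrA divfK // gt_eqF // ln2_gt0.
apply: H; have [uU E] := d; apply: (xgetPex 0); exists (- \sum_j r j * log2 (r j)), r, (fun j s => U s j).
split=> [j j'|].
  by have := congr1 (fun f => f j j') uU.1; rewrite /opm /adj /idop.
split=> // s t; rewrite E {1}/opm; apply: eq_bigr => j _.
by rewrite dgr [X in X * _]mulrC.
Qed.

Section OneSystem.
Variable J : finType.
Implicit Types (D rho sig : op R J).

Definition trR D : R := complex.Re (tr D).

Lemma trR_rdec D r U : rdec D r U -> trR D = \sum_j r j.
Proof. exact: tr_rdec. Qed.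

Lemma xdiag_qf D V j : xdiag D V j = complex.Re (qf (fun s => V s j) D).
Proof.
rewrite /xdiag /qf /opm; congr complex.Re; apply: eq_bigr => s _; rewrite mulr_sumr.
by apply: eq_bigr => t _; rewrite mulrA.
Qed.

Lemma qfD v D D' : qf v (fun s t => D s t + D' s t) = qf v D + qf v D'.
Proof.
rewrite /qf -big_split; apply: eq_bigr => s _; rewrite -big_split; apply: eq_bigr => t _.
by rewrite mulrDr mulrDl.
Qed.

Lemma qfZ v (c : C) D : qf v (fun s t => c * D s t) = c * qf v D.
Proof.
rewrite /qf mulr_sumr; apply: eq_bigr => s _; rewrite mulr_sumr; apply: eq_bigr => t _.
by rewrite mulrCA !mulrA.
Qed.

Lemma qfB v D D' : qf v (fun s t => D s t - D' s t) = qf v D - qf v D'.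
Proof.
rewrite -mulN1r -qfZ -qfD; congr qf; apply: opP => s t; by rewrite mulN1r.
Qed.

Lemma qf_sum v (T : Type) (l : seq T) (F : T -> op R J) :
  qf v (fun s t => \sum_(i <- l) F i s t) = \sum_(i <- l) qf v (F i).
Proof.
rewrite /qf [RHS]exchange_big /=; apply: eq_bigr => s _; rewrite [RHS]exchange_big /=.
by apply: eq_bigr => t _; rewrite mulr_sumr mulr_suml.
Qed.

Lemma psdD D D' : psd D -> psd D' -> psd (fun s t => D s t + D' s t).
Proof. by move=> h h' v; have := addr_ge0 (h v) (h' v); rewrite -qfD. Qed.

Lemma psdZ (c : R) D : 0 <= c -> psd D -> psd (fun s t => toC c * D s t).
Proof. by move=> c0 h v; rewrite -/(qf _ _) qfZ mulr_ge0 ?toC_ge0 //; exact: h. Qed.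

Lemma psd_sum (T : Type) (l : seq T) (F : T -> op R J) :
  (forall i, psd (F i)) ->
  psd (fun s t => \sum_(i <- l) F i s t).
Proof. by move=> h v; rewrite -/(qf _ _) qf_sum sumr_ge0 // => i _; exact: h. Qed.

Lemma psd_tr D : psd D -> tr D = toC (trR D).
Proof.
move=> h; apply: ge0_toC; apply: sumr_ge0 => s _.
have := h (fun u => (u == s)%:R); rewrite (bigD1 s) //= [X in _ + X]big1; last first.
  by move=> u /negbTE us; apply: big1 => v _; rewrite us conjC0 !mul0r.
rewrite (bigD1 s) //= [X in _ + X + _]big1; last by move=> v /negbTE us; rewrite us !mulr0.
by rewrite eqxx conjC1 mul1r mulr1 !addr0.
Qed.

Lemma psd_xdiag D V j : psd D -> 0 <= xdiag D V j.
Proof. by move=> h; rewrite xdiag_qf; apply: ge0_Re; exact: h. Qed.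

Lemma xdiagD D D' V j : xdiag (fun s t => D s t + D' s t) V j = xdiag D V j + xdiag D' V j.
Proof. by rewrite !xdiag_qf qfD cReD. Qed.

Lemma xdiagZ (c : R) D V j : xdiag (fun s t => toC c * D s t) V j = c * xdiag D V j.
Proof. by rewrite !xdiag_qf qfZ Re_toCl. Qed.

Lemma xentD D D' q V : xent (fun s t => D s t + D' s t) q V = xent D q V + xent D' q V.
Proof.
rewrite /xent -opprD -big_split; congr (- _); apply: eq_bigr => j _.
by rewrite xdiagD mulrDl.
Qed.

Lemma xentZ (c : R) D q V : xent (fun s t => toC c * D s t) q V = c * xent D q V.
Proof.
rewrite /xent mulrN mulr_sumr; congr (- _); apply: eq_bigr => j _.
by rewrite xdiagZ mulrA.
Qed.

Lemma xent_sum (T : Type) (l : seq T) (F : T -> op R J) q V :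
  xent (fun s t => \sum_(i <- l) F i s t) q V = \sum_(i <- l) xent (F i) q V.
Proof.
rewrite /xent sumrN; congr (- _); rewrite exchange_big /=; apply: eq_bigr => j _.
by rewrite -mulr_suml xdiag_qf qf_sum cRe_sum; under eq_bigr do rewrite -xdiag_qf.
Qed.

Lemma ent_klein rho q V : psd rho -> unitaryop V -> (forall j, 0 <= q j) ->
  supp_in rho q V -> ent rho <= xent rho q V + \sum_j q j - trR rho.
Proof.
move=> p uV q0 k; have [r [U [d r0]]] := psd_rdec p.
rewrite (entE d r0) (trR_rdec d); exact: klein d uV r0 q0 k.
Qed.

Lemma ent_xself sig q V : rdec sig q V -> (forall j, 0 <= q j) -> ent sig = xent sig q V.
Proof. by move=> d q0; rewrite (entE d q0) (xent_self d). Qed.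

Lemma xdiag_mono rho sig V j : psd (fun s t => sig s t - rho s t) ->
  xdiag rho V j <= xdiag sig V j.
Proof.
move=> h; rewrite -subr_ge0 !xdiag_qf -cReB -qfB; apply: ge0_Re; exact: h.
Qed.

Lemma supp_dom rho sig q V : psd rho -> psd (fun s t => sig s t - rho s t) ->
  rdec sig q V -> supp_in rho q V.
Proof.
move=> p h d j qj; apply/le_anti; rewrite psd_xdiag // andbT -qj -(xdiag_self j d).
exact: xdiag_mono.
Qed.

Lemma tr_psd_sq D Y : psd D -> 0 <= complex.Re (tr (opm D (opm Y (adj Y)))).
Proof.
move=> h; rewrite opmA tr_opmC /tr cRe_sum; apply: sumr_ge0 => s _.
have -> : opm (adj Y) (opm D Y) s s = qf (fun u => Y u s) D.
  rewrite /qf /opm; apply: eq_bigr => t _; rewrite mulr_sumr.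
  by apply: eq_bigr => u _; rewrite mulrA.
by apply: ge0_Re; exact: h.
Qed.

Lemma tr_opmBl D D' Y : tr (opm (fun s t => D s t - D' s t) Y) = tr (opm D Y) - tr (opm D' Y).
Proof.
rewrite /tr /opm -sumrB; apply: eq_bigr => s _; rewrite -sumrB; apply: eq_bigr => t _.
by rewrite mulrBl.
Qed.

(** A consequence of operator monotonicity of the logarithm, reached without it: enlarging the
    second operator lowers [vform] at every Y, so D(rho || sig) <= D(rho || rho) = 0. *)
Lemma xent_dom_le rho sig q V : psd rho -> psd (fun s t => sig s t - rho s t) ->
  rdec sig q V -> (forall j, 0 <= q j) -> xent rho q V <= ent rho.
Proof.
move=> p h d q0; have [r [U [dr r0]]] := psd_rdec p.
rewrite (entE dr r0) -subr_le0.
have -> : 0 = xent rho r U - shan r by rewrite (xent_self dr) subrr.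
apply: (relent_mono dr dr dr d) => //; first exact: supp_self dr.
  exact: supp_dom h d.
move=> s X s0; exists X; rewrite /vform lerD2r lerD2l lerN2 -subr_ge0 -cReB -tr_opmBl.
exact: tr_psd_sq.
Qed.

(** The entropy of X + Y is the sum of the cross entropies of X and of Y against X + Y, and both
    operators lie below X + Y. *)
Lemma ent_mix (X Y : op R J) : psd X -> psd Y -> ent (fun s t => X s t + Y s t) <= ent X + ent Y.
Proof.
move=> pX pY; have [q [V [d q0]]] := psd_rdec (psdD pX pY).
rewrite (ent_xself d q0) xentD lerD //; apply: xent_dom_le d q0 => //.
  by have -> // : (fun s t => X s t + Y s t - X s t) = Y by apply: opP => s t; rewrite addrAC subrr add0r.
by have -> // : (fun s t => X s t + Y s t - Y s t) = X by apply: opP => s t; rewrite addrK.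
Qed.

Lemma psd0 : psd (fun _ _ : J => 0 : C).
Proof. by move=> v; rewrite big1 // => s _; rewrite big1 // => t _; rewrite mulr0 mul0r. Qed.

Lemma ent0 : ent (fun _ _ : J => 0 : C) = 0.
Proof.
have [r [U [d r0]]] := psd_rdec psd0; rewrite (entE d r0).
have := trR_rdec d; rewrite /trR /tr big1 //= => /esym /eqP.
rewrite psumr_eq0 // => /allP h; rewrite /shan big1 ?oppr0 // => j _.
by have := h j; rewrite mem_index_enum => /(_ isT) /eqP ->; rewrite mul0r.
Qed.

Lemma ent_mix_sum (T : Type) (l : seq T) (F : T -> op R J) :
  (forall i, psd (F i)) ->
  ent (fun s t => \sum_(i <- l) F i s t) <= \sum_(i <- l) ent (F i).
Proof.
move=> h; elim: l => [|i l IH].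
  rewrite big_nil.
  have -> : (fun s t : J => \sum_(i <- [::]) F i s t) = (fun _ _ => 0).
    by apply: opP => s t; rewrite big_nil.
  by rewrite ent0.
rewrite big_cons.
have -> : (fun s t : J => \sum_(j <- i :: l) F j s t) =
   (fun s t => F i s t + \sum_(j <- l) F j s t).
  by apply: opP => s t; rewrite big_cons.
by apply: le_trans (ent_mix _ _) _ => //; [exact: psd_sum | rewrite lerD2l].
Qed.

Lemma psd_trR_ge0 D : psd D -> 0 <= trR D.
Proof. by move=> p; have [r [U [d r0]]] := psd_rdec p; rewrite (trR_rdec d) sumr_ge0. Qed.

Lemma trRD D D' : trR (fun s t => D s t + D' s t) = trR D + trR D'.
Proof. by rewrite /trR trD cReD. Qed.

Lemma ent_scale (c : R) D : 0 <= c -> psd D ->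
  ent (fun s t => toC c * D s t) = c * ent D - c * ln c * trR D.
Proof.
move=> c0 p; have [r [U [d r0]]] := psd_rdec p.
have d' : rdec (fun s t => toC c * D s t) (fun j => c * r j) U.
  case: d => uU E; split=> //; apply: opP => s t; rewrite E /opm mulr_sumr.
  apply: eq_bigr => u _; rewrite -!/(opm U _ s u) !dgr rmorphM /=; ring.
rewrite (entE d r0) (entE d') ?(trR_rdec d); last by move=> j; rewrite mulr_ge0.
rewrite /shan mulrN -opprD !mulr_sumr -big_split; congr (- _); apply: eq_bigr => j _ /=.
have [->|cn] := eqVneq c 0; first by rewrite !mul0r addr0.
have [->|rn] := eqVneq (r j) 0; first by rewrite !(mulr0, mul0r) addr0.
by rewrite lnM ?posrE ?lt_neqAle ?c0 ?r0 ?andbT ?[0 == _]eq_sym ?cn ?rn //; ring.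
Qed.

Lemma ent_ge0 D : psd D -> trR D <= 1 -> 0 <= ent D.
Proof.
move=> p; have [r [U [d r0]]] := psd_rdec p; rewrite (entE d r0) (trR_rdec d) => h.
rewrite oppr_ge0; apply: sumr_le0 => j _; rewrite mulr_ge0_le0 //; apply: ln_le0.
apply: le_trans h; rewrite (bigD1 j) //= lerDl; exact: sumr_ge0.
Qed.

Lemma rdec1 (c : R) : rdec (fun s t => toC c * idop R s t) (fun _ : J => c) (@idop R J).
Proof.
have a1 : adj (@idop R J) = @idop R J.
  by apply: opP => s t; rewrite /adj /idop eq_sym; case: (_ == _); rewrite ?conjC1 ?conjC0.
split; first by split; rewrite a1 opm1l.
rewrite a1 opm1l opm1r; apply: opP => s t; rewrite /dg /idop.
by case: (_ == _); rewrite ?mulr1 ?mulr0.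
Qed.

(** Klein's inequality against the maximally mixed operator. Its trace accounts for the + 1, present
    because D may be subnormalised, as the difference parts in [fannes] are. *)
Lemma ent_le_card D : psd D -> trR D <= 1 -> ent D <= trR D * ln #|J|%:R + 1.
Proof.
move=> p t1; have [J0|J0] := posnP #|J|.
  have -> : D = (fun _ _ => 0) by apply: opP => s; have := card0_eq J0 s; rewrite inE.
  by rewrite ent0 J0 ln0 // mulr0 add0r.
have c0 : 0 < (#|J|%:R : R)^-1 by rewrite invr_gt0 ltr0n.
have [uV _] := rdec1 (#|J|%:R)^-1.
have := @ent_klein D (fun=> (#|J|%:R)^-1) _ p uV (fun j => ltW c0).
have -> : \sum_(j : J) (#|J|%:R : R)^-1 = 1.
  by rewrite sumr_const -[LHS]mulr_natl divff // pnatr_eq0 -lt0n.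
move/(_ _)/le_trans; apply.
  by move=> j /eqP; rewrite gt_eqF.
have -> : xent D (fun=> (#|J|%:R)^-1) (@idop R J) = trR D * ln #|J|%:R.
  rewrite /xent -mulr_suml lnV ?posrE ?ltr0n // mulrN opprK; congr (_ * _).
  rewrite /trR -(tr_conj D uV) /tr cRe_sum; exact: eq_bigr.
have := psd_trR_ge0 p; lra.
Qed.

Lemma ent_le_card1 D : psd D -> trR D = 1 -> ent D <= ln #|J|%:R.
Proof.
move=> p t1; have [J0|J0] := posnP #|J|.
  have -> : D = (fun _ _ => 0) by apply: opP => s; have := card0_eq J0 s; rewrite inE.
  by rewrite ent0 J0 ln0.
have c0 : 0 < (#|J|%:R : R)^-1 by rewrite invr_gt0 ltr0n.
have [uV _] := rdec1 (#|J|%:R)^-1.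
have := @ent_klein D (fun=> (#|J|%:R)^-1) _ p uV (fun j => ltW c0).
have -> : \sum_(j : J) (#|J|%:R : R)^-1 = 1.
  by rewrite sumr_const -[LHS]mulr_natl divff // pnatr_eq0 -lt0n.
move/(_ _)/le_trans; apply.
  by move=> j /eqP; rewrite gt_eqF.
have -> : xent D (fun=> (#|J|%:R)^-1) (@idop R J) = trR D * ln #|J|%:R.
  rewrite /xent -mulr_suml lnV ?posrE ?ltr0n // mulrN opprK; congr (_ * _).
  rewrite /trR -(tr_conj D uV) /tr cRe_sum; exact: eq_bigr.
by rewrite t1; lra.
Qed.

(** Klein's inequality bounds the entropy of each [F i] by its cross entropy against the mixture,
    and cross entropy is linear in its first argument. *)
Lemma ent_concave (T : finType) (w : T -> R) (F : T -> op R J) :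
  (forall i, 0 <= w i) -> (forall i, psd (F i)) -> (forall i, trR (F i) = 1) -> \sum_i w i = 1 ->
  \sum_i w i * ent (F i) <= ent (fun s t => \sum_i toC (w i) * F i s t).
Proof.
move=> w0 pF tF w1.
pose D : op R J := fun s t => \sum_i toC (w i) * F i s t; rewrite -/D.
have pD : psd D by apply: psd_sum => i; exact: psdZ.
have tD : trR D = 1.
  rewrite /trR /D /tr exchange_big /= cRe_sum -w1; apply: eq_bigr => i _.
  by rewrite -mulr_sumr Re_toCl -/(tr _) -/(trR _) tF mulr1.
have [q [V [d q0]]] := psd_rdec pD.
rewrite (ent_xself d q0) xent_sum; apply: ler_sum => i _; rewrite xentZ.
have [->|wn] := eqVneq (w i) 0; first by rewrite !mul0r.
rewrite ler_wpM2l //; have [uV _] := d.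
have := @ent_klein (F i) q V (pF i) uV q0.
rewrite tF -(trR_rdec d) tD addrK; apply=> j qj.
(* The support condition: [w i] times [F i] lies below the mixture, and [w i] is not 0. *)
have /(_ j qj) : supp_in (fun s t => toC (w i) * F i s t) q V.
  apply: (supp_dom _ _ d); first exact: psdZ.
  have -> : (fun s t => D s t - toC (w i) * F i s t) =
     (fun s t => \sum_(k | k != i) toC (w k) * F k s t).
    by apply: opP => s t; rewrite /D (bigD1 i) //= addrAC subrr add0r.
  move=> v; rewrite -/(qf _ _).
  have -> : (fun s t => \sum_(k | k != i) toC (w k) * F k s t) =
    (fun s t => \sum_(k <- [seq k <- index_enum T | k != i]) toC (w k) * F k s t).
    by apply: opP => s t; rewrite big_filter.
  by apply: psd_sum => k; exact: psdZ.
by rewrite xdiagZ => /eqP; rewrite mulf_eq0 (negbTE wn) /= => /eqP.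
Qed.

End OneSystem.

Section Reindex.
Variables (J K : finType) (f : K -> J) (bf : bijective f).

Definition ren (D : op R J) : op R K := fun u v => D (f u) (f v).

Lemma ren_sum (F : J -> C) : \sum_k F (f k) = \sum_j F j.
Proof. by rewrite (reindex f) //=; exact: onW_bij. Qed.

Lemma ren_opm a b : opm (ren a) (ren b) = ren (opm a b).
Proof.
apply: opP => s t; rewrite /opm /ren -(ren_sum (fun u => a (f s) u * b u (f t))) //.
Qed.

Lemma ren_tr a : tr (ren a) = tr a.
Proof. by rewrite /tr /ren -(ren_sum (fun u => a u u)). Qed.

Lemma ren_idop : ren (@idop R J) = @idop R K.
Proof. by apply: opP => s t; rewrite /ren /idop (inj_eq (bij_inj bf)). Qed.

Lemma ren_adj a : adj (ren a) = ren (adj a). Proof. by []. Qed.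

Lemma ren_rdec D r U : rdec D r U -> rdec (ren D) (r \o f) (ren U).
Proof.
case=> -[u1 u2] ->; split; first by split; rewrite ren_adj ren_opm ?u1 ?u2 ren_idop.
rewrite ren_adj -!ren_opm; congr (opm (opm _ _) _).
by apply: opP => s t; rewrite /dg /ren (inj_eq (bij_inj bf)).
Qed.

Lemma ren_psd D : psd D -> psd (ren D).
Proof.
case: bf => g fg gf p v.
have := p (fun s => v (g s)).
rewrite -(ren_sum (fun s => \sum_t (v (g s))^* * D s t * v (g t))).
under eq_bigr => s _ do rewrite -(ren_sum (fun t => (v (g (f s)))^* * D (f s) t * v (g t))).
by under eq_bigr => s _ do under eq_bigr => t _ do rewrite !fg.
Qed.

Lemma ren_ent D : psd D -> ent (ren D) = ent D.
Proof.
move=> p; have [r [U [d r0]]] := psd_rdec p.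
rewrite (entE d r0) (entE (ren_rdec d)) => [|j]; last exact: r0.
by rewrite /shan (reindex f) //=; exact: onW_bij.
Qed.

End Reindex.
End Entropy.

(** * A continuity bound for entropy in terms of two-outcome tests *)

Section Fannes.
Variables (R : realType) (J : finType).
Local Notation toC := (real_complex R).
Implicit Types (D rho sig B U : op R J).

Lemma psd_opm_adj B : psd (opm B (adj B)).
Proof.
move=> v; rewrite /opm.
have -> : \sum_s \sum_t (v s)^* * (\sum_u B s u * adj B u t) * v t =
   \sum_u toC (nsq (\sum_s (v s)^* * B s u)).
  under [RHS]eq_bigr => u _.
    rewrite -mulCJ rmorph_sum mulr_suml.
    under eq_bigr => s _ do rewrite mulr_sumr.
    over.
  rewrite [RHS]exchange_big /=; apply: eq_bigr => s _.
  rewrite [RHS]exchange_big /=; apply: eq_bigr => t _.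
  rewrite mulr_sumr mulr_suml; apply: eq_bigr => u _.
  by rewrite /adj rmorphM /= conjCK; ring.
by apply: sumr_ge0 => u _; rewrite toC_ge0 nsq_ge0.
Qed.

Lemma psd_of_rdec D r U : rdec D r U -> (forall j, 0 <= r j) -> psd D.
Proof.
move=> [_ ->] r0.
have -> : opm (opm U (dg r)) (adj U) =
   opm (opm U (dg (fun j => Num.sqrt (r j)))) (adj (opm U (dg (fun j => Num.sqrt (r j))))).
  rewrite adjM adj_dg -!opmA; congr opm; rewrite opmA; congr opm.
  apply: opP => s t; rewrite dgl /dg; case: (s == t); rewrite ?mulr0n ?mulr0 //.
  by rewrite !mulr1n -rmorphM /= -expr2 sqr_sqrtr.
exact: psd_opm_adj.
Qed.

Definition spec U (r : J -> R) : op R J := opm (opm U (dg r)) (adj U).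

Lemma spec_rdec U r : unitaryop U -> rdec (spec U r) r U. Proof. by []. Qed.

Lemma specB U r q : (fun s t => spec U r s t - spec U q s t) = spec U (fun j => r j - q j).
Proof.
apply: opP => s t; rewrite /spec /opm -sumrB; apply: eq_bigr => u _.
rewrite -!/(opm U _ s u) !dgr rmorphB /=; ring.
Qed.

Lemma spec_opm U r q : unitaryop U -> opm (spec U r) (spec U q) = spec U (fun j => r j * q j).
Proof.
move=> uU; rewrite /spec -!opmA [opm (adj U) (opm U _)]opmA uU.1 opm1l; congr opm.
rewrite opmA; congr opm; apply: opP => s t; rewrite dgl /dg.
by have [->|_] := eqVneq s t; rewrite ?mulr0n ?mulr0 // !mulr1n -rmorphM.
Qed.

Lemma spec1 U : unitaryop U -> spec U (fun=> 1) = @idop R J.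
Proof.
move=> uU; rewrite /spec; have -> : dg (fun=> 1) = @idop R J.
  by apply: opP => s t; rewrite /dg /idop; case: (_ == _).
by rewrite opm1r uU.2.
Qed.

Lemma psd_le1 D : psd D -> trR D <= 1 -> psd (fun s t => idop R s t - D s t).
Proof.
move=> p; have [r [U [d r0]]] := psd_rdec p; rewrite (trR_rdec d) => h; have [uU ->] := d.
rewrite -(spec1 uU) -/(spec U r) specB; apply: psd_of_rdec (spec_rdec _ uU) _ => j.
rewrite subr_ge0; apply: le_trans h; rewrite (bigD1 j) //= lerDl; exact: sumr_ge0.
Qed.

Lemma sum_xdiag D V : unitaryop V -> \sum_j xdiag D V j = trR D.
Proof. by move=> uV; rewrite /trR -(tr_conj D uV) /tr cRe_sum. Qed.

(** With the Jordan decomposition rho - sig = P - N, both states lie below rho + N = sig + P. Going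
    up from rho costs at most 2 tr N, coming down to sig costs the entropy of P, at most e ln d + 1;
    as tr N = tr P <= e <= 1, the constants add up to 3. *)
Lemma fannes rho sig (e : R) : psd rho -> psd sig -> trR rho = 1 -> trR sig = 1 ->
  0 <= e <= 1 ->
  (forall b, psd b -> psd (fun s t => idop R s t - b s t) ->
     complex.Re (tr (opm rho b)) - complex.Re (tr (opm sig b)) <= e) ->
  ent rho <= ent sig + e * ln #|J|%:R + 3.
Proof.
move=> prho psig trho tsig /andP[e0 e1] h.
have psig' : psd (fun s t => idop R s t - sig s t) by apply: psd_le1; rewrite ?tsig.
(* Only positive operators have been diagonalised so far, so the difference is handled through rho +
   (1 - sig), which has the same eigenvectors and eigenvalues larger by 1. *)
have [y [U [d y0]]] := psd_rdec (psdD prho psig'); have [uU Ey] := d.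
pose x j := y j - 1.
have Ex : (fun s t => rho s t - sig s t) = spec U x.
  rewrite /x -specB (spec1 uU) [spec U y]/spec -Ey.
  by apply: opP => s t; ring.
pose xp j := Num.max (x j) 0; pose xn j := Num.max (- x j) 0.
have xp0 j : 0 <= xp j by rewrite le_max lexx orbT.
have xn0 j : 0 <= xn j by rewrite le_max lexx orbT.
have xE j : x j = xp j - xn j.
  by rewrite /xp /xn; case: (lerP 0 (x j)) => hx; case: (lerP 0 (- x j)) => hx'; lra.
pose P := spec U xp; pose N := spec U xn.
have dP : rdec P xp U by []. have dN : rdec N xn U by [].
have pP := psd_of_rdec dP xp0; have pN := psd_of_rdec dN xn0.
have RPN s t : rho s t + N s t = sig s t + P s t.
  have := congr1 (fun f => f s t) Ex.
  have -> : spec U x = (fun s t => P s t - N s t).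
    by rewrite /P /N specB; congr spec; apply/funext.
  move=> /= E; have -> : rho s t = P s t - N s t + sig s t by rewrite -E; ring.
  by ring.
have TPN : trR P = trR N.
  have : trR rho + trR N = trR sig + trR P.
    rewrite -!trRD; congr trR; apply: opP => s t; exact: RPN.
  by rewrite trho tsig; lra.
have TP : trR P <= e.
  (* The optimal test: the projection onto the nonnegative part of rho - sig. *)
  pose b := spec U (fun j => if 0 <= x j then 1 else 0).
  have pb : psd b by apply: psd_of_rdec (spec_rdec _ uU) _ => j; case: ifP.
  have pb' : psd (fun s t => idop R s t - b s t).
    rewrite -(spec1 uU) specB; apply: psd_of_rdec (spec_rdec _ uU) _ => j.
    by case: ifP; rewrite ?subrr ?subr0.
  apply: le_trans (h b pb pb'); rewrite -cReB -tr_opmBl Ex (spec_opm _ _ uU).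
  rewrite -/(trR _) (trR_rdec (spec_rdec _ uU)) (trR_rdec dP).
  by apply: ler_sum => j _; rewrite /xp; case: (lerP 0 (x j)); rewrite ?mulr1 ?mulr0.
have pZ := psdD prho pN.
have [z [W [dZ z0]]] := psd_rdec pZ; have [uW _] := dZ.
have tZ : \sum_j z j = 1 + trR N by rewrite -(trR_rdec dZ) trRD trho.
have cN : (fun s t => rho s t + N s t - N s t) = rho by apply: opP => s t; rewrite addrK.
have cR : (fun s t => rho s t + N s t - rho s t) = N by apply: opP => s t; ring.
have K : supp_in rho z W by apply: (supp_dom prho _ dZ); rewrite cR.
have := ent_klein prho uW z0 K; rewrite tZ trho.
have EZ : ent (fun s t => rho s t + N s t) = xent rho z W + xent N z W.
  by rewrite (ent_xself dZ z0) xentD.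
have mix : ent (fun s t => rho s t + N s t) <= ent sig + ent P.
  by rewrite (_ : (fun s t : J => _) = (fun s t => sig s t + P s t)) ?ent_mix //; apply: opP.
have TN0 := psd_trR_ge0 pN.
have LP := @ent_le_card _ _ P pP (le_trans TP e1).
have XN : - xent N z W <= trR N.
  rewrite opprK -(sum_xdiag N uW); apply: ler_sum => j _.
  rewrite -[leRHS]mulr1 ler_wpM2l ?psd_xdiag //.
  (* Every eigenvalue of rho + N is at most its trace 1 + tr N <= 2, hence has logarithm at most
     1. *)
  have zj : z j <= 2.
    have : z j <= \sum_j z j by rewrite (bigD1 j) //= lerDl sumr_ge0.
    by rewrite tZ -TPN; lra.
  have [->|zn] := eqVneq (z j) 0; first by rewrite ln0.
  have zp : 0 < z j by rewrite lt_neqAle eq_sym zn z0.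
  have -> : z j = 1 + (z j - 1) by ring.
  by apply: le_trans (le_ln1Dx _) _; lra.
have lnd : 0 <= ln (#|J|%:R : R).
  have [->|J0] := posnP #|J|; first by rewrite ln0.
  by rewrite ln_ge0 // ler1n.
have : trR P * ln #|J|%:R <= e * ln #|J|%:R by rewrite ler_wpM2r.
lra.
Qed.

End Fannes.

(** * Tensor products, partial traces and subadditivity *)

Section Tensor.
Variable R : realType.
Local Notation C := R[i].

Section Two.
Variables K L : finType.
Implicit Types (A : op R K) (B : op R L) (D : op R (K * L)%type).

Definition tens A B : op R (K * L)%type := fun u v => A u.1 v.1 * B u.2 v.2.
Definition ptr1 D : op R K := fun k k' => \sum_l D (k, l) (k', l).
Definition ptr2 D : op R L := fun l l' => \sum_k D (k, l) (k, l').

Lemma pair_sum (F : K * L -> C) : \sum_p F p = \sum_k \sum_l F (k, l).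
Proof. by rewrite pair_bigA; apply: eq_bigr => -[]. Qed.

Lemma pair_sumR (F : K * L -> R) : \sum_p F p = \sum_k \sum_l F (k, l).
Proof. by rewrite pair_bigA; apply: eq_bigr => -[]. Qed.

Lemma tens_opm A B A' B' : opm (tens A B) (tens A' B') = tens (opm A A') (opm B B').
Proof.
apply: opP => -[k l] [k' l']; rewrite /opm /tens /= pair_sum mulr_suml.
apply: eq_bigr => m _; rewrite mulr_sumr; apply: eq_bigr => n _ /=; ring.
Qed.

Lemma tens_adj A B : adj (tens A B) = tens (adj A) (adj B).
Proof. by apply: opP => -[k l] [k' l']; rewrite /adj /tens rmorphM. Qed.

Lemma tens_idop : tens (@idop R K) (@idop R L) = @idop R (K * L)%type.
Proof.
apply: opP => -[k l] [k' l']; rewrite /tens /idop /= -natrM.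
by rewrite -[in RHS]pair_eqE /= mulnb.
Qed.

Lemma tens_dg a b : tens (dg a) (dg b) = dg (fun p : K * L => a p.1 * b p.2).
Proof.
apply: opP => -[k l] [k' l']; rewrite /tens /dg /= -[in RHS]pair_eqE /=.
by case: (k == k'); case: (l == l'); rewrite ?mulr0n ?mulr0 ?mul0r //= !mulr1n -rmorphM.
Qed.

Lemma tens_rdec A B a b U V : rdec A a U -> rdec B b V ->
  rdec (tens A B) (fun p => a p.1 * b p.2) (tens U V).
Proof.
case=> -[u1 u2] -> [[v1 v2] ->]; split.
  by split; rewrite tens_adj tens_opm ?u1 ?u2 ?v1 ?v2 tens_idop.
by rewrite tens_adj -tens_dg !tens_opm.
Qed.

Lemma tr_tens_idop D A : tr (opm D (tens A (@idop R L))) = tr (opm (ptr1 D) A).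
Proof.
rewrite /tr /opm pair_sum; apply: eq_bigr => k _.
under eq_bigr do rewrite pair_sum.
rewrite exchange_big /=; apply: eq_bigr => k' _; rewrite /ptr1 mulr_suml.
apply: eq_bigr => l _; rewrite (bigD1 l) //= /tens /idop eqxx mulr1 big1 ?addr0 //.
by move=> l' /negbTE; rewrite /= => ->; rewrite !mulr0.
Qed.

Lemma tr_ptr1 D : tr (ptr1 D) = tr D.
Proof. by rewrite /tr pair_sum. Qed.

Lemma tr_ptr2 D : tr (ptr2 D) = tr D.
Proof. by rewrite /tr pair_sum exchange_big. Qed.

Lemma psd_ptr1 D : psd D -> psd (ptr1 D).
Proof.
move=> p v.
have -> : \sum_s \sum_t (v s)^* * ptr1 D s t * v t =
   \sum_l qf (fun u : K * L => v u.1 * (u.2 == l)%:R) D.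
  under eq_bigr do under eq_bigr do rewrite /ptr1 mulr_sumr mulr_suml.
  under eq_bigr do rewrite exchange_big /=.
  rewrite exchange_big /=; apply: eq_bigr => l _; rewrite /qf pair_sum.
  apply: eq_bigr => s _; rewrite (bigD1 l) //= [X in _ + X]big1 ?addr0.
    rewrite pair_sum; apply: eq_bigr => t _.
    rewrite (bigD1 l) //= [X in _ + X]big1 ?addr0 ?eqxx ?mulr1 //.
    by move=> l' /negbTE ->; rewrite !mulr0.
  move=> l' /negbTE nl; rewrite pair_sum big1 // => t _; rewrite big1 // => l2 _ /=.
  by rewrite nl mulr0 conjC0 !mul0r.
by apply: sumr_ge0 => l _; exact: p.
Qed.

Lemma psd_ptr2 D : psd D -> psd (ptr2 D).
Proof.
move=> p v.
have -> : \sum_s \sum_t (v s)^* * ptr2 D s t * v t =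
   \sum_k qf (fun u : K * L => v u.2 * (u.1 == k)%:R) D.
  under eq_bigr do under eq_bigr do rewrite /ptr2 mulr_sumr mulr_suml.
  under eq_bigr do rewrite exchange_big /=.
  rewrite exchange_big /=; apply: eq_bigr => k _; rewrite /qf pair_sum.
  rewrite [RHS]exchange_big /=; apply: eq_bigr => s _.
  rewrite (bigD1 k) //= [X in _ + X]big1 ?addr0.
    rewrite pair_sum exchange_big /=; apply: eq_bigr => t _.
    rewrite (bigD1 k) //= [X in _ + X]big1 ?addr0 ?eqxx ?mulr1 //.
    by move=> l' /negbTE ->; rewrite !mulr0.
  move=> l' /negbTE nl; rewrite pair_sum big1 // => t _; rewrite big1 // => l2 _ /=.
  by rewrite nl mulr0 conjC0 !mul0r.
by apply: sumr_ge0 => l _; exact: p.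
Qed.

Lemma sum_UU (J : finType) (U : op R J) s t : unitaryop U ->
  \sum_j U t j * (U s j)^* = (t == s)%:R.
Proof. by case=> _ h; have := congr1 (fun f => f t s) h. Qed.

Lemma sum_xdiag1 D U V i : unitaryop V ->
  \sum_j xdiag D (tens U V) (i, j) = xdiag (ptr1 D) U i.
Proof.
move=> uV; rewrite -cRe_sum /xdiag; congr complex.Re.
transitivity (\sum_j \sum_k \sum_l \sum_k' \sum_l'
   (U k i)^* * D (k, l) (k', l') * U k' i * (V l' j * (V l j)^*)).
  apply: eq_bigr => j _; rewrite /opm pair_sum; apply: eq_bigr => k _.
  apply: eq_bigr => l _; rewrite pair_sum mulr_sumr; apply: eq_bigr => k' _.
  rewrite mulr_sumr; apply: eq_bigr => l' _.
  by rewrite /adj /tens /= rmorphM; ring.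
rewrite exchange_big /= /opm; apply: eq_bigr => k _.
rewrite mulr_sumr exchange_big /=.
under eq_bigr do rewrite exchange_big /=.
rewrite exchange_big /=; apply: eq_bigr => k' _; rewrite /ptr1 mulr_suml mulr_sumr.
apply: eq_bigr => l _; rewrite exchange_big /=.
under eq_bigr do rewrite -mulr_sumr sum_UU //.
rewrite (bigD1 l) //= eqxx mulr1 big1 ?addr0 /adj ?mulrA // => l' /negbTE ->.
by rewrite mulr0.
Qed.

Lemma sum_xdiag2 D U V j : unitaryop U ->
  \sum_i xdiag D (tens U V) (i, j) = xdiag (ptr2 D) V j.
Proof.
move=> uU; rewrite -cRe_sum /xdiag; congr complex.Re.
transitivity (\sum_i \sum_l \sum_k \sum_l' \sum_k'
   (V l j)^* * D (k, l) (k', l') * V l' j * (U k' i * (U k i)^*)).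
  apply: eq_bigr => i _; rewrite /opm pair_sum exchange_big /=; apply: eq_bigr => l _.
  apply: eq_bigr => k _; rewrite pair_sum exchange_big /= mulr_sumr; apply: eq_bigr => l' _.
  rewrite mulr_sumr; apply: eq_bigr => k' _.
  by rewrite /adj /tens /= rmorphM; ring.
rewrite exchange_big /= /opm; apply: eq_bigr => l _.
rewrite mulr_sumr exchange_big /=.
under eq_bigr do rewrite exchange_big /=.
rewrite exchange_big /=; apply: eq_bigr => l' _; rewrite /ptr2 mulr_suml mulr_sumr.
apply: eq_bigr => k _; rewrite exchange_big /=.
under eq_bigr do rewrite -mulr_sumr sum_UU //.
rewrite (bigD1 k) //= eqxx mulr1 big1 ?addr0 /adj ?mulrA // => k' /negbTE ->.
by rewrite mulr0.
Qed.

Section Marg.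
Variables (D : op R (K * L)%type) (a : K -> R) (b : L -> R) (U : op R K) (V : op R L).
Hypotheses (pD : psd D) (da : rdec (ptr1 D) a U) (db : rdec (ptr2 D) b V).
Hypotheses (a0 : forall i, 0 <= a i) (b0 : forall j, 0 <= b j).

(** Diagonal entries of D in the product basis are nonnegative and sum to eigenvalues of the
    marginals. Hence the support of D lies in that of the product of its marginals, the side
    condition for comparing the two. *)
Lemma xdiag_marg0 i j : a i = 0 \/ b j = 0 -> xdiag D (tens U V) (i, j) = 0.
Proof.
have [[uU _] [uV _]] := (da, db).
case=> h.
  have := sum_xdiag1 D U i uV; rewrite (xdiag_self _ da) h => /eqP.
  rewrite psumr_eq0 => [/allP /(_ j)|j' _]; last exact: psd_xdiag.
  by rewrite mem_index_enum => /(_ isT) /eqP.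
have := sum_xdiag2 D V j uU; rewrite (xdiag_self _ db) h => /eqP.
rewrite psumr_eq0 => [/allP /(_ i)|j' _]; last exact: psd_xdiag.
by rewrite mem_index_enum => /(_ isT) /eqP.
Qed.

Lemma supp_marg : supp_in D (fun p => a p.1 * b p.2) (tens U V).
Proof.
move=> [i j] /= /eqP; rewrite mulf_eq0 => /orP[] /eqP h; apply: xdiag_marg0; [by left|by right].
Qed.

Lemma xent_marg : xent D (fun p => a p.1 * b p.2) (tens U V) = ent (ptr1 D) + ent (ptr2 D).
Proof.
have [[uU _] [uV _]] := (da, db).
rewrite (entE da a0) (entE db b0) /xent /shan -opprD; congr (- _).
(* The logarithm of a product splits only for positive factors; at zero eigenvalues the coefficient
   vanishes by [xdiag_marg0]. *)
transitivity (\sum_(p : K * L) (xdiag D (tens U V) p * ln (a p.1) + xdiag D (tens U V) p * ln (b p.2))).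
  apply: eq_bigr => -[i j] _ /=.
  have [ai|ai] := eqVneq (a i) 0; first by rewrite xdiag_marg0 ?mul0r ?addr0 //; left.
  have [bj|bj] := eqVneq (b j) 0; first by rewrite xdiag_marg0 ?mul0r ?addr0 //; right.
  by rewrite lnM ?mulrDr // posrE lt_neqAle eq_sym ?ai ?bj ?a0 ?b0.
rewrite big_split /=; congr (_ + _); rewrite pair_sumR.
  by apply: eq_bigr => i _; rewrite /= -mulr_suml sum_xdiag1 // (xdiag_self _ da).
by rewrite exchange_big /=; apply: eq_bigr => j _; rewrite /= -mulr_suml sum_xdiag2 // (xdiag_self _ db).
Qed.

End Marg.

(** Klein's inequality against the product of the marginals, whose trace is 1. *)
Lemma ent_subadd D : psd D -> trR D = 1 -> ent D <= ent (ptr1 D) + ent (ptr2 D).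
Proof.
move=> p t1.
have [a [U [da a0]]] := psd_rdec (psd_ptr1 p).
have [b [V [db b0]]] := psd_rdec (psd_ptr2 p).
have [uW _] := tens_rdec da db.
have := ent_klein p uW (fun q => mulr_ge0 (a0 q.1) (b0 q.2)) (supp_marg p da db).
rewrite (xent_marg p da db a0 b0) t1 pair_sumR.
under eq_bigr do rewrite /= -mulr_sumr.
by rewrite -mulr_suml -(trR_rdec da) -(trR_rdec db) /trR tr_ptr1 tr_ptr2 -/(trR D) t1 mulr1 addrK.
Qed.

Lemma ptr1_tens A B : tr B = 1 -> ptr1 (tens A B) = A.
Proof.
by move=> h; apply: opP => k k'; rewrite /ptr1 /tens /= -mulr_sumr -[\sum_l _]/(tr B) h mulr1.
Qed.

Lemma ptr2_tens A B : tr A = 1 -> ptr2 (tens A B) = B.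
Proof.
by move=> h; apply: opP => k k'; rewrite /ptr2 /tens /= -mulr_suml -[\sum_k _]/(tr A) h mul1r.
Qed.

Lemma psd_tens A B : psd A -> psd B -> psd (tens A B).
Proof.
move=> pA pB; have [a [U [da a0]]] := psd_rdec pA; have [b [V [db b0]]] := psd_rdec pB.
by apply: psd_of_rdec (tens_rdec da db) _ => j; rewrite mulr_ge0.
Qed.

Lemma ent_tens A B : psd A -> psd B -> tr A = 1 -> tr B = 1 ->
  ent (tens A B) = ent A + ent B.
Proof.
move=> pA pB tA tB; have [a [U [da a0]]] := psd_rdec pA; have [b [V [db b0]]] := psd_rdec pB.
have dT := tens_rdec da db.
rewrite (ent_xself dT) => [|j]; last by rewrite mulr_ge0.
by rewrite xent_marg ?ptr1_tens ?ptr2_tens //; exact: psd_tens.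
Qed.

End Two.
End Tensor.

(** * Strong subadditivity and its conditional form *)

Section StrongSubadditivity.
Variable R : realType.
Local Notation C := R[i].
Local Notation toC := (real_complex R).

Lemma ren_adjoint (J K : finType) (f : K -> J) (g : J -> K) (D : op R J) (Q : op R K) :
  cancel f g -> cancel g f -> tr (opm D (ren g Q)) = tr (opm (ren f D) Q).
Proof.
move=> fg gf; have bf : bijective f by exists g.
rewrite -(ren_tr bf) -(ren_opm bf); congr (tr (opm _ _)).
by apply: opP => s t; rewrite /ren !fg.
Qed.

Section SSA.
Variables X Y Z : finType.

Definition assoc (u : (X * Y) * Z) : X * (Y * Z) := (u.1.1, (u.1.2, u.2)).
Definition unassoc (u : X * (Y * Z)) : (X * Y) * Z := ((u.1, u.2.1), u.2.2).
Lemma assocK : cancel assoc unassoc. Proof. by move=> [[]]. Qed.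
Lemma unassocK : cancel unassoc assoc. Proof. by move=> [x []]. Qed.

(** Both sides are relative entropies in disguise: this is D(XY || X tensor Y) <= D(XYZ || X tensor
    YZ), the monotonicity under forgetting Z. *)
Lemma ssa_ptr (D : op R (X * (Y * Z))%type) : psd D -> trR D = 1 ->
  ent D + ent (ptr1 (ptr2 D)) <= ent (ptr1 (ren assoc D)) + ent (ptr2 D).
Proof.
move=> p t1.
have ba : bijective assoc by exists unassoc; [exact: assocK|exact: unassocK].
have bu : bijective unassoc by exists assoc; [exact: unassocK|exact: assocK].
set DXY := ptr1 (ren assoc D).
have pXY : psd DXY by apply: psd_ptr1; apply: ren_psd.
have tXY : trR DXY = 1 by rewrite /trR tr_ptr1 (ren_tr ba).
have EX : ptr1 DXY = ptr1 D.
  by apply: opP => x x'; rewrite /ptr1 pair_sum.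
have EY : ptr2 DXY = ptr1 (ptr2 D).
  by apply: opP => y y'; rewrite /ptr1 /ptr2 exchange_big.
have [d [U [dD d0]]] := psd_rdec p.
have [c [V [dXY c0]]] := psd_rdec pXY.
have [a [UX [dX a0]]] := psd_rdec (psd_ptr1 p).
have [b [UYZ [dYZ b0]]] := psd_rdec (psd_ptr2 p).
have [e [UY [dY e0]]] := psd_rdec (psd_ptr1 (psd_ptr2 p)).
have dX' := dX; rewrite -EX in dX'; have dY' := dY; rewrite -EY in dY'.
have := relent_mono dD (tens_rdec dX dYZ) dXY (tens_rdec dX' dY') d0
  (fun i => mulr_ge0 (a0 i.1) (b0 i.2)) c0 (fun i => mulr_ge0 (a0 i.1) (e0 i.2))
  (supp_marg p dX dYZ) (supp_marg pXY dX' dY').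
rewrite (xent_marg p dX dYZ a0 b0) (xent_marg pXY dX' dY' a0 e0) EX EY.
rewrite -(entE dD d0) -(entE dXY c0) => H.
suff : ent (ptr1 D) + ent (ptr1 (ptr2 D)) - ent DXY <= ent (ptr1 D) + ent (ptr2 D) - ent D.
  by lra.
apply: H; first by rewrite -(trR_rdec dXY) -(trR_rdec dD) tXY t1.
(* An operator on XY, extended by the identity on Z, gives the same value of the form, since the
   extension commutes with products and adjoints. *)
move=> s X0 s0; exists (ren unassoc (tens X0 (@idop R Z))).
have iA : adj (@idop R Z) = @idop R Z.
  by apply: opP => u v; rewrite /adj /idop eq_sym; case: (_ == _); rewrite ?conjC1 ?conjC0.
have M (S : op R (X * (Y * Z))%type) Q :
    tr (opm S (ren unassoc (tens Q (@idop R Z)))) = tr (opm (ptr1 (ren assoc S)) Q).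
  exact: etrans (ren_adjoint S (tens Q (@idop R Z)) assocK unassocK) (tr_tens_idop _ _).
pose ex Q : op R (X * (Y * Z))%type := ren unassoc (tens Q (@idop R Z)).
have eA Q : adj (ex Q) = ex (adj Q) by rewrite /ex ren_adj tens_adj iA.
have eM Q Q' : opm (ex Q) (ex Q') = ex (opm Q Q') by rewrite /ex (ren_opm bu) tens_opm opm1l.
rewrite /vform -/(ex X0) eA !eM /ex !M.
have -> // : ptr1 (ren assoc (tens (ptr1 D) (ptr2 D))) = tens (ptr1 D) (ptr1 (ptr2 D)).
apply: opP => -[x y] [x' y']; rewrite {1}/ptr1 /ren /tens /=.
by rewrite -mulr_sumr.
Qed.

(** The bijection [f] and the entrywise marginals let a window be cut into three parts without first
    being rewritten as a nested product. *)
Lemma ssa (J : finType) (D : op R J) (f : X * (Y * Z) -> J) (DXY : op R (X * Y)%type)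
    (DYZ : op R (Y * Z)%type) (DY : op R Y) : bijective f -> psd D -> trR D = 1 ->
  (forall x y x' y', DXY (x, y) (x', y') = \sum_z D (f (x, (y, z))) (f (x', (y', z)))) ->
  (forall y z y' z', DYZ (y, z) (y', z') = \sum_x D (f (x, (y, z))) (f (x, (y', z')))) ->
  (forall y y', DY y y' = \sum_x \sum_z D (f (x, (y, z))) (f (x, (y', z)))) ->
  ent D + ent DY <= ent DXY + ent DYZ.
Proof.
move=> bf p t1 hXY hYZ hY; have := ssa_ptr (ren_psd bf p).
rewrite /trR (ren_tr bf) -/(trR D) t1 (ren_ent bf p) => /(_ erefl).
have -> : ptr1 (ptr2 (ren f D)) = DY.
  by apply: opP => y y'; rewrite hY /ptr1 /ptr2 /ren exchange_big.
have -> : ptr2 (ren f D) = DYZ by apply: opP => -[y z] [y' z']; rewrite hYZ.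
by have -> : ptr1 (ren assoc (ren f D)) = DXY by apply: opP => -[x y] [x' y']; rewrite hXY.
Qed.

End SSA.

Lemma subadd (J K L : finType) (D : op R J) (f : K * L -> J) (DK : op R K) (DL : op R L) :
  bijective f -> psd D -> trR D = 1 ->
  (forall k k', DK k k' = \sum_l D (f (k, l)) (f (k', l))) ->
  (forall l l', DL l l' = \sum_k D (f (k, l)) (f (k, l'))) ->
  ent D <= ent DK + ent DL.
Proof.
move=> bf p t1 hK hL; have := ent_subadd (ren_psd bf p).
rewrite /trR (ren_tr bf) -/(trR D) t1 (ren_ent bf p) => /(_ erefl).
have -> : ptr1 (ren f D) = DK by apply: opP => k k'; rewrite hK.
by have -> : ptr2 (ren f D) = DL by apply: opP => k k'; rewrite hL.
Qed.

Section CondSubadd.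
Variables (J K1 K2 L1 L2 : finType) (D : op R J) (f : (K1 * K2) * (L1 * L2) -> J).
Hypotheses (bf : bijective f) (pD : psd D) (tD : trR D = 1).
Variables (DL : op R (L1 * L2)%type) (D1 : op R (K1 * L1)%type) (D2 : op R (K2 * L2)%type).
Variables (DL1 : op R L1) (DL2 : op R L2).
Hypothesis hL : forall l l', DL l l' = \sum_k1 \sum_k2 D (f ((k1, k2), l)) (f ((k1, k2), l')).
Hypothesis hD1 : forall k l k' l', D1 (k, l) (k', l') =
  \sum_k2 \sum_l2 D (f ((k, k2), (l, l2))) (f ((k', k2), (l', l2))).
Hypothesis hD2 : forall k l k' l', D2 (k, l) (k', l') =
  \sum_k1 \sum_l1 D (f ((k1, k), (l1, l))) (f ((k1, k'), (l1, l'))).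
Hypothesis hL1 : forall l l', DL1 l l' = \sum_l2 DL (l, l2) (l', l2).
Hypothesis hL2 : forall l l', DL2 l l' = \sum_l1 DL (l1, l) (l1, l').

(** This is S(K1 K2 | L1 L2) <= S(K1 | L1) + S(K2 | L2). One use of strong subadditivity splits the
    left side conditionally on L1 L2 ([S1]); two more drop the foreign system from each conditioning
    ([S2], [S3]). *)
Lemma cond_subadd : ent D + ent DL1 + ent DL2 <= ent DL + ent D1 + ent D2.
Proof.
pose E1 : op R (K1 * (L1 * L2))%type := fun u v =>
  \sum_k2 D (f ((u.1, k2), u.2)) (f ((v.1, k2), v.2)).
pose E2 : op R (K2 * (L1 * L2))%type := fun u v =>
  \sum_k1 D (f ((k1, u.1), u.2)) (f ((k1, v.1), v.2)).
pose f1 (u : (K1 * (L1 * L2)) * K2) : J := f ((u.1.1, u.2), u.1.2).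
pose f2 (u : (K2 * (L1 * L2)) * K1) : J := f ((u.2, u.1.1), u.1.2).
case: bf => g fg gf.
have b1 : bijective f1.
  exists (fun j => (((g j).1.1, (g j).2), (g j).1.2)) => [[[x y] z]|j]; rewrite /f1 ?fg //=.
  by rewrite -[RHS]gf; congr f; case: (g j) => [[]].
have b2 : bijective f2.
  exists (fun j => (((g j).1.2, (g j).2), (g j).1.1)) => [[[x y] z]|j]; rewrite /f2 ?fg //=.
  by rewrite -[RHS]gf; congr f; case: (g j) => [[]].
have eE1 : E1 = ptr1 (ren f1 D) by [].
have eE2 : E2 = ptr1 (ren f2 D) by [].
have pE1 : psd E1 by rewrite eE1; apply: psd_ptr1; exact: ren_psd.
have pE2 : psd E2 by rewrite eE2; apply: psd_ptr1; exact: ren_psd.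
have tE1 : trR E1 = 1 by rewrite eE1 /trR tr_ptr1 (ren_tr b1).
have tE2 : trR E2 = 1 by rewrite eE2 /trR tr_ptr1 (ren_tr b2).
have S1 : ent D + ent DL <= ent E1 + ent (ren (fun p => (p.2, p.1)) E2).
  apply: (@ssa K1 (L1 * L2)%type K2 J D (fun u => f ((u.1, u.2.2), u.2.1))) => //.
    exists (fun j => ((g j).1.1, ((g j).2, (g j).1.2))) => [[x [y z]]|j]; rewrite ?fg //=.
    by rewrite -[RHS]gf; congr f; case: (g j) => [[]].
have S2 : ent E1 + ent DL1 <= ent D1 + ent DL.
  apply: (@ssa K1 L1 L2 _ E1 id) => //; first by exists id.
  - by move=> x y x' y'; rewrite hD1 exchange_big.
  - move=> y y'; rewrite hL1; under eq_bigr do rewrite hL.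
    by rewrite exchange_big.
have S3 : ent E2 + ent DL2 <= ent D2 + ent (ren (fun p => (p.2, p.1)) DL).
  apply: (@ssa K2 L2 L1 _ E2 (fun u => (u.1, (u.2.2, u.2.1)))) => //.
  - by exists (fun u => (u.1, (u.2.2, u.2.1))) => [[x [y z]]|[x [y z]]].
  - by move=> x y x' y'; rewrite hD2 exchange_big.
  - by move=> y z y' z'; rewrite /ren hL exchange_big.
  - move=> y y'; rewrite hL2; under eq_bigr do rewrite hL exchange_big.
    by rewrite exchange_big.
have sw (P Q : finType) : bijective (fun p : P * Q => (p.2, p.1)).
  by exists (fun p => (p.2, p.1)) => -[].
have pDL : psd DL.
  have -> : DL = ptr2 E1 by apply: opP => l l'; rewrite hL.
  exact: psd_ptr2.
rewrite (ren_ent (sw _ _)) // in S1; rewrite (ren_ent (sw _ _)) // in S3.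
lra.
Qed.

End CondSubadd.

(** * Mutual information bounded below by a test *)

Section TestBound.
Variables K L : finType.
Implicit Types D : op R (K * L)%type.

Lemma tr_spec_c (J : finType) (D : op R J) (U : op R J) (z : J -> C) : psd D ->
  complex.Re (tr (opm D (opm (opm U (fun s t => z s *+ (s == t))) (adj U)))) =
  \sum_j complex.Re (z j) * xdiag D U j.
Proof.
move=> p; rewrite opmA tr_opmC !opmA /tr cRe_sum; apply: eq_bigr => j _.
have -> : opm (opm (opm (adj U) D) U) (fun s t => z s *+ (s == t)) j j =
   z j * opm (adj U) (opm D U) j j.
  rewrite {1}/opm (bigD1 j) //=; rewrite [X in _ + X]big1 ?addr0; last first.
    by move=> k /negbTE nk; rewrite /= nk mulr0n mulr0.
  by rewrite eqxx mulr1n mulrC -!opmA.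
have -> : opm (adj U) (opm D U) j j = toC (xdiag D U j).
  apply: ge0_toC; have -> : opm (adj U) (opm D U) j j = qf (fun s => U s j) D.
    rewrite /qf /opm; apply: eq_bigr => s _; rewrite mulr_sumr.
    by apply: eq_bigr => t _; rewrite mulrA.
  exact: p.
by rewrite cReM /= mulr0 subr0.
Qed.

Lemma spec_c_adj (J : finType) (U : op R J) (z : J -> C) : unitaryop U ->
  opm (opm (opm U (fun s t => z s *+ (s == t))) (adj U))
      (adj (opm (opm U (fun s t => z s *+ (s == t))) (adj U))) =
  opm (opm U (fun s t => toC (nsq (z s)) *+ (s == t))) (adj U)
  /\ opm (adj (opm (opm U (fun s t => z s *+ (s == t))) (adj U)))
      (opm (opm U (fun s t => z s *+ (s == t))) (adj U)) =
  opm (opm U (fun s t => toC (nsq (z s)) *+ (s == t))) (adj U).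
Proof.
move=> uU.
have E1 : opm (fun s t : J => z s *+ (s == t)) (adj (fun s t : J => z s *+ (s == t))) =
   (fun s t => toC (nsq (z s)) *+ (s == t)).
  apply: opP => s t; rewrite /opm /adj (bigD1 s) //= [X in _ + X]big1 ?addr0; last first.
    by move=> k /negbTE nk; rewrite eq_sym nk mulr0n mul0r.
  rewrite eqxx mulr1n [t == s]eq_sym; have [->|_] := eqVneq s t; rewrite ?mulr0n ?conjC0 ?mulr0 //.
  by rewrite !mulr1n mulCJ.
have E2 : opm (adj (fun s t : J => z s *+ (s == t))) (fun s t : J => z s *+ (s == t)) =
   (fun s t => toC (nsq (z s)) *+ (s == t)).
  apply: opP => s t; rewrite /opm /adj (bigD1 s) //= [X in _ + X]big1 ?addr0; last first.
    by move=> k /negbTE nk; rewrite nk mulr0n conjC0 mul0r.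
  rewrite eqxx mulr1n; have [->|_] := eqVneq s t; rewrite ?mulr0n ?mulr0 //.
  by rewrite !mulr1n mulrC mulCJ.
rewrite !adjM adjK; split.
  rewrite -!opmA [opm (adj U) (opm U _)]opmA uU.1 opm1l; congr opm.
  by rewrite opmA E1.
rewrite -!opmA [opm (adj U) (opm U _)]opmA uU.1 opm1l; congr opm.
by rewrite opmA E2.
Qed.

Lemma nsq_convex (t : R) (x y : C) : 0 <= t <= 1 ->
  nsq (toC t * x + toC (1 - t) * y) <= t * nsq x + (1 - t) * nsq y.
Proof.
move=> /andP[t0 t1]; rewrite -subr_ge0.
have -> : t * nsq x + (1 - t) * nsq y - nsq (toC t * x + toC (1 - t) * y) =
  t * (1 - t) * nsq (x - y).
  rewrite /nsq; case: x y => a b [c d] /=; ring.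
by rewrite !mulr_ge0 ?subr_ge0 ?nsq_ge0.
Qed.

(** The relative entropy of D to the product of its marginals dominates that of the outcome laws,
    which is -r ln q1 minus a binary entropy; the latter is at most ln 2. *)
Lemma test_bound D (T : op R (K * L)%type) (q1 : R) : psd D -> trR D = 1 -> psd T ->
  psd (fun s t => idop R s t - T s t) -> 0 < q1 ->
  trR (opm (tens (ptr1 D) (ptr2 D)) T) <= q1 ->
  - (trR (opm D T) * ln q1) - ln 2 <= ent (ptr1 D) + ent (ptr2 D) - ent D.
Proof.
move=> p t1 pT pT1 q10 hq.
have [t [U [dT t0]]] := psd_rdec pT; have [uU eT] := dT.
have tl1 j : t j <= 1.
  have := xdiag_mono U j pT1; rewrite (xdiag_self _ dT) => /le_trans; apply.
  by rewrite /xdiag opm1l uU.1 /idop eqxx.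
set S := tens (ptr1 D) (ptr2 D).
have pS : psd S by apply: psd_tens; [exact: psd_ptr1|exact: psd_ptr2].
have tS : trR S = 1.
  rewrite /S /trR /tr pair_sum; under eq_bigr do rewrite /tens /= -mulr_sumr.
  rewrite -mulr_suml -/(tr (ptr1 D)) -/(tr (ptr2 D)) tr_ptr1 tr_ptr2.
  by rewrite (psd_tr p) t1 mulr1.
have trT E : psd E -> trR (opm E T) = \sum_j t j * xdiag E U j.
  by move=> pE; rewrite /trR eT (tr_spec_c U (fun j => toC (t j)) pE).
set r := trR (opm D T).
have rE : r = \sum_j t j * xdiag D U j by rewrite /r trT.
have r0 : 0 <= r by rewrite rE sumr_ge0 // => j _; rewrite mulr_ge0 // psd_xdiag.
have r1 : r <= 1.
  rewrite rE -t1 -(sum_xdiag D uU); apply: ler_sum => j _.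
  by rewrite ler_piMl // psd_xdiag.
pose r' (b : bool) : R := if b then r else 1 - r.
(* The second outcome gets weight 1 instead of 1 - q1. Only the masses of the first arguments have
   to agree, and ln 1 = 0 removes the term. *)
pose q' (b : bool) : R := if b then q1 else 1.
have r'0 b : 0 <= r' b by case: b; rewrite /r' // subr_ge0.
have q'0 b : 0 <= q' b by case: b; rewrite /q' // ltW.
have uI : unitaryop (@idop R bool) by have [] := @rdec1 R bool 1.
have aI : adj (@idop R bool) = @idop R bool.
  by apply: opP => u v; rewrite /adj /idop eq_sym; case: (_ == _); rewrite ?conjC1 ?conjC0.
have dr : rdec (dg r') r' (@idop R bool) by split=> //; rewrite aI opm1l opm1r.
have dq : rdec (dg q') q' (@idop R bool) by split=> //; rewrite aI opm1l opm1r.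
have [d [V [dD d0]]] := psd_rdec p.
have [a [UX [dX a0]]] := psd_rdec (psd_ptr1 p).
have [b [UY [dY b0]]] := psd_rdec (psd_ptr2 p).
have sK : supp_in (dg r') q' (@idop R bool).
  by case; rewrite /q' => /eqP; rewrite ?oner_eq0 ?gt_eqF.
have := relent_mono dD (tens_rdec dX dY) dr dq d0 (fun i => mulr_ge0 (a0 i.1) (b0 i.2)) r'0 q'0
  (supp_marg p dX dY) sK.
rewrite (xent_marg p dX dY a0 b0) -(entE dD d0) -(entE dr r'0).
have -> : xent (dg r') q' (@idop R bool) = - (r * ln q1).
  rewrite /xent big_bool /= !(xdiag_self _ dr) /r' /q' ln1 mulr0 addr0 //.
have pr : psd (dg r') := psd_of_rdec dr r'0.
have tr' : trR (dg r') = 1 by rewrite (trR_rdec dr) big_bool /r' /= addrC subrK.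
have : ent (dg r') <= ln 2.
  by apply: le_trans (ent_le_card1 pr tr') _; rewrite card_bool.
move=> H1 H; suff : - (r * ln q1) - ent (dg r') <= ent (ptr1 D) + ent (ptr2 D) - ent D by lra.
apply: H; first by rewrite -(trR_rdec dr) -(trR_rdec dD) tr' t1.
(* The competitor is T x + (1 - T) y, built in the eigenbasis of T from the diagonal of X; the
   off-diagonal entries of X can only lower its form. *)
move=> s X s0; pose x := X true true; pose y := X false false.
pose z j : C := toC (t j) * x + toC (1 - t j) * y.
exists (opm (opm U (fun s t => z s *+ (s == t))) (adj U)).
have [e1 e2] := spec_c_adj z uU.
rewrite /vform e1 e2 -/S !tr_spec_c //=.
have trdg (w : bool -> R) Q : complex.Re (tr (opm (dg w) Q)) =
    w true * complex.Re (Q true true) + w false * complex.Re (Q false false).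
  by rewrite /tr cRe_sum big_bool /= !dgl !Re_toCl.
rewrite !trdg !opm_adj_diag !adj_opm_diag /= !big_bool /=.
(* Convexity of the squared modulus plays the role of the Schwarz inequality for the measurement
   map. *)
have cvx E : psd E -> trR E = 1 -> \sum_j nsq (z j) * xdiag E U j <=
    trR (opm E T) * nsq x + (1 - trR (opm E T)) * nsq y.
  move=> pE tE; rewrite (trT E pE) -tE -(sum_xdiag E uU) -sumrB !mulr_suml -big_split /=.
  apply: ler_sum => j _; apply: le_trans (ler_wpM2r (psd_xdiag _ _ pE) (nsq_convex _ _ _)) _.
    by rewrite t0 tl1.
  by rewrite le_eqVlt; apply/orP; left; apply/eqP; ring.
have c1 := cvx D p t1; have c2 := cvx S pS tS; rewrite -/r in c1.
have -> : \sum_j complex.Re (z j) * xdiag D U j = r * complex.Re x + (1 - r) * complex.Re y.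
  rewrite rE -t1 -(sum_xdiag D uU) -sumrB !mulr_suml -big_split /=.
  by apply: eq_bigr => j _; rewrite /z cReD !Re_toCl; ring.
have T0 : 0 <= trR (opm S T).
  by rewrite (trT S pS) sumr_ge0 // => j _; rewrite mulr_ge0 // psd_xdiag.
have n1 := nsq_ge0 x; have n2 := nsq_ge0 y.
have n3 := nsq_ge0 (X true false); have n4 := nsq_ge0 (X false true).
rewrite -/x -/y /r' /q'.
have c3 : trR (opm S T) * nsq x <= q1 * nsq x by rewrite ler_wpM2r.
have c4 : (1 - trR (opm S T)) * nsq y <= nsq y by rewrite ler_piMl //; lra.
have c5 : s * (\sum_j nsq (z j) * xdiag D U j) <=
   s * (r * (nsq x + nsq (X false true)) + (1 - r) * (nsq (X true false) + nsq y)).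
  rewrite ler_wpM2l ?(ltW s0) //.
  have : 0 <= r * nsq (X false true) by rewrite mulr_ge0.
  have : 0 <= (1 - r) * nsq (X true false) by rewrite mulr_ge0 // subr_ge0.
  by move: c1; clear; lra.
have c6 : 0 <= q1 * nsq (X true false) by rewrite mulr_ge0 // ltW.
move: c2 c3 c4 c5 c6 n3 n4; rewrite mulrDr mul1r; clear; lra.
Qed.

End TestBound.
End StrongSubadditivity.

(** * Positive functionals and their densities *)

Section LinearFunctionals.
Variables (R : realType) (J : finType).
Local Notation C := R[i].
Local Notation toC := (real_complex R).
Implicit Types (b : op R J) (L : op R J -> C).

Definition lin_op L := forall (c : C) b1 b2, L (fun s t => c * b1 s t + b2 s t) = c * L b1 + L b2.
Definition pos_op L := forall b, psd b -> 0 <= L b.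

Lemma lin_op0 L : lin_op L -> L (fun _ _ => 0) = 0.
Proof.
move=> l; have := l 1 (fun _ _ => 0) (fun _ _ => 0).
have -> : (fun s t : J => 1 * (0 : C) + 0) = (fun _ _ => 0).
  by apply: opP => s t; rewrite mulr0 addr0.
rewrite mul1r.
by move/eqP; rewrite -subr_eq0 opprD addrA subrr sub0r oppr_eq0 => /eqP.
Qed.

Lemma lin_op_sum L (T : Type) (l : seq T) (c : T -> C) (F : T -> op R J) : lin_op L ->
  L (fun s t => \sum_(i <- l) c i * F i s t) = \sum_(i <- l) c i * L (F i).
Proof.
move=> h; elim: l => [|i l IH].
  rewrite big_nil -[RHS](lin_op0 h); congr L; apply: opP => s t; by rewrite big_nil.
rewrite big_cons -IH -h; congr L; apply: opP => s t; by rewrite big_cons.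
Qed.

Lemma lin_opE L b : lin_op L -> L b = \sum_s \sum_t b s t * L (@munit R J s t).
Proof.
move=> h; rewrite pair_bigA /=.
rewrite -(lin_op_sum (index_enum (J * J)%type) (fun p => b p.1 p.2) (fun p => @munit R J p.1 p.2) h).
congr L; apply: opP => s t; rewrite -(pair_bigA _ (fun i j => b i j * munit R i j s t)) /=.
rewrite (bigD1 s) //= (bigD1 t) //= /munit !eqxx mulr1.
rewrite [X in _ + X + _]big1 ?addr0; last by move=> j /negbTE nj; rewrite eq_sym nj mulr0.
rewrite [X in _ + X]big1 ?addr0 // => i /negbTE ni; rewrite big1 // => j _.
by rewrite eq_sym ni mulr0.
Qed.

(** The transposed indices make [L b] the trace of [dens L] times [b], in agreement with
    [dens_out]. *)
Definition dens L : op R J := fun s t => L (@munit R J t s).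

Lemma lin_op_tr L b : lin_op L -> L b = tr (opm (dens L) b).
Proof.
move=> h; rewrite (lin_opE b h) /tr /opm exchange_big /=; apply: eq_bigr => s _.
by apply: eq_bigr => t _; rewrite mulrC.
Qed.

Lemma rank1_psd (v : J -> C) : psd (fun s t => v s * (v t)^*).
Proof.
move=> w; have -> : \sum_s \sum_t (w s)^* * (v s * (v t)^*) * w t =
    toC (nsq (\sum_s (w s)^* * v s)).
  rewrite -mulCJ rmorph_sum mulr_suml; apply: eq_bigr => s _; rewrite mulr_sumr.
  by apply: eq_bigr => t _; rewrite rmorphM /= conjCK; ring.
by rewrite toC_ge0 nsq_ge0.
Qed.

(** On the rank one operator |v><v| the functional takes the value of the quadratic form of its
    density at v. *)
Lemma psd_dens L : lin_op L -> pos_op L -> psd (dens L).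
Proof.
move=> h p v; have := p _ (rank1_psd v); rewrite (lin_opE _ h) exchange_big /=.
congr (0 <= _); apply: eq_bigr => s _; apply: eq_bigr => t _.
by rewrite /dens; ring.
Qed.

Lemma tr_dens L : lin_op L -> tr (dens L) = L (@idop R J).
Proof. by move=> h; rewrite (lin_op_tr _ h) opm1r. Qed.

(** Supplies the uniform bound that makes the values of a channel on matrix units integrable. *)
Lemma psd_entry (D : op R J) s t : psd D -> trR D = 1 ->
  `|complex.Re (D s t)| <= 1 /\ `|complex.Im (D s t)| <= 1.
Proof.
move=> p t1; have [r [U [d r0]]] := psd_rdec p; have [uU E] := d.
rewrite -t1 (trR_rdec d) E {1 3}/opm cRe_sum cIm_sum.
have n1 u j : nsq (U u j) <= 1.
  have := adj_opm_diag U j; rewrite uU.1 /idop eqxx => /(@toC_inj R) ->.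
  rewrite (bigD1 u) //= lerDl; apply: sumr_ge0 => *; exact: nsq_ge0.
have B (j : J) : `|complex.Re (opm U (dg r) s j * adj U j t)| <= r j /\
         `|complex.Im (opm U (dg r) s j * adj U j t)| <= r j.
  rewrite dgr /adj; have := n1 s j; have := n1 t j.
  rewrite conjCE /nsq; case: (U s j) => a b; case: (U t j) => c e /= h1 h2.
  have rj := r0 j.
  have s1 := sqr_ge0 (a - c); have s2 := sqr_ge0 (a + c).
  have s3 := sqr_ge0 (b - e); have s4 := sqr_ge0 (b + e).
  have s5 := sqr_ge0 (b - c); have s6 := sqr_ge0 (b + c).
  have s7 := sqr_ge0 (a - e); have s8 := sqr_ge0 (a + e).
  have q1 : `|a * c + b * e| <= 1 by rewrite ler_norml; apply/andP; split; nra.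
  have q2 : `|b * c - a * e| <= 1 by rewrite ler_norml; apply/andP; split; nra.
  split.
    have -> : (a * r j - b * 0) * c - (a * 0 + b * r j) * - e = r j * (a * c + b * e) by ring.
    by rewrite normrM ger0_norm // ler_piMr.
  have -> : (a * r j - b * 0) * - e + (a * 0 + b * r j) * c = r j * (b * c - a * e) by ring.
  by rewrite normrM ger0_norm // ler_piMr.
by split; apply: le_trans (ler_norm_sum _ _ _) _; apply: ler_sum => j _; have [] := B j.
Qed.

End LinearFunctionals.

(** * Cutting windows, and consistency of states on them *)

Section Windows.
Variables (X : finType).

Definition pull N k (phi : 'I_k -> 'I_N) (s : cfg X N) : cfg X k := [ffun i => s (phi i)].
(** As a 0-1 matrix this is the identity on the sites outside [j, j + k), the factor that embeds a
    local operator into a larger window. *)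
Definition offeq N j k (s t : cfg X N) :=
  [forall i : 'I_N, ((j <= i) && (i < j + k)) || (s i == t i)]%N.
Definition cleft k l (s : cfg X (k + l)) : cfg X k := @pull (k + l) k (@lshift k l) s.
Definition cright k l (s : cfg X (k + l)) : cfg X l := @pull (k + l) l (@rshift k l) s.
Definition fcat k l (s : cfg X k) (t : cfg X l) : cfg X (k + l) :=
  [ffun i : 'I_(k + l) => match fintype.split i with inl x => (s : {ffun 'I_k -> X}) x | inr y => (t : {ffun 'I_l -> X}) y end].

Lemma cleft_fcat k l (s : cfg X k) (t : cfg X l) : cleft (fcat s t) = s.
Proof.
apply/ffunP => i; rewrite !ffunE; case: splitP => j /= h; last by have := ltn_ord i; rewrite h ltnNge leq_addr.
by congr (s _); apply: val_inj.
Qed.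

Lemma cright_fcat k l (s : cfg X k) (t : cfg X l) : cright (fcat s t) = t.
Proof.
apply/ffunP => i; rewrite !ffunE; case: splitP => j /= h.
  by have := ltn_ord j; rewrite -h ltnNge leq_addr.
by congr (t _); apply: val_inj => /=; apply/eqP; rewrite -(eqn_add2l k) h.
Qed.

Lemma fcat_split k l (s : cfg X (k + l)) : fcat (cleft s) (cright s) = s.
Proof.
apply/ffunP => i; rewrite !ffunE; case: splitP => j h; rewrite !ffunE; congr (s _); exact: val_inj.
Qed.

Lemma fcat_eq k l (s s' : cfg X k) (t t' : cfg X l) :
  (fcat s t == fcat s' t') = (s == s') && (t == t').
Proof.
apply/eqP/andP => [h|[/eqP -> /eqP ->]] //; split; apply/eqP.
  by rewrite -(cleft_fcat s t) h cleft_fcat.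
by rewrite -(cright_fcat s t) h cright_fcat.
Qed.

Lemma eq_fcat k l (v : cfg X (k + l)) (s : cfg X k) (t : cfg X l) :
  (v == fcat s t) = (cleft v == s) && (cright v == t).
Proof. by rewrite -{1}[v]fcat_split fcat_eq. Qed.

Lemma offeq_left k l (s t : cfg X (k + l)) : offeq 0 k s t = (cright s == cright t).
Proof.
apply/forallP/eqP => [h|h i].
  apply/ffunP => i; rewrite !ffunE; have := h (rshift k i).
  by rewrite /= ?add0n ltnNge leq_addr /= => /eqP.
have [ik|ik] := ltnP i k; first by rewrite /= ?add0n ?ik.
apply/orP; right.
have il : (i - k < l)%N by rewrite ltn_subLR.
have := congr1 (fun f : cfg X l => f (Ordinal il)) h; rewrite !ffunE.
have -> : rshift k (Ordinal il) = i by apply: val_inj; rewrite /= subnKC.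
by move/eqP.
Qed.

Lemma offeq_right k l (s t : cfg X (k + l)) : offeq k l s t = (cleft s == cleft t).
Proof.
apply/forallP/eqP => [h|h i].
  apply/ffunP => i; rewrite !ffunE; have := h (lshift l i).
  by rewrite /= leqNgt ltn_ord /= => /eqP.
case: (leqP k i) => ik /=; first by rewrite ltn_ord.
have := congr1 (fun f : cfg X k => f (Ordinal ik)) h; rewrite !ffunE.
have -> : lshift l (Ordinal ik) = i by apply: val_inj.
by move/eqP.
Qed.

Lemma window_pull (x : int -> X) n N j k (phi : 'I_k -> 'I_N) :
  (forall i, phi i = j + i :> nat)%N -> pull phi (window x n N) = window x (n + j%:Z) k.
Proof. by move=> h; apply/ffunP => i; rewrite !ffunE h PoszD addrA. Qed.

Lemma window_left (x : int -> X) n k l : cleft (window x n (k + l)) = window x n k.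
Proof. by rewrite /cleft (@window_pull _ _ _ 0) // addr0. Qed.

Lemma window_right (x : int -> X) n k l : cright (window x n (k + l)) = window x (n + k%:Z) l.
Proof. by rewrite /cright (@window_pull _ _ _ k). Qed.

Lemma window_fcat (x : int -> X) n k l :
  window x n (k + l) = fcat (window x n k) (window x (n + k%:Z) l).
Proof. by rewrite -(window_left x n k l) -(window_right x n k l) fcat_split. Qed.

Lemma cfg_sum (V : nmodType) k l (F : cfg X (k + l) -> V) :
  \sum_s F s = \sum_a \sum_b F (fcat a b).
Proof.
rewrite pair_bigA /= (reindex (fun p : cfg X k * cfg X l => fcat p.1 p.2)) //=.
exists (fun s => (cleft s, cright s)) => [[a b] _|s _] /=; last exact: fcat_split.
by rewrite cleft_fcat cright_fcat.
Qed.

Lemma fcat_bij k l : bijective (fun p : cfg X k * cfg X l => fcat p.1 p.2).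
Proof.
exists (fun s => (cleft s, cright s)) => [[a b]|s] /=; last exact: fcat_split.
by rewrite cleft_fcat cright_fcat.
Qed.

End Windows.

Section BState.
Variables (R : realType) (I : finType) (om : bfamily R I).
Arguments om : clear implicits.
Hypothesis st : is_bstate om.

Lemma bstate_lin n k : lin_op (om n k). Proof. by move=> c b1 b2; have [] := st n k. Qed.
Lemma bstate_pos n k : pos_op (om n k). Proof. by have [_ []] := st n k. Qed.
Lemma bstate1 n k : om n k (@idop R _) = 1. Proof. by have [_ [_ []]] := st n k. Qed.

(** The consistency axioms add one site at a time. The induction removes the last site while the
    small window starts at the left end, and the first site otherwise. *)
Lemma bstate_window N : forall k j n (phi : 'I_k -> 'I_N) (b : bop R I k),
  (forall i, phi i = j + i :> nat)%N -> (j + k <= N)%N ->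
  om (n + j%:Z) k b = om n N (fun s t => b (pull phi s) (pull phi t) * (offeq j k s t)%:R).
Proof.
elim: N => [|N IH] k j n phi b hphi hN.
  have [j0 k0] : j = 0%N /\ k = 0%N by lia.
  subst j k; rewrite addr0; congr om; apply: opP => s t.
  have e u : pull phi u = u :> cfg I 0 by apply/ffunP => -[].
  rewrite !e.
  have -> : offeq 0 0 s t by apply/forallP => -[].
  by rewrite mulr1.
case: j hphi hN => [|j] hphi hN.
  rewrite add0n in hN; have [ek|hk] := eqVneq k N.+1.
    subst k; rewrite addr0; congr om; apply: opP => s t.
    have e u : pull phi u = u :> cfg I N.+1.
      by apply/ffunP => i; rewrite ffunE; congr (u _); apply: val_inj; rewrite /= hphi.
    rewrite !e.
    have -> : offeq 0 N.+1 s t by apply/forallP => i; rewrite /= ?add0n ltn_ord.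
    by rewrite mulr1.
  have kN : (k <= N)%N by lia.
  pose phi' (i : 'I_k) : 'I_N := Ordinal (leq_trans (ltn_ord i) kN).
  rewrite (IH k 0%N n phi' b) //.
  have [_ [_ [_ [-> _]]]] := st n N.
  congr om; apply: opP => s t; rewrite /extR -mulrA; congr (_ * _).
    have P u : pull phi' (cinit u) = pull phi u :> cfg I k.
      by apply/ffunP => i; rewrite !ffunE; congr (u _); apply: val_inj; rewrite /= hphi.
    by rewrite !P.
  rewrite -natrM mulnb; congr (nat_of_bool _)%:R.
  apply/andP/forallP => [[/forallP h1 /eqP h2] i|h].
    have [iN|iN] := ltnP i N.
      have := h1 (Ordinal iN); rewrite !ffunE /=.
      by have -> : widen_ord (leqnSn N) (Ordinal iN) = i by apply: val_inj.
    have -> : i = ord_max by apply: val_inj => /=; have := ltn_ord i; lia.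
    by rewrite h2 eqxx orbT.
  split; last first.
    have := h ord_max; rewrite /= ?add0n => /orP[|//]; lia.
  by apply/forallP => i; rewrite !ffunE; have := h (widen_ord (leqnSn N) i).
have jN (i : 'I_k) : (j + i < N)%N by have := ltn_ord i; lia.
pose phi' (i : 'I_k) : 'I_N := Ordinal (jN i).
have hphi' i : phi' i = (j + i)%N :> nat by [].
have -> : n + j.+1%:Z = (n + 1) + j%:Z by rewrite -addrA -PoszD.
rewrite (IH k j (n + 1) phi' b hphi') //.
have [_ [_ [_ [_ ->]]]] := st (n + 1) N.
rewrite addrK; congr om; apply: opP => s t; rewrite /extL mulrC -mulrA; congr (_ * _).
  have P u : pull phi' (ctail u) = pull phi u :> cfg I k.
    apply/ffunP => i; rewrite !ffunE; congr (u _); apply: val_inj.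
    by rewrite /= hphi.
  by rewrite !P.
rewrite -natrM mulnb; congr (nat_of_bool _)%:R.
apply/andP/forallP => [[/forallP h1 /eqP h2] i|h].
  have [e|iN] := eqVneq i ord0; first by rewrite e h2 eqxx orbT.
  have [i' ->] : exists i', i = lift ord0 i'.
    by case: (unliftP ord0 i) iN => [i' ->|->]; [exists i'|rewrite eqxx].
  by have := h1 i'; rewrite !ffunE /= /bump /=; lia.
split; last by have := h ord0.
apply/forallP => i; rewrite !ffunE; have := h (lift ord0 i); rewrite /= /bump /=; lia.
Qed.

Lemma bstate_left n k l (b : bop R I k) :
  om n k b = om n (k + l) (fun s t => b (cleft s) (cleft t) * (cright s == cright t)%:R).
Proof.
rewrite -{1}[n]addr0 (@bstate_window (k + l) k 0 n (@lshift k l) b) ?leq_addr //.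
by congr om; apply: opP => s t; rewrite offeq_left.
Qed.

Lemma bstate_right n k l (b : bop R I l) :
  om (n + k%:Z) l b = om n (k + l) (fun s t => b (cright s) (cright t) * (cleft s == cleft t)%:R).
Proof.
rewrite (@bstate_window (k + l) l k n (@rshift k l) b) //.
by congr om; apply: opP => s t; rewrite offeq_right.
Qed.

Lemma bstate_entry n k s t :
  `|complex.Re (om n k (@munit R _ s t))| <= 1 /\ `|complex.Im (om n k (@munit R _ s t))| <= 1.
Proof.
have := @psd_entry R _ (dens (om n k)) t s (psd_dens (@bstate_lin n k) (@bstate_pos n k)).
by apply; rewrite /trR (tr_dens (@bstate_lin n k)) bstate1.
Qed.

End BState.
Arguments bstate_lin {R I om} st n k.
Arguments bstate_pos {R I om} st n k.
Arguments bstate1 {R I om} st n k.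
Arguments bstate_entry {R I om} st n k s t.

Local Open Scope classical_set_scope.

(** * Integration over inputs and densities of joint windows *)

Section CylinderIntegrals.
Variables (R : realType) (A : finType) (a0 : A).
Local Notation C := R[i].
Local Notation toC := (real_complex R).
Local Notation SA := (SA a0).
Implicit Types (p : probability SA R).

Definition bmeas (g : SA -> R) :=
  measurable_fun [set: SA] g /\ exists M, forall x, `|g x| <= M.

Definition bmC (g : SA -> C) :=
  bmeas (fun x => complex.Re (g x)) /\ bmeas (fun x => complex.Im (g x)).

Lemma bmeas_int p g : bmeas g -> p.-integrable [set: SA] (EFin \o g).
Proof.
case=> mg [M hM]; apply: measurable_bounded_integrable => //.
  by apply: le_lt_trans (probability_le1 p measurableT) _; rewrite ltry.
exists M; split; first exact: num_real.
by move=> N MN x _; apply: le_trans (hM x) _; exact: ltW.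
Qed.

Lemma bmeasD g h : bmeas g -> bmeas h -> bmeas (fun x => g x + h x).
Proof.
move=> [mg [M hM]] [mh [N hN]]; split; first exact: measurable_funD.
by exists (M + N) => x; apply: le_trans (ler_normD _ _) _; rewrite lerD.
Qed.

Lemma bmeasM g h : bmeas g -> bmeas h -> bmeas (fun x => g x * h x).
Proof.
move=> [mg [M hM]] [mh [N hN]]; split; first exact: measurable_funM.
exists (M * N) => x; rewrite normrM; apply: ler_pM => //.
Qed.

Lemma bmeas_cst c : bmeas (fun=> c).
Proof. by split; [exact: measurable_cst|exists `|c|]. Qed.

Lemma bmeasN g : bmeas g -> bmeas (fun x => - g x).
Proof.
move=> h; have := bmeasM (bmeas_cst (-1)) h; congr bmeas.
by apply/funext => x; rewrite mulN1r.
Qed.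

Lemma bmC_cst c : bmC (fun=> c).
Proof. by split; exact: bmeas_cst. Qed.

Lemma bmCD g h : bmC g -> bmC h -> bmC (fun x => g x + h x).
Proof.
move=> [g1 g2] [h1 h2]; split.
  have -> : (fun x => complex.Re (g x + h x)) = (fun x => complex.Re (g x) + complex.Re (h x)).
    by apply/funext => x; rewrite cReD.
  exact: bmeasD.
have -> : (fun x => complex.Im (g x + h x)) = (fun x => complex.Im (g x) + complex.Im (h x)).
  by apply/funext => x; rewrite cImD.
exact: bmeasD.
Qed.

Lemma bmCM g h : bmC g -> bmC h -> bmC (fun x => g x * h x).
Proof.
move=> [g1 g2] [h1 h2]; split.
  have -> : (fun x => complex.Re (g x * h x)) = (fun x => complex.Re (g x) * complex.Re (h x)
      + - (complex.Im (g x) * complex.Im (h x))).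
    by apply/funext => x; rewrite cReM.
  by apply: bmeasD; [|apply: bmeasN]; apply: bmeasM.
have -> : (fun x => complex.Im (g x * h x)) = (fun x => complex.Re (g x) * complex.Im (h x)
      + complex.Im (g x) * complex.Re (h x)).
  by apply/funext => x; rewrite cImM.
by apply: bmeasD; apply: bmeasM.
Qed.

Lemma bmC_sum (T : Type) (l : seq T) (F : T -> SA -> C) : (forall i, bmC (F i)) ->
  bmC (fun x => \sum_(i <- l) F i x).
Proof.
move=> h; elim: l => [|i l IH].
  have -> : (fun x : SA => \sum_(i <- [::]) F i x) = (fun=> 0).
    by apply/funext => x; rewrite big_nil.
  exact: bmC_cst.
have -> : (fun x : SA => \sum_(j <- i :: l) F j x) = (fun x => F i x + \sum_(j <- l) F j x).
  by apply/funext => x; rewrite big_cons.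
exact: bmCD.
Qed.

Lemma measurable_cyl n k (P : pred (cfg A k)) : measurable [set x : SA | P (window x n k)].
Proof.
have -> : [set x : SA | P (window x n k)] = \bigcup_(a in [set` P]) [set x : SA | window x n k = a].
  apply/seteqP; split => x /= => [h|[a Pa wa]]; first by exists (window x n k).
  by rewrite /= in wa; rewrite wa.
apply: fin_bigcup_measurable; first exact: finite_finset.
by move=> a _; apply: sub_sigma_algebra; exists n, k, a.
Qed.

Lemma bmC_ind n k (P : pred (cfg A k)) : bmC (fun x => (P (window x n k))%:R).
Proof.
have E : (fun x : SA => ((P (window x n k))%:R : R)) = \1_[set x : SA | P (window x n k)].
  by apply/funext => x; rewrite indicE mem_setE.
split.
  have -> : (fun x : SA => complex.Re ((P (window x n k))%:R : C)) = (fun x => (P (window x n k))%:R).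
    by apply/funext => x; case: (P _).
  split; last by exists 1 => x; case: (P _); rewrite ?normr1 ?normr0.
  by rewrite E; apply: measurable_indic; exact: measurable_cyl.
have -> : (fun x : SA => complex.Im ((P (window x n k))%:R : C)) = (fun=> 0).
  by apply/funext => x; case: (P _).
exact: bmeas_cst.
Qed.

Lemma cint_lin p (c : C) f g : bmC f -> bmC g ->
  cint p (fun x => c * f x + g x) = c * cint p f + cint p g.
Proof.
move=> [f1 f2] [g1 g2]; apply: conjC_eqP.
  rewrite cReD cReM /cint /=.
  have -> : (fun x => complex.Re (c * f x + g x)) = (fun x =>
     (complex.Re c * complex.Re (f x) + - complex.Im c * complex.Im (f x)) + complex.Re (g x)).
    by apply/funext => x; rewrite cReD cReM mulNr.
  have i1 := bmeas_int p (bmeasM (bmeas_cst (complex.Re c)) f1).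
  have i2 := bmeas_int p (bmeasM (bmeas_cst (- complex.Im c)) f2).
  rewrite RintegralD //; last first.
  - exact: bmeas_int.
  - by apply: bmeas_int; apply: bmeasD; apply: bmeasM => //; exact: bmeas_cst.
  rewrite RintegralD // !RintegralZl //; last first.
  - exact: bmeas_int.
  - exact: bmeas_int.
  by rewrite mulNr.
rewrite cImD cImM /cint /=.
have -> : (fun x => complex.Im (c * f x + g x)) = (fun x =>
   (complex.Re c * complex.Im (f x) + complex.Im c * complex.Re (f x)) + complex.Im (g x)).
  by apply/funext => x; rewrite cImD cImM.
have i1 := bmeas_int p (bmeasM (bmeas_cst (complex.Re c)) f2).
have i2 := bmeas_int p (bmeasM (bmeas_cst (complex.Im c)) f1).
rewrite RintegralD //; last first.
- exact: bmeas_int.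
- by apply: bmeas_int; apply: bmeasD; apply: bmeasM => //; exact: bmeas_cst.
rewrite RintegralD // !RintegralZl //; last first.
- exact: bmeas_int.
- exact: bmeas_int.
Qed.

Lemma cint_ge0 p g : (forall x, 0 <= g x) -> 0 <= cint p g.
Proof.
move=> h; rewrite /cint.
have -> : (fun x => complex.Im (g x)) = (fun=> 0).
  by apply/funext => x; rewrite (ge0_toC (h x)).
rewrite Rintegral_cst // mul0r lecE /= eqxx /=; apply: Rintegral_ge0 => x _.
exact: ge0_Re.
Qed.

Lemma cint_cst p c : cint p (fun=> c) = c.
Proof.
rewrite /cint !Rintegral_cst //.
have -> : fine (p [set: SA]) = 1 by rewrite (@probability_setT _ _ _ p).
by rewrite !mulr1; case: c.
Qed.

Lemma cint_ind p n k (P : pred (cfg A k)) :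
  cint p (fun x => (P (window x n k))%:R) = toC (fine (p [set x : SA | P (window x n k)])).
Proof.
rewrite /cint.
have -> : (fun x : SA => complex.Im ((P (window x n k))%:R : C)) = (fun=> 0).
  by apply/funext => x; case: (P _).
rewrite Rintegral_cst // mul0r /real_complex_def; congr Complex.
rewrite /Rintegral; congr fine.
have -> : (fun x : SA => (complex.Re ((P (window x n k))%:R : C))%:E) =
   (fun x => (\1_[set x : SA | P (window x n k)] x)%:E).
  apply/funext => x; rewrite indicE.
  have -> : (x \in [set y : SA | P (window y n k)]) = P (window x n k) by rewrite mem_setE.
  by case: (P _).
rewrite integral_indic ?setIT //; exact: measurable_cyl.
Qed.

Lemma cint_Re_le p f g : bmC f -> bmC g -> (forall x, complex.Re (f x) <= complex.Re (g x)) ->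
  complex.Re (cint p f) <= complex.Re (cint p g).
Proof.
move=> [f1 _] [g1 _] h; apply: le_Rintegral => //; exact: bmeas_int.
Qed.

Section Channel.
Variables (I : finType) (W : chan R A I).
Arguments W : clear implicits.
Hypothesis cq : cq_channel a0 W.

Lemma W_st x : is_bstate (W x). Proof. by have [] := cq. Qed.

(** Matrix units are measurable by the definition of a channel and bounded by [bstate_entry];
    linearity extends both properties to every b. *)
Lemma bmC_W n k (b : bop R I k) : bmC (fun x => W x n k b).
Proof.
have -> : (fun x : SA => W x n k b) = (fun x => \sum_s \sum_t b s t * W x n k (@munit R _ s t)).
  by apply/funext => x; rewrite (lin_opE b (bstate_lin (W_st x) n k)).
apply: bmC_sum => s; apply: bmC_sum => t; apply: bmCM; first exact: bmC_cst.
have [_ h] := cq; have [m1 m2] := h n k (@munit R _ s t).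
by split; split => //; exists 1 => x; have [] := bstate_entry (W_st x) n k s t.
Qed.

Lemma bmC_Ww n k n' N (F : cfg A N -> bop R I k) : bmC (fun x => W x n k (F (window x n' N))).
Proof.
have -> : (fun x : SA => W x n k (F (window x n' N))) =
   (fun x => \sum_a (window x n' N == a)%:R * W x n k (F a)).
  apply/funext => x; rewrite (bigD1 (window x n' N)) //= eqxx mul1r big1 ?addr0 //.
  by move=> a /negbTE na; rewrite eq_sym na mul0r.
apply: bmC_sum => a; apply: bmCM; last exact: bmC_W.
exact: (bmC_ind n' (fun w => w == a)).
Qed.

Variable p : probability SA R.

(** Input sites [n, n + N) and output sites [n', n' + k) are chosen separately. Only blocks of [b]
    diagonal in the input are read, which makes the classical input a commuting part of a matrix
    algebra. *)
Definition wstate n N n' k (b : op R (cfg A N * cfg I k)%type) : C :=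
  cint p (fun x => W x n' k (fun s t => b (window x n N, s) (window x n N, t))).

Lemma wstate_lin n N n' k : lin_op (@wstate n N n' k).
Proof.
move=> c b1 b2; rewrite /wstate -cint_lin; last first.
- exact: (bmC_Ww n' n (fun w s t => b2 (w, s) (w, t))).
- exact: (bmC_Ww n' n (fun w s t => b1 (w, s) (w, t))).
by congr cint; apply/funext => x; rewrite -(bstate_lin (W_st x) _ _).
Qed.

Lemma psd_block (P Q : finType) (b : op R (P * Q)%type) a : psd b -> psd (fun s t => b (a, s) (a, t)).
Proof.
move=> h v; have := h (fun u => v u.2 * (u.1 == a)%:R).
congr (0 <= _); rewrite pair_sum (bigD1 a) //= [X in _ + X]big1 ?addr0; last first.
  by move=> a' /negbTE na; rewrite big1 // => s _; rewrite big1 // => t _ /=; rewrite na mulr0 conjC0 !mul0r.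
apply: eq_bigr => s _; rewrite pair_sum (bigD1 a) //= [X in _ + X]big1 ?addr0; last first.
  by move=> a' /negbTE na; rewrite big1 // => t _ /=; rewrite na !mulr0.
by apply: eq_bigr => t _; rewrite eqxx !mulr1.
Qed.

Lemma wstate_pos n N n' k : pos_op (@wstate n N n' k).
Proof.
move=> b h; apply: cint_ge0 => x; apply: (bstate_pos (W_st x) n' k).
exact: (@psd_block (cfg A N) (cfg I k) b (@window A x n N) h).
Qed.

Lemma wstate1 n N n' k : @wstate n N n' k (@idop R _) = 1.
Proof.
rewrite /wstate -[RHS](cint_cst p); congr cint; apply/funext => x.
rewrite -(bstate1 (W_st x) n' k); congr (W x _ _ _); apply: opP => s t.
by rewrite /idop -pair_eqE /= eqxx.
Qed.

Definition DJ n N n' k : op R (cfg A N * cfg I k)%type := dens (@wstate n N n' k).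

Arguments DJ : clear implicits.

Lemma psd_DJ n N n' k : psd (DJ n N n' k).
Proof. exact: (psd_dens (@wstate_lin n N n' k) (@wstate_pos n N n' k)). Qed.

Lemma tr_DJ n N n' k : tr (DJ n N n' k) = 1.
Proof. by rewrite tr_dens ?wstate1 //; exact: wstate_lin. Qed.

Lemma trR_DJ n N n' k : trR (DJ n N n' k) = 1.
Proof. by rewrite /trR tr_DJ. Qed.

Lemma DJ_test n N n' k b : tr (opm (DJ n N n' k) b) = @wstate n N n' k b.
Proof. by rewrite -lin_op_tr //; exact: wstate_lin. Qed.

Lemma wstate_sum n N n' k (T : finType) (F : T -> op R (cfg A N * cfg I k)%type) :
  \sum_i @wstate n N n' k (F i) = @wstate n N n' k (fun s t => \sum_i F i s t).
Proof.
have := lin_op_sum (index_enum T) (fun=> 1) F (@wstate_lin n N n' k).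
under [in RHS]eq_bigr do rewrite mul1r.
move=> <-; congr (@wstate n N n' k _); apply: opP => s t; by under eq_bigr do rewrite mul1r.
Qed.

(** Together with [DJ_outr], [DJ_inl] and [DJ_inr]: deleting sites at one end is a partial trace, by
    consistency of states on the output side and by partition into words on the input side. *)
Lemma DJ_outl n N n' k l a s a' t : DJ n N n' k (a, s) (a', t) =
  \sum_u DJ n N n' (k + l) (a, fcat s u) (a', fcat t u).
Proof.
rewrite /DJ /dens wstate_sum /wstate; congr cint; apply/funext => x.
rewrite (bstate_left (W_st x) n' l); congr (W x _ _ _); apply: opP => v w.
rewrite /munit -!pair_eqE /=.
under eq_bigr do rewrite !eq_fcat.
rewrite (bigD1 (cright v)) //= eqxx [\sum_(_ | _) _]big1 ?addr0; last first.
  by move=> u /negbTE nu; rewrite [cright v == u]eq_sym nu !andbF.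
rewrite andbT -natrM mulnb [cright v == _]eq_sym.
by congr (nat_of_bool _)%:R; rewrite -!andbA.
Qed.

Lemma DJ_outr n N n' k l a s a' t : DJ n N (n' + k%:Z) l (a, s) (a', t) =
  \sum_u DJ n N n' (k + l) (a, fcat u s) (a', fcat u t).
Proof.
rewrite /DJ /dens wstate_sum /wstate; congr cint; apply/funext => x.
rewrite (bstate_right (W_st x) n' k); congr (W x _ _ _); apply: opP => v w.
rewrite /munit -!pair_eqE /=.
under eq_bigr do rewrite !eq_fcat.
rewrite (bigD1 (cleft v)) //= eqxx [\sum_(_ | _) _]big1 ?addr0; last first.
  by move=> u /negbTE nu; rewrite [cleft v == u]eq_sym nu !andbF.
rewrite /= -natrM mulnb [cleft v == _]eq_sym.
by congr (nat_of_bool _)%:R; rewrite -!andbA; do !bool_congr; rewrite andbC.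
Qed.

Lemma DJ_inl n N M n' k a s a' t : DJ n N n' k (a, s) (a', t) =
  \sum_u DJ n (N + M) n' k (fcat a u, s) (fcat a' u, t).
Proof.
rewrite /DJ /dens wstate_sum /wstate; congr cint; apply/funext => x.
congr (W x _ _ _); apply: opP => v w; rewrite /munit -!pair_eqE /= window_fcat.
under eq_bigr do rewrite /= !fcat_eq.
rewrite (bigD1 (@window A x (n + N%:Z) M)) //= eqxx [\sum_(_ | _) _]big1 ?addr0 ?andbT //.
by move=> u /negbTE nu; rewrite [_ == u]eq_sym nu !andbF.
Qed.

Lemma DJ_inr n N M n' k a s a' t : DJ (n + N%:Z) M n' k (a, s) (a', t) =
  \sum_u DJ n (N + M) n' k (fcat u a, s) (fcat u a', t).
Proof.
rewrite /DJ /dens wstate_sum /wstate; congr cint; apply/funext => x.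
congr (W x _ _ _); apply: opP => v w; rewrite /munit -!pair_eqE /= window_fcat.
under eq_bigr do rewrite /= !fcat_eq.
rewrite (bigD1 (@window A x n N)) //= eqxx [\sum_(_ | _) _]big1 ?addr0 //.
by move=> u /negbTE nu; rewrite [_ == u]eq_sym nu.
Qed.

Definition DA n N : op R (cfg A N) := fun a a' =>
  toC (fine (p [set x : SA | window x n N = a])) *+ (a == a').
Definition DB n k : op R (cfg I k) := fun s t => cint p (fun x => W x n k (@munit R _ t s)).

Arguments DA : clear implicits.
Arguments DB : clear implicits.

Lemma ptr1_DJ n N n' k : ptr1 (DJ n N n' k) = DA n N.
Proof.
apply: opP => a a'; rewrite /ptr1 /DJ /dens wstate_sum /wstate /DA.
have -> : (fun x : SA => W x n' k (fun s t => \sum_i @munit R _ (a', i) (a, i) (window x n N, s) (window x n N, t)))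
   = (fun x => ((window x n N == a) && (a == a'))%:R).
  apply/funext => x; set c : C := (X in _ = X).
  have := bstate_lin (W_st x) n' k c (@idop R _) (fun _ _ => 0).
  rewrite (lin_op0 (bstate_lin (W_st x) n' k)) (bstate1 (W_st x)) mulr1 addr0 => <-.
  congr (W x _ _ _); apply: opP => s t; rewrite addr0 /idop /munit -!pair_eqE /= /c.
  rewrite (bigD1 s) //= eqxx [\sum_(_ | _) _]big1 ?addr0; last first.
    by move=> u /negbTE nu; rewrite [s == u]eq_sym nu andbF.
  rewrite andbT -natrM mulnb [t == s]eq_sym; congr (nat_of_bool _)%:R.
  have [->|ne] := eqVneq a a'; first by rewrite andbT; case: (_ == _).
  rewrite andbF; apply/negbTE/negP => /andP[/eqP h /andP[/eqP h' _]].
  by rewrite -h' h eqxx in ne.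
case: (a == a'); rewrite ?mulr1n ?mulr0n.
  have := cint_ind p n (fun w => w == a).
  have -> : [set x : SA | window x n N == a] = [set x : SA | window x n N = a].
    by apply/seteqP; split => x /= /eqP.
  by move=> <-; congr cint; apply/funext => x; rewrite andbT.
rewrite -[RHS](cint_cst p); congr cint; apply/funext => x; by rewrite andbF.
Qed.

Lemma ptr2_DJ n N n' k : ptr2 (DJ n N n' k) = DB n' k.
Proof.
apply: opP => s t; rewrite /ptr2 /DJ /dens wstate_sum /wstate /DB.
congr cint; apply/funext => x; congr (W x _ _ _); apply: opP => v w; rewrite /munit -!pair_eqE /=.
rewrite (bigD1 (@window A x n N)) //= eqxx [\sum_(_ | _) _]big1 ?addr0 //.
by move=> u /negbTE nu; rewrite [_ == u]eq_sym nu.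
Qed.

(** The off-diagonal blocks, set to 0 in [dens_joint], vanish in [DJ] as well because a window
    cannot equal two different words. *)
Lemma dens_jointE k : dens_joint (psiPW p W) k = DJ 1 k 1 k.
Proof.
apply: opP => -[a s] [a' t]; rewrite /dens_joint /DJ /dens /wstate /psiPW /=.
have [<-|ne] := eqVneq a a'.
  congr cint; apply/funext => x; congr (W x _ _ _).
  rewrite /munit /zeroop; apply: opP => v w; rewrite -!pair_eqE /=.
  by case: (_ == a) => /=.
rewrite -[LHS](cint_cst p); congr cint; apply/funext => x.
rewrite -(lin_op0 (bstate_lin (W_st x) 1 k)); congr (W x _ _ _); apply: opP => v w.
rewrite /munit -!pair_eqE /=; symmetry; apply/eqP; rewrite pnatr_eq0 eqb0.
by apply/negP => /andP[/andP[/eqP h _] /andP[/eqP h' _]]; rewrite -h -h' eqxx in ne.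
Qed.

Lemma dens_inE k : dens_in (psiPW p W) k = DA 1 k.
Proof.
apply: opP => a a'; rewrite /dens_in /psiPW /DA; case: (a == a'); rewrite ?mulr0n // mulr1n.
have := cint_ind p 1 (fun w => w == a).
have -> : [set x : SA | window x 1 k == a] = [set x : SA | window x 1 k = a].
  by apply/seteqP; split => x /= /eqP.
move=> <-; congr cint; apply/funext => x; case: eqP => _.
  exact: (bstate1 (W_st x)).
exact: (lin_op0 (bstate_lin (W_st x) 1 k)).
Qed.

End Channel.
End CylinderIntegrals.
Arguments wstate {R A a0 I} W p n N n' k.
Arguments DJ {R A a0 I} W p n N n' k.
Arguments DA {R A a0} p n N.
Arguments DB {R A a0 I} W p n k.
Arguments DJ_inl {R A a0 I W} cq p n N M n' k a s a' t.
Arguments DJ_inr {R A a0 I W} cq p n N M n' k a s a' t.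
Arguments DJ_outl {R A a0 I W} cq p n N n' k l a s a' t.
Arguments DJ_outr {R A a0 I W} cq p n N n' k l a s a' t.
Arguments psd_DJ {R A a0 I W} cq p n N n' k.
Arguments tr_DJ {R A a0 I W} cq p n N n' k.
Arguments trR_DJ {R A a0 I W} cq p n N n' k.
Arguments ptr1_DJ {R A a0 I W} cq p n N n' k.
Arguments ptr2_DJ {R A a0 I W} cq p n N n' k.

(** * Entropy inequalities between windows *)

Section WindowEntropy.
Variables (R : realType) (A : finType) (a0 : A) (I : finType) (W : chan R A I).
Arguments W : clear implicits.
Hypothesis cq : cq_channel a0 W.
Variable p : probability (SA a0) R.
Local Notation DJ := (DJ W p).
Local Notation DB := (DB W p).
Local Notation DA := (DA p).

Definition SJ n k : R := ent (DJ n k n k).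
Definition SI n k : R := ent (DA n k).
Definition SO n k : R := ent (DB n k).

(** An empty output window exhibits [DA] as a marginal of a joint density; [DB] is treated likewise
    with an empty input window. *)
Lemma psd_DA n k : psd (DA n k).
Proof. by rewrite -(ptr1_DJ cq p n k n 0); apply: psd_ptr1; exact: psd_DJ. Qed.
Lemma psd_DB n k : psd (DB n k).
Proof. by rewrite -(ptr2_DJ cq p n 0 n k); apply: psd_ptr2; exact: psd_DJ. Qed.
Arguments psd_DA : clear implicits.
Arguments psd_DB : clear implicits.
Lemma tr_DA n k : tr (DA n k) = 1.
Proof. by rewrite -(ptr1_DJ cq p n k n 0) tr_ptr1 tr_DJ. Qed.
Lemma tr_DB n k : tr (DB n k) = 1.
Proof. by rewrite -(ptr2_DJ cq p n 0 n k) tr_ptr2 tr_DJ. Qed.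
Lemma trR_DA n k : trR (DA n k) = 1. Proof. by rewrite /trR tr_DA. Qed.
Lemma trR_DB n k : trR (DB n k) = 1. Proof. by rewrite /trR tr_DB. Qed.

Lemma DAE n k n' l a a' : DA n k a a' = \sum_s DJ n k n' l (a, s) (a', s).
Proof. by rewrite -(ptr1_DJ cq p n k n' l). Qed.
Lemma DBE n k n' l s t : DB n' l s t = \sum_a DJ n k n' l (a, s) (a, t).
Proof. by rewrite -(ptr2_DJ cq p n k n' l). Qed.

Arguments DAE : clear implicits.
Arguments DBE : clear implicits.

Lemma DA_left n k l a a' : DA n k a a' = \sum_u DA n (k + l) (fcat a u) (fcat a' u).
Proof.
rewrite (DAE n k n 0); under eq_bigr do rewrite (DJ_inl cq p n k l).
by rewrite exchange_big /=; apply: eq_bigr => u _; rewrite (DAE n (k + l) n 0).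
Qed.

Lemma DA_right n k l a a' : DA (n + k%:Z) l a a' = \sum_u DA n (k + l) (fcat u a) (fcat u a').
Proof.
rewrite (DAE (n + k%:Z) l n 0); under eq_bigr do rewrite (DJ_inr cq p n k l).
by rewrite exchange_big /=; apply: eq_bigr => u _; rewrite (DAE n (k + l) n 0).
Qed.

Lemma DB_left n k l s t : DB n k s t = \sum_u DB n (k + l) (fcat s u) (fcat t u).
Proof.
rewrite (DBE n 0 n k); under eq_bigr do rewrite (DJ_outl cq p n 0 n k l).
by rewrite exchange_big /=; apply: eq_bigr => u _; rewrite (DBE n 0 n (k + l)).
Qed.

Lemma DB_right n k l s t : DB (n + k%:Z) l s t = \sum_u DB n (k + l) (fcat u s) (fcat u t).
Proof.
rewrite (DBE n 0 (n + k%:Z) l); under eq_bigr do rewrite (DJ_outr cq p n 0 n k l).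
by rewrite exchange_big /=; apply: eq_bigr => u _; rewrite (DBE n 0 n (k + l)).
Qed.

Lemma DJ_left n k l u v : DJ n k n k u v =
  \sum_(w : cfg A l * cfg I l)
    DJ n (k + l) n (k + l) (fcat u.1 w.1, fcat u.2 w.2) (fcat v.1 w.1, fcat v.2 w.2).
Proof.
case: u v => a s [a' t]; rewrite (DJ_inl cq p n k l) pair_sum /=.
by apply: eq_bigr => a2 _; rewrite (DJ_outl cq p n (k + l) n k l).
Qed.

Lemma DJ_right n k l u v : DJ (n + k%:Z) l (n + k%:Z) l u v =
  \sum_(w : cfg A k * cfg I k)
    DJ n (k + l) n (k + l) (fcat w.1 u.1, fcat w.2 u.2) (fcat w.1 v.1, fcat w.2 v.2).
Proof.
case: u v => a s [a' t]; rewrite (DJ_inr cq p n k l) pair_sum /=.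
by apply: eq_bigr => a2 _; rewrite (DJ_outr cq p n (k + l) n k l).
Qed.

Arguments DA_left : clear implicits.
Arguments DA_right : clear implicits.
Arguments DB_left : clear implicits.
Arguments DB_right : clear implicits.
Arguments DJ_left : clear implicits.
Arguments DJ_right : clear implicits.

Lemma SI_subadd n k l : SI n (k + l) <= SI n k + SI (n + k%:Z) l.
Proof.
rewrite /SI; apply: (@subadd _ _ _ _ (DA n (k + l)) _ _ _ (@fcat_bij A k l) (psd_DA _ _) (trR_DA _ _)) => a a'.
  exact: DA_left.
exact: DA_right.
Qed.

Lemma SO_subadd n k l : SO n (k + l) <= SO n k + SO (n + k%:Z) l.
Proof.
rewrite /SO; apply: (@subadd _ _ _ _ (DB n (k + l)) _ _ _ (@fcat_bij I k l) (psd_DB _ _) (trR_DB _ _)) => s t.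
  exact: DB_left.
exact: DB_right.
Qed.

Definition jcat k l (u : (cfg A k * cfg I k) * (cfg A l * cfg I l)) : cfg A (k + l) * cfg I (k + l) :=
  (fcat u.1.1 u.2.1, fcat u.1.2 u.2.2).

Lemma jcat_bij k l : bijective (@jcat k l).
Proof.
exists (fun v => ((cleft v.1, cleft v.2), (cright v.1, cright v.2))) => [[[a s] [b t]]|[v w]].
  by rewrite /jcat /= !cleft_fcat !cright_fcat.
by rewrite /jcat /= !fcat_split.
Qed.

Lemma SJ_subadd n k l : SJ n (k + l) <= SJ n k + SJ (n + k%:Z) l.
Proof.
rewrite /SJ; apply: (@subadd _ _ _ _ (DJ n (k + l) n (k + l)) _ _ _ (@jcat_bij k l) (psd_DJ cq _ _ _ _ _) (trR_DJ cq _ _ _ _ _)) => u v.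
  exact: DJ_left.
exact: DJ_right.
Qed.

Lemma SI_ge0 n k : 0 <= SI n k.
Proof. by apply: ent_ge0; [exact: psd_DA | rewrite trR_DA]. Qed.
Lemma SO_ge0 n k : 0 <= SO n k.
Proof. by apply: ent_ge0; [exact: psd_DB | rewrite trR_DB]. Qed.
Lemma SJ_ge0 n k : 0 <= SJ n k.
Proof. by apply: ent_ge0; [exact: psd_DJ | rewrite trR_DJ]. Qed.

Lemma ln_card_cfg (X : finType) k : ln (#|cfg X k|%:R : R) = k%:R * ln #|X|%:R.
Proof.
rewrite card_ffun card_ord; have [X0|X0] := posnP #|X|.
  rewrite X0 [ln 0%:R]ln0 // mulr0; case: k => [|k]; rewrite ?expn0 ?ln1 //.
  by rewrite exp0n // ln0.
by rewrite natrX lnXn ?ltr0n // mulr_natl.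
Qed.

Lemma SI_le n k : SI n k <= k%:R * ln #|A|%:R.
Proof. by rewrite -ln_card_cfg; apply: ent_le_card1; [exact: psd_DA | exact: trR_DA]. Qed.
Lemma SO_le n k : SO n k <= k%:R * ln #|I|%:R.
Proof. by rewrite -ln_card_cfg; apply: ent_le_card1; [exact: psd_DB | exact: trR_DB]. Qed.

Lemma SJ_le_marg n k : SJ n k <= SI n k + SO n k.
Proof.
have := ent_subadd (psd_DJ cq p n k n k) (trR_DJ cq p n k n k).
by rewrite ptr1_DJ // ptr2_DJ.
Qed.

Lemma SJ_le n k : SJ n k <= k%:R * (ln #|A|%:R + ln #|I|%:R).
Proof. by rewrite mulrDr; apply: le_trans (SJ_le_marg n k) _; rewrite lerD ?SI_le ?SO_le. Qed.

(** Subadditivity of the conditional entropy [SJ - SO] of input given output. With independent input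
    blocks it becomes superadditivity of the mutual information. *)
Lemma SJ_cond n k l :
  SJ n (k + l) + SO n k + SO (n + k%:Z) l <= SO n (k + l) + SJ n k + SJ (n + k%:Z) l.
Proof.
pose f (u : (cfg A k * cfg A l) * (cfg I k * cfg I l)) : cfg A (k + l) * cfg I (k + l) :=
  (fcat u.1.1 u.1.2, fcat u.2.1 u.2.2).
have bf : bijective f.
  exists (fun v => ((cleft v.1, cright v.1), (cleft v.2, cright v.2))) => [[[a b] [s t]]|[v w]].
    by rewrite /f /= !cleft_fcat !cright_fcat.
  by rewrite /f /= !fcat_split.
have := @cond_subadd R _ _ _ _ _ (DJ n (k + l) n (k + l)) f bf (psd_DJ cq _ _ _ _ _)
  (trR_DJ cq _ _ _ _ _) (ren (fun q => fcat q.1 q.2) (DB n (k + l)))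
  (DJ n k n k) (DJ (n + k%:Z) l (n + k%:Z) l) (DB n k) (DB (n + k%:Z) l).
rewrite (ren_ent (@fcat_bij I k l) (psd_DB _ _)); apply.
- by move=> s t; rewrite /ren (DBE n (k + l)) cfg_sum.
- by move=> a s a' t; rewrite (DJ_left n k l) pair_sum.
- by move=> a s a' t; rewrite (DJ_right n k l) pair_sum.
- by move=> s t; rewrite (DB_left n k l).
- by move=> s t; rewrite (DB_right n k l).
Qed.

Lemma DJ_inner_out n t m s r x y x' y' :
  DJ n t (n + m%:Z) s (x, y) (x', y') = \sum_z1 \sum_z3
    DJ n t n (m + (s + r)) (x, fcat z1 (fcat y z3)) (x', fcat z1 (fcat y' z3)).
Proof.
rewrite (DJ_outl cq p n t (n + m%:Z) s r); under eq_bigr do rewrite (DJ_outr cq p n t n m (s + r)).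
by rewrite exchange_big.
Qed.

Lemma DJ_inner_in n m s r n' k x y x' y' :
  DJ (n + m%:Z) s n' k (x, y) (x', y') = \sum_z1 \sum_z3
    DJ n (m + (s + r)) n' k (fcat z1 (fcat x z3), y) (fcat z1 (fcat x' z3), y').
Proof.
rewrite (DJ_inl cq p (n + m%:Z) s r n' k); under eq_bigr do rewrite (DJ_inr cq p n m (s + r) n' k).
by rewrite exchange_big.
Qed.

Arguments DJ_inner_out : clear implicits.
Arguments DJ_inner_in : clear implicits.

(** Forgetting the outputs on the first m and last r sites can only raise the conditional entropy of
    the input given the output. *)
Lemma SJ_restrict_out n m s r :
  SJ n (m + (s + r)) + SO (n + m%:Z) s <=
  ent (DJ n (m + (s + r)) (n + m%:Z) s) + SO n (m + (s + r)).
Proof.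
set t := (m + (s + r))%N.
pose g (u : cfg I s * (cfg I m * cfg I r)) : cfg I t := fcat u.2.1 (fcat u.1 u.2.2).
have bg : bijective g.
  exists (fun v => (cleft (cright v), (cleft v, cright (cright v)))) => [[y [z1 z3]]|v].
    by rewrite /g /= !(cleft_fcat, cright_fcat).
  by rewrite /g /= !fcat_split.
pose f (u : cfg A t * (cfg I s * (cfg I m * cfg I r))) : cfg A t * cfg I t := (u.1, g u.2).
have bf : bijective f.
  by case: bg => h hg gh; exists (fun v => (v.1, h v.2)) => [[x y]|[x y]]; rewrite /f /= ?hg ?gh.
rewrite /SO -(ren_ent bg (psd_DB n t)).
apply: (@ssa _ _ _ _ _ (DJ n t n t) f _ _ _ bf (psd_DJ cq _ _ _ _ _) (trR_DJ cq _ _ _ _ _)).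
- by move=> x y x' y'; rewrite (DJ_inner_out n t m s r) pair_sum.
- by move=> y z y' z'; rewrite /ren (DBE n t).
- move=> y y'; rewrite (DBE n t); apply: eq_bigr => x _.
  by rewrite (DJ_inner_out n t m s r) pair_sum.
Qed.

(** The m + r outer input sites are split off by subadditivity and bounded by the dimension of their
    algebra. *)
Lemma SJ_inner_le n m s r :
  ent (DJ n (m + (s + r)) (n + m%:Z) s) <= (m + r)%:R * ln #|A|%:R + SJ (n + m%:Z) s.
Proof.
set t := (m + (s + r))%N.
pose f (u : (cfg A m * cfg A r) * (cfg A s * cfg I s)) : cfg A t * cfg I s :=
  (fcat u.1.1 (fcat u.2.1 u.1.2), u.2.2).
have bf : bijective f.
  exists (fun v => ((cleft v.1, cright (cright v.1)), (cleft (cright v.1), v.2))) => [[[a b] [c d]]|[v w]].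
    by rewrite /f /= !(cleft_fcat, cright_fcat).
  by rewrite /f /= !fcat_split.
have pD := psd_DJ cq p n t (n + m%:Z) s; have tD := trR_DJ cq p n t (n + m%:Z) s.
have H := @subadd _ _ _ _ (DJ n t (n + m%:Z) s) f (ptr1 (ren f (DJ n t (n + m%:Z) s)))
  (DJ (n + m%:Z) s (n + m%:Z) s) bf pD tD.
apply: le_trans (H _ _) _ => //.
  by move=> [x y] [x' y']; rewrite (DJ_inner_in n m s r) pair_sum.
rewrite lerD2r; apply: le_trans (ent_le_card1 _ _) _.
- by apply: psd_ptr1; exact: ren_psd.
- by rewrite /trR tr_ptr1 (ren_tr bf).
have cA N : 0 < #|cfg A N|%:R :> R by rewrite ltr0n; apply/card_gt0P; exists [ffun=> a0].
by rewrite card_prod natrM lnM ?posrE // !ln_card_cfg natrD mulrDl.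
Qed.

End WindowEntropy.
Arguments SJ {R A a0 I} W p n k.
Arguments SI {R A a0} p n k.
Arguments SO {R A a0 I} W p n k.
Arguments psd_DA {R A a0 I W} cq p n k.
Arguments psd_DB {R A a0 I W} cq p n k.
Arguments tr_DA {R A a0 I W} cq p n k.
Arguments tr_DB {R A a0 I W} cq p n k.
Arguments DAE {R A a0 I W} cq p n k n' l a a'.
Arguments DBE {R A a0 I W} cq p n k n' l s t.
Arguments trR_DA {R A a0 I W} cq p n k.
Arguments trR_DB {R A a0 I W} cq p n k.

(** * Rates of periodic subadditive families *)

Section PeriodicFekete.
Variables (R : realType) (S : int -> nat -> R) (L : R) (t : nat).
Hypotheses (t0 : (0 < t)%N) (S0 : forall n k, 0 <= S n k).
Hypothesis SL : forall n k, S n k <= k%:R * L.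
Hypothesis Ssub : forall n k l, S n (k + l)%N <= S n k + S (n + k%:Z) l.
Hypothesis Sper : forall n k, S (n + t%:Z) k = S n k.

Let L0 : 0 <= L.
Proof. by have := le_trans (S0 0 1) (SL 0 1); rewrite mul1r. Qed.

Lemma periodic_nat n k (z : nat) : S (n + z%:Z * t%:Z) k = S n k.
Proof.
elim: z => [|z IH]; first by rewrite mul0r addr0.
by rewrite -addn1 PoszD mulrDl mul1r addrA Sper IH.
Qed.

Lemma periodic_int n k (z : int) : S (n + z * t%:Z) k = S n k.
Proof.
case: z => z; first exact: periodic_nat.
by rewrite -(periodic_nat (n + Negz z * t%:Z) k z.+1) NegzE -addrA -mulrDl addNr mul0r addr0.
Qed.

Lemma phase n n' : exists d : nat, (d < t)%N /\ forall k, S (n + d%:Z) k = S n' k.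
Proof.
have tn : (t%:Z != 0 :> int) by rewrite eqz_nat -lt0n.
pose d := ((n' - n) %% t%:Z)%Z.
have d0 : 0 <= d by exact: modz_ge0.
have dt : d < t%:Z by apply: ltz_pmod; rewrite ltz_nat.
exists `|d|%N; split.
  by rewrite -ltz_nat gez0_abs.
move=> k; rewrite gez0_abs // -(periodic_int n' k (- ((n' - n) %/ t%:Z)%Z)).
congr (S _ k); have := divz_eq (n' - n) t%:Z; rewrite -/d; lia.
Qed.

Lemma block_le q k : (0 < q)%N -> S 1 k <= k%:R * (S 1 (q * t) / (q * t)%:R) + (q * t)%:R * L.
Proof.
move=> q0; have qt0 : (0 < q * t)%N by rewrite muln_gt0 q0.
set x := S 1 (q * t) / (q * t)%:R.
have x0 : 0 <= x by rewrite divr_ge0.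
have B Q : S 1 (Q * (q * t)) <= (Q * (q * t))%:R * x.
  elim: Q => [|Q IH]; first by rewrite mul0n mul0r; have := SL 1 0; rewrite mul0r.
  rewrite mulSnr; apply: le_trans (Ssub _ _ _) _.
  rewrite [X in _ <= X%:R * _]addnC natrD mulrDl addrC lerD //.
  have -> : (Q * (q * t))%:Z = (Q * q)%:Z * t%:Z :> int by rewrite mulnA PoszM.
  by rewrite periodic_int /x mulrCA divff ?mulr1 // pnatr_eq0 -lt0n.
rewrite {1}(divn_eq k (q * t)); apply: le_trans (Ssub _ _ _) _; apply: lerD.
  apply: le_trans (B _) _; rewrite ler_wpM2r // ler_nat; exact: leq_divM.
apply: le_trans (SL _ _) _; rewrite ler_wpM2r // ler_nat ltnW // ltn_pmod //.
Qed.

(** Fewer than t sites are spent to reach the phase of site 1; from there whole blocks of length q t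
    all have the same value. *)
Lemma rate_upper n q k : (0 < q)%N ->
  S n k <= k%:R * (S 1 (q * t) / (q * t)%:R) + (t + q * t)%:R * L.
Proof.
move=> q0; have [d [dt Hd]] := phase n 1.
have x0 : 0 <= S 1 (q * t) / (q * t)%:R by rewrite divr_ge0.
have [kd|dk] := ltnP k d.
  apply: le_trans (SL _ _) _; rewrite -[leLHS]add0r lerD ?mulr_ge0 //.
  by rewrite ler_wpM2r // ler_nat; lia.
rewrite -{1}(subnKC dk); apply: le_trans (Ssub _ _ _) _; rewrite Hd.
have h1 := SL n d; have h2 := block_le (k - d) q0.
have h3 : d%:R * L <= t%:R * L by rewrite ler_wpM2r // ler_nat ltnW.
have h4 : (k - d)%:R * (S 1 (q * t) / (q * t)%:R) <= k%:R * (S 1 (q * t) / (q * t)%:R).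
  by rewrite ler_wpM2r // ler_nat leq_subr.
by rewrite natrD mulrDl; lra.
Qed.

(** The infimum runs over multiples of the period, starting at site 1: there the family is an
    ordinary subadditive sequence, as shifts by multiples of t change nothing. *)
Definition frate : R := inf [set S 1 (q * t) / (q * t)%:R | q in [set q | (0 < q)%N]].

Lemma frate_le q : (0 < q)%N -> frate <= S 1 (q * t) / (q * t)%:R.
Proof.
move=> q0; apply: ge_inf; last by exists q.
by exists 0 => _ [r _ <-]; rewrite divr_ge0.
Qed.

Lemma frate_ge0 : 0 <= frate.
Proof.
apply: lb_le_inf; first by exists (S 1 (1 * t) / (1 * t)%:R), 1%N.
by move=> _ [r _ <-]; rewrite divr_ge0.
Qed.

(** The window is extended to the left as far as the phase of site 1 and to the right up to a
    multiple of t. Each extension has at most t sites, which gives the two terms t L. *)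
Lemma rate_lower n k : k%:R * frate - (t%:R * L) *+ 2 <= S n k.
Proof.
have [d [dt Hd]] := phase 1 n.
have h1 := Ssub 1 d k; rewrite Hd in h1.
have h2 := SL 1 d.
have h3 : d%:R * L <= t%:R * L by rewrite ler_wpM2r // ler_nat ltnW.
pose Q := ((d + k) %/ t).+1.
have hQ : (d + k < Q * t)%N by rewrite /Q mulSn; have := divn_eq (d + k) t; have := ltn_pmod (d + k) t0; lia.
have hQ' : (Q * t <= d + k + t)%N by rewrite /Q mulSn; have := leq_divM (d + k) t; lia.
have h4 := Ssub 1 (d + k) (Q * t - (d + k)); rewrite subnKC ?(ltnW hQ) // in h4.
have h5 := SL (1 + (d + k)%N%:Z) (Q * t - (d + k)).
have h6 : (Q * t - (d + k))%:R * L <= t%:R * L by rewrite ler_wpM2r // ler_nat; lia.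
have h7 : (Q * t)%:R * frate <= S 1 (Q * t).
  have := frate_le (isT : (0 < Q)%N); rewrite ler_pdivlMr ?ltr0n ?muln_gt0 //=.
  by rewrite mulrC.
have h8 : k%:R * frate <= (Q * t)%:R * frate.
  by rewrite ler_wpM2r ?frate_ge0 // ler_nat; lia.
by rewrite mulr2n; lra.
Qed.

Lemma rate_cvg n : (S n k / k%:R) @[k --> \oo] --> frate.
Proof.
apply/cvgrPdist_le => e e0.
have hi : has_inf [set S 1 (q * t) / (q * t)%:R | q in [set q | (0 < q)%N]].
  split; first by exists (S 1 (1 * t) / (1 * t)%:R), 1%N.
  by exists 0 => _ [r _ <-]; rewrite divr_ge0.
have [_ [q /= q0 <-] hq] := inf_adherent (divr_gt0 e0 (ltr0n R 2)) hi.
have lim1 := nbhs_infty_ger ((t + q * t)%:R * L / (e / 2)).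
have lim2 := nbhs_infty_ger ((t%:R * L) *+ 2 / e).
near=> k.
have k1 : (t + q * t)%:R * L / (e / 2) <= k%:R by near: k.
have k2 : (t%:R * L) *+ 2 / e <= k%:R by near: k.
have k0 : (0 < k)%N by near: k; exact: nbhs_infty_gt.
have kp : 0 < k%:R :> R by rewrite ltr0n.
rewrite ler_pdivrMr ?divr_gt0 // in k1; rewrite ler_pdivrMr // in k2.
have u := rate_upper n k q0; have l := rate_lower n k.
have hq' : k%:R * (S 1 (q * t) / (q * t)%:R) <= k%:R * (frate + e / 2) by rewrite ler_wpM2l // ltW.
rewrite ler_norml; apply/andP; split.
  rewrite lerBrDl -lerBrDr opprK ler_pdivrMr //.
  by move: u hq' k1; rewrite !mulrDr; lra.
rewrite lerBlDl -lerBlDr ler_pdivlMr //; move: l k2; lra.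
Unshelve. all: by end_near.
Qed.

End PeriodicFekete.

(** * Shifted input laws and existence of the information rate *)

Section Shift.
Variables (R : realType) (A : finType) (a0 : A).
Local Notation toC := (real_complex R).
Local Notation SA := (SA a0).

Definition shn (z : int) (x : SA) : SA := fun i => x (i + z).

Lemma measurable_shn z : measurable_fun [set: SA] (shn z).
Proof.
apply: (@measurability _ _ SA SA setT (shn z) (cylinders a0 : set (set SA))); first by [].

move=> _ [_ [n [k [a ->]]] <-]; rewrite setTI.
have -> : shn z @^-1` [set x | window x n k = a] = [set x | window x (n + z) k = a].
  apply/seteqP; split => x /=; rewrite /shn => <-; apply/ffunP => i; rewrite !ffunE;
  congr (x _); ring.
by apply: sub_sigma_algebra; exists (n + z), k, a.
Qed.

HB.instance Definition _ z := isMeasurableFun.Build _ _ _ _ (shn z) (measurable_shn z).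

Lemma window_shn z (x : SA) n k : window (shn z x) n k = window x (n + z) k.
Proof. by apply/ffunP => i; rewrite !ffunE /shn; congr (x _); ring. Qed.

Implicit Types p q : probability SA R.

Lemma cint_eq p q g : bmC g -> (forall E, measurable E -> p E = q E) -> cint p g = cint q g.
Proof.
move=> _ h; rewrite /cint /Rintegral.
congr (Complex (fine _) (fine _)); apply: eq_measure_integral => E mE _; exact: h.
Qed.

Lemma cint_push p (phi : {mfun SA >-> SA}) g : bmC g -> bmC (g \o phi) ->
  cint (distribution p phi) g = cint p (g \o phi).
Proof.
move=> [g1 g2] [h1 h2]; rewrite /cint /Rintegral; congr (Complex (fine _) (fine _)).
  by rewrite integral_pushforward //; [apply/measurable_EFinP; case: g1|exact: bmeas_int].
by rewrite integral_pushforward //; [apply/measurable_EFinP; case: g2|exact: bmeas_int].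
Qed.

Lemma bmeas_shift_ge0 (g : SA -> R) : bmeas g -> exists M : R, bmeas (fun x : SA => g x + M) /\ forall x, 0 <= g x + M.
Proof.
move=> h; have [_ [M hM]] := h; exists M; split; first by apply: bmeasD => //; exact: bmeas_cst.
by move=> x; have := hM x; rewrite ler_norml => /andP[? _]; lra.
Qed.

(** Integrals of nonnegative functions are additive in the measure; a bounded function becomes
    nonnegative after adding a constant, which both sides integrate to the same value. *)
Lemma Rint_mix (t : nat) (q : probability SA R) (P : nat -> probability SA R) (g : SA -> R) :
  (0 < t)%N -> (forall E, measurable E -> q E = ((t%:R^-1)%:E * \sum_(j < t) P j E)%E) ->
  bmeas g ->
  Rintegral q [set: SA] g = t%:R^-1 * \sum_(j < t) Rintegral (P j) [set: SA] g.
Proof.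
move=> t0 hq hg.
have tinv : 0 <= (t%:R : R)^-1 by rewrite invr_ge0.
suff H (h : SA -> R) : bmeas h -> (forall x, 0 <= h x) ->
    Rintegral q [set: SA] h = t%:R^-1 * \sum_(j < t) Rintegral (P j) [set: SA] h.
  have [M [hM M0]] := bmeas_shift_ge0 hg.
  have := H _ hM M0.
  have E (r : probability SA R) : Rintegral r [set: SA] (fun x => g x + M) = Rintegral r [set: SA] g + M.
    rewrite RintegralD //; [|exact: bmeas_int|by apply: bmeas_int; exact: bmeas_cst].
    rewrite Rintegral_cst // (_ : fine (r [set: SA]) = 1) ?mulr1 //.
    by rewrite (@probability_setT _ _ _ r).
  rewrite E; under eq_bigr do rewrite E.
  rewrite big_split /= sumr_const card_ord mulrDr -[M *+ t]mulr_natl mulrA mulVf ?mul1r; last first.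
    by rewrite pnatr_eq0 -lt0n.
  by move/addIr.
move=> hh h0; have mh : measurable_fun [set: SA] (EFin \o h).
  by apply/measurable_EFinP; case: hh.
pose k : {nonneg R} := NngNum tinv.
have -> : Rintegral q [set: SA] h = fine (\int[mscale k (msum P t)]_x (h x)%:E)%E.
  rewrite /Rintegral; congr fine; apply: eq_measure_integral => E mE _.
  exact: (hq E mE).
rewrite ge0_integral_mscale //; last by move=> x _; rewrite lee_fin.
rewrite ge0_integral_measure_sum //; last by move=> x _; rewrite lee_fin.
have F j : (\int[P j]_x (h x)%:E)%E = (Rintegral (P j) [set: SA] h)%:E.
  by rewrite /Rintegral fineK //; apply: integrable_fin_num => //; exact: bmeas_int.
by under eq_bigr do rewrite F; rewrite sumEFin.
Qed.

Lemma cint_mix (t : nat) (q : probability SA R) (P : nat -> probability SA R) g :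
  (0 < t)%N -> (forall E, measurable E -> q E = ((t%:R^-1)%:E * \sum_(j < t) P j E)%E) ->
  bmC g -> cint q g = toC (t%:R^-1) * \sum_(j < t) cint (P j) g.
Proof.
move=> t0 hq [g1 g2]; apply: conjC_eqP.
  by rewrite Re_toCl cRe_sum /= (Rint_mix t0 hq).
by rewrite Im_toCl cIm_sum /= (Rint_mix t0 hq).
Qed.

Definition inv_under p (z : int) := forall E : set SA, measurable E -> p (shn z @^-1` E) = p E.

Section ChannelRates.
Variables (I : finType) (W : chan R A I).
Arguments W : clear implicits.
Hypothesis cq : cq_channel a0 W.
Hypothesis stW : stationary_channel W.

Lemma W_shn (t : nat) (x : SA) n k b : W (shn t%:Z x) n k b = W x (n + t%:Z) k b.
Proof.
elim: t n x => [|t IH] n x.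
  by rewrite addr0; congr (W _ n k b); apply/funext => i; rewrite /shn addr0.
have -> : shn t.+1 x = shiftx (shn t%:Z x).
  by apply/funext => i; rewrite /shn /shiftx; congr (x _); lia.
rewrite stW IH; congr (W x _ k b); lia.
Qed.

Lemma wstate_shn p (t : nat) n N n' k b :
  wstate W (distribution p (shn t%:Z)) n N n' k b = wstate W p (n + t%:Z) N (n' + t%:Z) k b.
Proof.
rewrite /wstate cint_push.
- by congr cint; apply/funext => x; rewrite /= W_shn window_shn.
- exact: (bmC_Ww cq n' n (fun w s t => b (w, s) (w, t))).
have := bmC_Ww cq (n' + t%:Z) (n + t%:Z) (fun w s t => b (w, s) (w, t)).
by congr bmC; apply/funext => x; rewrite /= W_shn window_shn.
Qed.

Lemma DJ_shn p (t : nat) n N n' k :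
  DJ W (distribution p (shn t%:Z)) n N n' k = DJ W p (n + t%:Z) N (n' + t%:Z) k.
Proof. by apply: opP => u v; rewrite /DJ /dens wstate_shn. Qed.

Lemma DA_shn p (t : nat) n N : DA (distribution p (shn t%:Z)) n N = DA p (n + t%:Z) N.
Proof.
by rewrite -(ptr1_DJ cq _ n N n 0) DJ_shn (ptr1_DJ cq).
Qed.

Lemma DB_shn p (t : nat) n N : DB W (distribution p (shn t%:Z)) n N = DB W p (n + t%:Z) N.
Proof.
by rewrite -(ptr2_DJ cq _ n 0 n N) DJ_shn (ptr2_DJ cq).
Qed.

Lemma DJ_eq p q n N n' k : (forall E, measurable E -> p E = q E) -> DJ W p n N n' k = DJ W q n N n' k.
Proof.
move=> h; apply: opP => u v; apply: cint_eq h.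
exact: (bmC_Ww cq n' n (fun w s t => munit R v u (w, s) (w, t))).
Qed.

Lemma DA_eq p q n N : (forall E, measurable E -> p E = q E) -> DA p n N = DA q n N.
Proof. by move=> h; rewrite -!(ptr1_DJ cq _ n N n 0) (DJ_eq n N n 0 h). Qed.
Lemma DB_eq p q n N : (forall E, measurable E -> p E = q E) -> DB W p n N = DB W q n N.
Proof. by move=> h; rewrite -!(ptr2_DJ cq _ n 0 n N) (DJ_eq n 0 n N h). Qed.

Section Periodic.
Variables (p : probability SA R) (t : nat).
Hypotheses (t0 : (0 < t)%N) (hp : inv_under p t%:Z).

Lemma SJ_per n k : SJ W p (n + t%:Z) k = SJ W p n k.
Proof. by rewrite /SJ -DJ_shn (DJ_eq _ _ _ _ (q := p)). Qed.
Lemma SI_per n k : SI p (n + t%:Z) k = SI p n k.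
Proof. by rewrite /SI -DA_shn (DA_eq _ _ (q := p)). Qed.
Lemma SO_per n k : SO W p (n + t%:Z) k = SO W p n k.
Proof. by rewrite /SO -DB_shn (DB_eq _ _ (q := p)). Qed.

Definition IW n k : R := SI p n k + SO W p n k - SJ W p n k.

Lemma IW_ge0 n k : 0 <= IW n k.
Proof. by rewrite subr_ge0; exact: SJ_le_marg. Qed.

(** [rate_cvg] makes each [limn] in [info] a genuine limit. The starting site is arbitrary because
    averaging over shifts compares windows at all phases. *)
Lemma IW_cvg n : (IW n k / k%:R) @[k --> \oo] --> info p W * ln 2.
Proof.
have cA := rate_cvg t0 (SI_ge0 cq p) (SI_le cq p) (SI_subadd cq p) SI_per.
have cB := rate_cvg t0 (SO_ge0 cq p) (SO_le cq p) (SO_subadd cq p) SO_per.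
have cJ := rate_cvg t0 (SJ_ge0 cq p) (SJ_le cq p) (SJ_subadd cq p) SJ_per.
have l2 := @ln2_gt0 R.
have E (S : int -> nat -> R) (J : nat -> finType) (D : forall k, op R (J k)) (r : R) :
    (forall k, S 1 k = ent (D k)) -> S 1 k / k%:R @[k --> \oo] --> r ->
    entropy_rate (fun k => vN_entropy (D k)) = r / ln 2.
  move=> hS hc; apply/cvg_lim => //.
  have -> : (fun k => vN_entropy (D k) / k%:R) = (fun k => S 1 k / k%:R * (ln 2)^-1).
    by apply/funext => k; rewrite hS /ent [RHS]mulrAC mulfK ?gt_eqF.
  by apply: cvgM => //; exact: cvg_cst.
rewrite /info (E (SI p) _ (fun k => dens_in (psiPW p W) k) _ _ (cA 1)); last first.
  by move=> k; rewrite (dens_inE cq).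
rewrite (E (SO W p) _ (fun k => dens_out (psiPW p W) k) _ _ (cB 1)) //.
rewrite (E (SJ W p) _ (fun k => dens_joint (psiPW p W) k) _ _ (cJ 1)); last first.
  by move=> k; rewrite (dens_jointE cq).
rewrite -mulrDl -mulrBl divfK ?gt_eqF //.
have -> : (fun k => IW n k / k%:R) = (fun k => SI p n k / k%:R + SO W p n k / k%:R - SJ W p n k / k%:R).
  by apply/funext => k; rewrite /IW mulrBl mulrDl.
by apply: cvgB => //; apply: cvgD.
Qed.

Lemma info_le : info p W * ln 2 <= ln #|A|%:R + ln #|I|%:R.
Proof.
apply: (cvgr_to_le (IW_cvg 1)); near=> k.
have k0 : (0 < k)%N by near: k; exact: nbhs_infty_gt.
rewrite ler_pdivrMr ?ltr0n //.
have := SI_le cq p 1 k; have := SO_le cq p 1 k; have := SJ_ge0 cq p 1 k.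
by rewrite /IW mulrDl; lra.
Unshelve. all: by end_near.
Qed.

Lemma SI_cvg n : exists h : R, SI p n k / k%:R @[k --> \oo] --> h.
Proof.
by eexists; exact: rate_cvg t0 (SI_ge0 cq p) (SI_le cq p) (SI_subadd cq p) SI_per n.
Qed.

End Periodic.
End ChannelRates.
End Shift.
Arguments IW {R A a0 I} W p n k.

(** * Events of finite windows as a generating pi-system *)

Section FiniteWindowSets.
Variables (R : realType) (A : finType) (a0 : A).
Local Notation C := R[i].
Local Notation SA := (SA a0).
Implicit Types p q : probability SA R.

Definition prb p (E : set SA) : R := fine (p E).

Lemma prbE p E : measurable E -> p E = (prb p E)%:E.
Proof. by move=> mE; rewrite /prb fineK // fin_num_measure. Qed.

Lemma prb_ge0 p E : 0 <= prb p E.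
Proof. by rewrite /prb fine_ge0. Qed.

Lemma prb_le1 p E : measurable E -> prb p E <= 1.
Proof. by move=> mE; rewrite -lee_fin -prbE // probability_le1. Qed.

Lemma prbT p : prb p setT = 1.
Proof. by rewrite /prb (@probability_setT _ _ _ p). Qed.

Lemma prbU p E F : measurable E -> measurable F -> E `&` F = set0 ->
  prb p (E `|` F) = prb p E + prb p F.
Proof.
move=> mE mF d; apply/EFin_inj; rewrite EFinD -!prbE //; last exact: measurableU.
by rewrite measureU.
Qed.

Definition winset n k (P : pred (cfg A k)) : set SA := [set x | P (window x n k)].

Lemma measurable_winset n k P : measurable (@winset n k P).
Proof. exact: measurable_cyl. Qed.

Lemma cint_sum p (T : Type) (l : seq T) (c : T -> C) (F : T -> SA -> C) :
  (forall i, bmC (F i)) ->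
  cint p (fun x => \sum_(i <- l) c i * F i x) = \sum_(i <- l) c i * cint p (F i).
Proof.
move=> h; elim: l => [|i l IH].
  rewrite big_nil -[RHS](cint_cst p); congr cint; apply/funext => x; by rewrite big_nil.
rewrite big_cons -IH -cint_lin //.
  by congr cint; apply/funext => x; rewrite big_cons.
by apply: bmC_sum => j; apply: bmCM => //; exact: bmC_cst.
Qed.

Lemma prb_winset p n k (P : pred (cfg A k)) :
  prb p (winset n P) = \sum_(w | P w) prb p (winset n (pred1 w)).
Proof.
apply: (@toC_inj R); rewrite -cint_ind.
have -> : (fun x : SA => ((P (window x n k))%:R : C)) =
  (fun x => \sum_w (P w)%:R * (@window A x n k == w)%:R).
  apply/funext => x; rewrite (bigD1 (@window A x n k)) //= eqxx mulr1 big1 ?addr0 //.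
  by move=> w /negbTE nw; rewrite eq_sym nw mulr0.
rewrite cint_sum; last by move=> w; exact: (bmC_ind R a0 n (fun v : cfg A k => v == w)).
rewrite rmorph_sum [RHS]big_mkcond /=; apply: eq_bigr => w _.
rewrite (cint_ind p n (fun v : cfg A k => v == w)); case: (P w); rewrite ?mul1r ?mul0r //.
Qed.

Lemma winset_widen n k (P : pred (cfg A k)) m l : m <= n -> n + k%:Z <= m + l%:Z ->
  exists Q : pred (cfg A l), winset n P = winset m Q.
Proof.
move=> mn nk; have jl (i : 'I_k) : (`|(n - m)%R| + i < l)%N by have := ltn_ord i; lia.
exists (fun w => P (pull (fun i => Ordinal (jl i)) w)).
apply/funext => x; rewrite /winset /mkset.
have -> : pull (fun i => Ordinal (jl i)) (@window A x m l) = window x n k.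
  have e : m + `|(n - m)%R|%N%:Z = n by lia.
  by rewrite (@window_pull A x m l `|(n - m)%R|%N) // e.
by [].
Qed.

Definition winsets : set (set SA) := [set E | exists n k (P : pred (cfg A k)), E = winset n P].

(** The window [1 - K t, K t] is a union of whole blocks [k t + 1, (k + 1) t]. All large K are
    allowed, so two events can share one window. *)
Lemma winsets_aligned (t : nat) E : (0 < t)%N -> winsets E -> exists K0, forall K, (K0 <= K)%N ->
  exists Q : pred (cfg A (K * t + K * t)), E = winset (1 - (K * t)%:Z) Q.
Proof.
move=> t0 [n [k [P ->]]]; exists (`|n| + k).+1 => K hK.
have KK : (K <= K * t)%N by rewrite leq_pmulr.
apply: winset_widen; lia.
Qed.

Lemma winsets_measurable : winsets `<=` measurable.
Proof. by move=> _ [n [k [P ->]]]; exact: measurable_winset. Qed.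

Lemma winsets_gen : @measurable _ SA = <<s winsets >>.
Proof.
apply/seteqP; split.
  apply: smallest_sub; first exact: smallest_sigma_algebra.
  move=> _ [n [k [a ->]]]; apply: sub_sigma_algebra; exists n, k, (pred1 a).
  by apply/seteqP; split => x /= /eqP.
apply: smallest_sub; last exact: winsets_measurable.
exact: sigma_algebra_measurable.
Qed.

Lemma winsets_setI : setI_closed winsets.
Proof.
(* Alignment with period 1 serves only to put both events on a common window. *)
move=> E F hE hF; have [K1 h1] := winsets_aligned (ltnSn 0) hE.
have [K2 h2] := winsets_aligned (ltnSn 0) hF.
have [Q1 ->] := h1 _ (leq_maxl K1 K2); have [Q2 ->] := h2 _ (leq_maxr K1 K2).
eexists _, _, (fun w => Q1 w && Q2 w); apply/seteqP; split => x; rewrite /winset /setI /mkset.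
  by case=> h3 h4; apply/andP; split; [exact: h3|exact: h4].
by move=> h; have /andP[h3 h4] := (h : is_true (_ && _)); split.
Qed.

Lemma winsetsT : winsets setT.
Proof. by exists 0, 0%N, predT; apply/seteqP; split. Qed.

Lemma prb_unique p q : (forall E, winsets E -> prb p E = prb q E) ->
  forall E, measurable E -> p E = q E.
Proof.
move=> h E mE; apply: (@measure_unique _ R SA winsets (fun=> setT) winsets_gen winsets_setI) => //.
- by move=> _; exact: winsetsT.
- by apply/seteqP; split => // x _; exists 0%N.
- move=> F hF; have mF := winsets_measurable hF.
  exact: etrans (prbE p mF) (etrans (congr1 EFin (h F hF)) (esym (prbE q mF))).
- by move=> _; apply: le_lt_trans (probability_le1 p measurableT) _; rewrite ltry.
Qed.

Lemma shn_winset z n k (P : pred (cfg A k)) : shn z @^-1` winset n P = winset (n + z) P.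
Proof.
apply/funext => x; rewrite /winset /preimage /mkset.
have e : @window A (shn z x) n k = @window A x (n + z) k := window_shn z x n k.
by rewrite e.
Qed.

Lemma measurable_shn_pre z (E : set SA) : measurable E -> measurable (shn z @^-1` E).
Proof. by move=> mE; rewrite -[_ @^-1` _]setTI; exact: measurable_shn. Qed.

End FiniteWindowSets.

(** * Block independence of periodic product measures *)

Section PeriodicProduct.
Variables (R : realType) (A : finType) (a0 : A).
Local Notation SA := (SA a0).
Variables (p : probability SA R) (t : nat) (pi : cfg A t -> R).
Hypothesis t0 : (0 < t)%N.
Hypothesis Hpp : forall (m : int) (N : nat) (a : nat -> A),
  p [set x : SA | forall j : nat, (j < N * t)%N -> x (m * t%:Z + 1 + j%:Z) = a j]
      = (\prod_(k < N) pi [ffun j : 'I_t => a (k * t + j)%N])%:E.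

(** Periodic products are specified through functions on [nat]; words are padded with [a0] to
    match. *)
Definition wext L (w : cfg A L) (j : nat) : A := if insub j is Some i then w i else a0.
Definition bw N (a : nat -> A) : R := \prod_(k < N) pi [ffun j : 'I_t => a (k * t + j)%N].

Lemma wextE L (w : cfg A L) (i : 'I_L) : wext w i = w i.
Proof. by rewrite /wext valK. Qed.

Lemma pp_window m N L (w : cfg A L) : L = (N * t)%N ->
  prb p (winset (m * t%:Z + 1) (pred1 w)) = bw N (wext w).
Proof.
move=> hL; rewrite /prb /bw.
rewrite -[RHS]/(fine (\prod_(k < N) pi [ffun j : 'I_t => wext w (k * t + j)%N])%:E) -(Hpp m) -hL.
congr (fine (p _)); apply/seteqP; split => x /=.
  by move=> /eqP h j jL; rewrite -[j]/(val (Ordinal jL)) wextE -h ffunE.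
by move=> h; apply/eqP/ffunP => i; rewrite ffunE h // wextE.
Qed.

Lemma bw_fcat N M L1 L2 (w1 : cfg A L1) (w2 : cfg A L2) : L1 = (N * t)%N -> L2 = (M * t)%N ->
  bw (N + M) (wext (fcat w1 w2)) = bw N (wext w1) * bw M (wext w2).
Proof.
move=> h1 h2; rewrite /bw big_split_ord /=; congr (_ * _); apply: eq_bigr => k _;
  congr pi; apply/ffunP => j; rewrite !ffunE.
  have kL : (k * t + j < L1)%N.
    by rewrite h1; have := ltn_ord k; have := ltn_ord j; nia.
  rewrite -[(k * t + j)%N]/(val (Ordinal kL)) wextE.
  by rewrite -[val (Ordinal kL)]/(val (lshift L2 (Ordinal kL))) wextE -[RHS](congr1 (fun f : cfg A L1 => f (Ordinal kL)) (cleft_fcat w1 w2)) !ffunE.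
have kL : (k * t + j < L2)%N.
  by rewrite h2; have := ltn_ord k; have := ltn_ord j; nia.
have -> : ((N + k) * t + j = val (rshift L1 (Ordinal kL)))%N by rewrite /= h1; lia.
rewrite -[(k * t + j)%N]/(val (Ordinal kL)) !wextE.
by rewrite -[RHS](congr1 (fun f : cfg A L2 => f (Ordinal kL)) (cright_fcat w1 w2)) !ffunE.
Qed.

Lemma pp_indep1 m N M L1 L2 (w1 : cfg A L1) (w2 : cfg A L2) : L1 = (N * t)%N -> L2 = (M * t)%N ->
  prb p (winset (m * t%:Z + 1) (pred1 (fcat w1 w2))) =
  prb p (winset (m * t%:Z + 1) (pred1 w1)) * prb p (winset (m * t%:Z + 1 + L1%:Z) (pred1 w2)).
Proof.
move=> h1 h2; subst L1 L2; rewrite (@pp_window m (N + M)) ?mulnDl //.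
have -> : m * t%:Z + 1 + (N * t)%N%:Z = (m + N%:Z) * t%:Z + 1 by lia.
rewrite (@pp_window m N) // (@pp_window (m + N%:Z) M) // bw_fcat //.
Qed.

Lemma pp_indep m N M L1 L2 (P : pred (cfg A L1)) (Q : pred (cfg A L2)) :
  L1 = (N * t)%N -> L2 = (M * t)%N ->
  prb p (winset (m * t%:Z + 1) P `&` winset (m * t%:Z + 1 + L1%:Z) Q) =
  prb p (winset (m * t%:Z + 1) P) * prb p (winset (m * t%:Z + 1 + L1%:Z) Q).
Proof.
move=> h1 h2; set n := m * t%:Z + 1.
have -> : (winset n P : set SA) `&` winset (n + L1%:Z) Q =
   winset n (fun w : cfg A (L1 + L2) => P (cleft w) && Q (cright w)).
  apply/seteqP; split => x; have e1 := window_left (x : int -> A) n L1 L2;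
    have e2 := window_right (x : int -> A) n L1 L2.
    case=> h3 h4; apply/andP; split; [exact: etrans (congr1 P e1) h3|].
    exact: etrans (congr1 Q e2) h4.
  move=> h; have /andP[h3 h4] := (h : is_true (_ && _)); split.
    exact: etrans (congr1 P (esym e1)) h3.
  exact: etrans (congr1 Q (esym e2)) h4.
rewrite !prb_winset big_mkcond cfg_sum /= mulr_suml [RHS]big_mkcond /=; apply: eq_bigr => w1 _.
case: ifP => [Pw|nPw]; last first.
  by apply: big1 => w2 _; rewrite cleft_fcat nPw.
rewrite mulr_sumr [RHS]big_mkcond /=; apply: eq_bigr => w2 _; rewrite cleft_fcat cright_fcat Pw /=.
by case: ifP => // _; rewrite (@pp_indep1 m N M).
Qed.

(** On aligned windows the probability of a word does not mention the block index m, and such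
    windows carry a generating pi-system. *)
Lemma pp_inv : inv_under p t%:Z.
Proof.
have H : forall E, measurable E -> distribution p (shn t%:Z : {mfun SA >-> SA}) E = p E.
  apply: prb_unique => E hE.
  have [K0 /(_ K0 (leqnn _)) [Q ->]] := winsets_aligned t0 hE.
  transitivity (prb p (winset (1 - (K0 * t)%N%:Z + t%:Z) Q)); first by rewrite -(@shn_winset A a0 t%:Z).
  rewrite !prb_winset.
  apply: eq_bigr => w _.
  have -> : 1 - (K0 * t)%:Z = (- K0%:Z) * t%:Z + 1 by lia.
  have -> : - K0%:Z * t%:Z + 1 + t%:Z = (- K0%:Z + 1) * t%:Z + 1 by lia.
  by rewrite !(@pp_window _ (K0 + K0)) // mulnDl.
exact: H.
Qed.

Lemma DAE_prb n k (w w' : cfg A k) :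
  DA p n k w w' = real_complex R (prb p (winset n (pred1 w))) *+ (w == w').
Proof.
rewrite /DA /prb; congr (real_complex R (fine (p _)) *+ _).
by apply/seteqP; split => x /= /eqP.
Qed.

Variables (I : finType) (W : chan R A I).
Hypothesis cq : cq_channel a0 W.
Hypothesis stW : stationary_channel W.

Lemma pp_DA m N M : ren (fun q => fcat q.1 q.2) (DA p (m * t%:Z + 1) (N * t + M * t)) =
  tens (DA p (m * t%:Z + 1) (N * t)) (DA p (m * t%:Z + 1 + (N * t)%N%:Z) (M * t)).
Proof.
apply: opP => -[w1 w2] [v1 v2]; rewrite /ren /tens /= !DAE_prb fcat_eq (@pp_indep1 m N M) //.
case: (w1 == v1); case: (w2 == v2); rewrite ?mulr0n ?mulr0 ?mul0r //.
by rewrite !mulr1n rmorphM.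
Qed.

(** Independence turns subadditivity of the input entropy into equality, by the entropy formula for
    tensor products. *)
Lemma pp_SI q : SI p 1 (q * t) = q%:R * SI p 1 t.
Proof.
have B : SI p 1 (0 * t) = 0.
  by apply/le_anti; rewrite (SI_ge0 cq) andbT; apply: le_trans (SI_le cq p 1 0) _; rewrite mul0r.
elim: q => [|q IH]; first by rewrite B mul0r.
have := pp_DA 0 1 q; rewrite mul0r add0r mul1n => E.
have := ent_tens (psd_DA cq p 1 t) (psd_DA cq p (1 + t%:Z) (q * t)) (tr_DA cq p 1 t) (tr_DA cq p _ _).
rewrite -E (ren_ent (@fcat_bij A t (q * t))); last exact: (psd_DA cq p 1 (t + q * t)).
rewrite -/(SI p _ _) -/(SI p 1 t) -/(SI p (1 + t%:Z) (q * t)) => e.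
by rewrite mulSn [LHS]e (SI_per cq stW pp_inv) IH -natr1 mulrDl mul1r addrC.
Qed.

End PeriodicProduct.

(** * Independent digits of a uniform random number *)

Section Digits.
Variables (R : realType) (B : finType) (b0 : B) (pi : B -> R).
Hypotheses (pi0 : forall b, 0 <= pi b) (pi1 : \sum_b pi b = 1).

Definition cum (n : nat) : R := \sum_(b | (enum_rank b < n)%N) pi b.

Lemma cum_mono m n : (m <= n)%N -> cum m <= cum n.
Proof.
move=> mn; rewrite /cum big_mkcond [leRHS]big_mkcond; apply: ler_sum => b _.
case: ifP => h; first by rewrite (leq_trans h mn).
by case: ifP.
Qed.

Lemma cumS b : cum (enum_rank b).+1 = cum (enum_rank b) + pi b.
Proof.
rewrite /cum (bigD1 b) //= addrC; congr (_ + _); apply: eq_bigl => c.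
rewrite ltnS ltn_neqAle andbC; congr (_ && _); congr (~~ _).
by rewrite (inj_eq val_inj) (inj_eq enum_rank_inj).
Qed.

Lemma cum_all : cum #|B| = 1.
Proof. by rewrite -pi1 /cum; apply: eq_bigl => b; rewrite ltn_ord. Qed.

Lemma cum0 : cum 0 = 0.
Proof. by rewrite /cum big_pred0. Qed.

Lemma cum_find (y : R) : 0 <= y < 1 -> exists b, cum (enum_rank b) <= y < cum (enum_rank b) + pi b.
Proof.
move=> /andP[y0 y1].
have ex : exists n, y < cum n by exists #|B|; rewrite cum_all.
case: (ex_minnP ex) => -[|n]; first by rewrite cum0 ltNge y0.
move=> hn hmin.
have nB : (n < #|B|)%N by apply: hmin; rewrite cum_all.
exists (enum_val (Ordinal nB)); rewrite -cumS enum_valK /= hn andbT leNgt.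
by apply/negP => /hmin; rewrite ltnn.
Qed.

Definition cell (l s : R) b (x : R) := l + s * cum (enum_rank b) <= x < l + s * cum (enum_rank b) + s * pi b.

Lemma cell_ex l s x : l <= x < l + s -> exists b, cell l s b x.
Proof.
move=> /andP[h1 h2]; have s0 : 0 < s by lra.
have [|b /andP[b1 b2]] := @cum_find ((x - l) / s).
  by rewrite ler_pdivlMr // ltr_pdivrMr //; lra.
exists b; rewrite ler_pdivlMr // in b1; rewrite ltr_pdivrMr // in b2.
by apply/andP; split; [lra|move: b2; rewrite mulrDl; lra].
Qed.

Lemma cell_uniq l s b c x : 0 <= s -> cell l s b x -> cell l s c x -> b = c.
Proof.
move=> s0.
have H (u v : B) : (enum_rank u < enum_rank v)%N -> cell l s u x -> cell l s v x -> False.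
  move=> uv /andP[_ h1] /andP[h2 _].
  have := cum_mono uv; rewrite cumS => h3.
  have : s * (cum (enum_rank u) + pi u) <= s * cum (enum_rank v) by rewrite ler_wpM2l.
  by rewrite mulrDr; lra.
move=> hb hc; case: (ltngtP (enum_rank b) (enum_rank c)) => h.
- by case: (H _ _ h hb hc).
- by case: (H _ _ h hc hb).
- by apply: enum_rank_inj; apply: val_inj.
Qed.

Lemma cell_sub l s b x : 0 <= s -> cell l s b x -> l <= x < l + s.
Proof.
move=> s0 /andP[h1 h2].
have c0 : 0 <= cum (enum_rank b) by rewrite -cum0 cum_mono.
have c1 : cum (enum_rank b) + pi b <= 1 by rewrite -cumS -cum_all cum_mono.
have h3 : 0 <= s * cum (enum_rank b) by rewrite mulr_ge0.
have : s * (cum (enum_rank b) + pi b) <= s * 1 by rewrite ler_wpM2l.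
by rewrite mulrDr mulr1; move=> h4; apply/andP; split; lra.
Qed.

(** Arithmetic coding: the left end and the length of the interval of points whose expansion starts
    with n letters of w. Each letter takes a share of the current interval proportional to its
    probability. *)
Fixpoint lolen (w : nat -> B) (n : nat) : R * R :=
  if n is m.+1 then
    let: (l, s) := lolen w m in (l + s * cum (enum_rank (w m)), s * pi (w m))
  else (0, 1).

Lemma lolen_ge0 w n : 0 <= (lolen w n).2.
Proof. by elim: n => [|n] //=; case: (lolen w n) => l s /= h; rewrite mulr_ge0. Qed.

Lemma lolen_prod w n : (lolen w n).2 = \prod_(k < n) pi (w k).
Proof.
elim: n => [|n] /=; first by rewrite big_ord0.
by rewrite big_ord_recr /= => <-; case: (lolen w n).
Qed.

Lemma lolen_eq w v n : (forall k, (k < n)%N -> w k = v k) -> lolen w n = lolen v n.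
Proof.
elim: n => [|n IH] //= h; rewrite IH ?h // => k kn; apply: h; exact: ltnW.
Qed.

Definition pickd (l s x : R) : B := odflt b0 [pick b | cell l s b x].

(** The decoder keeps the interval found so far and reads the next letter from the cell containing
    x; the default [b0] of [pickd] is never reached for x in [0, 1). *)
Fixpoint digst (x : R) (n : nat) : R * R :=
  if n is m.+1 then
    let: (l, s) := digst x m in (l + s * cum (enum_rank (pickd l s x)), s * pi (pickd l s x))
  else (0, 1).
Definition dig x n : B := pickd (digst x n).1 (digst x n).2 x.

Lemma digstE x n : digst x n = lolen (dig x) n.
Proof. by elim: n => [|n IH] //=; rewrite -IH /dig; case: (digst x n). Qed.

Definition inI w n (x : R) := (lolen w n).1 <= x < (lolen w n).1 + (lolen w n).2.

Lemma inI_S w n x : inI w n.+1 x = cell (lolen w n).1 (lolen w n).2 (w n) x.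
Proof. by rewrite /inI /=; case: (lolen w n). Qed.

Lemma dig_inI x n : 0 <= x < 1 -> inI (dig x) n x.
Proof.
move=> x01; elim: n => [|n IH]; first by rewrite /inI /= add0r.
rewrite inI_S -digstE /dig /pickd.
case: pickP => [b //|] h; have [b hb] := cell_ex IH.
by have := h b; rewrite digstE hb.
Qed.

Lemma dig_prefix x w n : 0 <= x < 1 -> (forall k, (k < n)%N -> dig x k = w k) <-> inI w n x.
Proof.
move=> x01; elim: n => [|n IH]; first by split => // _; rewrite /inI /= add0r.
split=> [h|].
  have e : lolen w n.+1 = lolen (dig x) n.+1 by apply: lolen_eq => k kn; rewrite h.
  by rewrite /inI e; exact: dig_inI.
move=> h; have h1 : inI w n x by move: h; rewrite inI_S => /(cell_sub (lolen_ge0 w n)).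
have h2 := proj2 IH h1.
have e : lolen (dig x) n = lolen w n by exact: lolen_eq.
move=> k; rewrite ltnS leq_eqVlt => /predU1P[->|]; last exact: h2.
have := dig_inI n.+1 x01; rewrite inI_S e => h3; rewrite inI_S in h.
exact: cell_uniq (lolen_ge0 w n) h3 h.
Qed.

Definition unitI : set R := `[0, 1[%classic.

Lemma measurable_unitI : measurable unitI. Proof. exact: measurable_itv. Qed.

Lemma unitIP x : unitI x <-> 0 <= x < 1.
Proof. by rewrite /unitI /= in_itv. Qed.

Definition pword L (v : {ffun 'I_L -> B}) (k : nat) : B := if insub k is Some i then v i else b0.

Definition dset L (v : {ffun 'I_L -> B}) : set R := [set x | unitI x /\ forall k : 'I_L, dig x k = v k].

Lemma dsetE L (v : {ffun 'I_L -> B}) :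
  dset v = `[(lolen (pword v) L).1, (lolen (pword v) L).1 + (lolen (pword v) L).2[%classic.
Proof.
have vE (i : 'I_L) : pword v i = v i by rewrite /pword valK.
have sub n w x : inI w n x -> 0 <= x < 1.
  elim: n => [|n IH]; first by rewrite /inI /= add0r.
  by rewrite inI_S => /(cell_sub (lolen_ge0 w n)).
apply/seteqP; split => x /=; rewrite in_itv /= => h.
  case: h => /unitIP x01 h; apply/(dig_prefix _ L x01) => k kL.
  by rewrite -[k]/(val (Ordinal kL)) vE -h.
have x01 := sub L _ x h; split; first exact/unitIP.
by move=> k; rewrite -vE; exact: (proj2 (dig_prefix (pword v) L x01) h).
Qed.

Lemma measurable_dset L (v : {ffun 'I_L -> B}) : measurable (dset v).
Proof. by rewrite dsetE; exact: measurable_itv. Qed.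

(** Lengths multiply, so under Lebesgue measure on [0, 1) the digits are independent with law
    [pi]. *)
Lemma leb_dset L (v : {ffun 'I_L -> B}) :
  lebesgue_measure (dset v) = (\prod_(k < L) pi (v k))%:E.
Proof.
rewrite dsetE lebesgue_measure_itv /= lte_fin ltrDl lt_neqAle lolen_ge0 andbT.
have -> : \prod_(k < L) pi (v k) = (lolen (pword v) L).2.
  by rewrite lolen_prod; apply: eq_bigr => k _; rewrite /pword valK.
case: eqP => [<-//|_] /=.
by rewrite -EFinB addrAC subrr add0r.
Qed.

Definition dsets L (P : pred {ffun 'I_L -> B}) : set R :=
  [set x | unitI x /\ P [ffun k : 'I_L => dig x k]].

Lemma dsetsE L (P : pred {ffun 'I_L -> B}) : dsets P = \bigcup_(v in [set` P]) dset v.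
Proof.
apply/seteqP; split => x /=.
  by case=> ux Px; exists [ffun k : 'I_L => dig x k] => //; split => // k; rewrite ffunE.
case=> v /= Pv [ux h]; split => //.
by have -> : [ffun k : 'I_L => dig x k] = v by apply/ffunP => k; rewrite ffunE h.
Qed.

Lemma measurable_dsets L (P : pred {ffun 'I_L -> B}) : measurable (dsets P).
Proof.
rewrite dsetsE; apply: fin_bigcup_measurable; first exact: finite_finset.
by move=> v _; exact: measurable_dset.
Qed.

Lemma leb_dsets L (P : pred {ffun 'I_L -> B}) :
  lebesgue_measure (dsets P) = (\sum_(v | P v) \prod_(k < L) pi (v k))%:E.
Proof.
rewrite dsetsE measure_fin_bigcup; last 3 first.
- exact: finite_finset.
- move=> v w _ _ [x [[_ hv] [_ hw]]]; apply/ffunP => k; by rewrite -hv -hw.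
- by move=> v _; exact: measurable_dset.
rewrite (@fsbigE _ _ _ _ _ (enum P)) ?enum_uniq //; last 2 first.
- by move=> v /=; rewrite mem_enum.
- by move=> v Pv; rewrite mem_enum; have -> : v \in P by exact: Pv.
rewrite -sumEFin -[RHS]big_enum /= big_mkcond /=.
apply: eq_big_seq => v; rewrite mem_enum => Pv; rewrite mem_setE Pv.
exact: leb_dset.
Qed.

End Digits.

(** * Construction of periodic product measures *)

Section BlockMeasure.
Variables (R : realType) (A : finType) (a0 : A).
Local Notation SA := (SA a0).
Variables (t : nat) (pi : cfg A t -> R).
Hypotheses (t0 : (0 < t)%N) (pi0 : forall b, 0 <= pi b) (pi1 : \sum_b pi b = 1).
Let B : finType := cfg A t.
Let b0 : B := [ffun=> a0].

(** Blocks are indexed by integers and digits by naturals, so block m reads digit [pickle m]. The i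
    - 1 reflects that blocks start at sites k t + 1. *)
Definition bseqx (w : nat -> B) : SA := fun i : int =>
  if insub `|((i - 1) %% t%:Z)%Z|%N is Some j then w (pickle ((i - 1) %/ t%:Z)%Z) (j : 'I_t) else a0.

Definition blockmap (x : R) : SA :=
  bseqx (if 0 <= x < 1 then dig b0 pi x else fun=> b0).

Lemma bseqx_block w (m : int) k (j : 'I_t) :
  bseqx w (m * t%:Z + 1 + (k * t + j)%N%:Z) = w (pickle (m + k%:Z)) j.
Proof.
rewrite /bseqx.
have e : m * t%:Z + 1 + (k * t + j)%N%:Z - 1 = (m + k%:Z) * t%:Z + j%:Z by lia.
have tz : (t%:Z != 0 :> int) by rewrite eqz_nat -lt0n.
have jt : (0 <= j%:Z < t%:Z)%R by rewrite ltz_nat ltn_ord andbT.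
rewrite e divzMDl // modzMDl divz_small ?gtr0_norm ?ltz_nat // modz_small //.
by rewrite absz_nat valK addr0.
Qed.

Lemma bseqx_local n k : exists L, forall w v : nat -> B, (forall i, (i < L)%N -> w i = v i) ->
  window (bseqx w) n k = window (bseqx v) n k.
Proof.
exists (\max_(i < k) (pickle ((n + i%:Z - 1) %/ t%:Z)%Z).+1) => w v h.
apply/ffunP => i; rewrite !ffunE /bseqx; case: insub => // j; rewrite h //.
exact: (leq_bigmax_cond i).
Qed.

Lemma measurable_blockmap : measurable_fun [set: measurableTypeR R] (blockmap : measurableTypeR R -> SA).
Proof.
apply: (@measurability _ _ (measurableTypeR R) SA setT blockmap (cylinders a0 : set (set SA))); first by [].
move=> _ [_ [n [k [a ->]]] <-]; rewrite setTI.
have [L hL] := bseqx_local n k.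
pose P : pred {ffun 'I_L -> B} := fun v => window (bseqx (pword b0 v)) n k == a.
have -> : blockmap @^-1` [set x | window x n k = a] =
   dsets b0 pi P `|` (if window (bseqx (fun=> b0)) n k == a then ~` @unitI R else set0).
  apply/seteqP; split => x /=; rewrite /blockmap.
    case: ifP => x01 hx.
      left; split; first exact/unitIP.
      apply/eqP; rewrite -hx; apply: hL => i iL.
      by rewrite /pword insubT ffunE.
    right; case: ifP => [_|/eqP//]; by rewrite /setC /= => /unitIP; rewrite x01.
  case=> [[/unitIP x01 /eqP hx]|].
    rewrite x01 -hx; apply: hL => i iL; by rewrite /pword insubT ffunE.
  case: ifP => // /eqP hx nx; case: ifP => // x01; by case: nx; exact/unitIP.
apply: measurableU; first exact: measurable_dsets.
by case: ifP => _ //; apply: measurableC; exact: measurable_unitI.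
Qed.

HB.instance Definition _ := isMeasurableFun.Build _ _ _ _ (blockmap : measurableTypeR R -> SA) measurable_blockmap.

Let mI : measurable (@unitI R : set (measurableTypeR R)) := @measurable_unitI R.

Definition dirac0 : probability (measurableTypeR R) R := \d_(0 : measurableTypeR R).
(** Lebesgue measure on [0, 1) packaged as a probability; [dirac0] is the default of the
    normalisation for total mass 0 or infinity, excluded in [unitprobE]. *)
Definition unitprob : probability (measurableTypeR R) R :=
  mnormalize (mrestr (@lebesgue_measure R) mI) dirac0.

Lemma unitprobE (E : set (measurableTypeR R)) : unitprob E = lebesgue_measure (E `&` @unitI R).
Proof.
have e1 : mrestr (@lebesgue_measure R) mI setT = 1%E.
  transitivity (lebesgue_measure (@unitI R)).
    by rewrite -[LHS]/(lebesgue_measure (setT `&` @unitI R)) setTI.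
  by rewrite lebesgue_measure_itv /= lte_fin ltr01 -EFinB subr0.
rewrite /unitprob /= /mnormalize; case: ifPn => [/orP[]/eqP h|_].
- by have := etrans (esym h) e1 => /eqP; rewrite eq_sym onee_eq0.
- by have := etrans (esym h) e1.
apply: etrans (congr1 (fun z => (lebesgue_measure (E `&` @unitI R) * ((fine z)^-1)%:E)%E) e1) _.
by rewrite /= invr1 mule1.
Qed.

Definition block_measure : probability SA R :=
  distribution unitprob (blockmap : {mfun measurableTypeR R >-> SA}).

Lemma block_measureE (m : int) (N : nat) (a : nat -> A) :
  block_measure [set x : SA | forall j : nat, (j < N * t)%N -> x (m * t%:Z + 1 + j%:Z) = a j]
  = (\prod_(k < N) pi [ffun j : 'I_t => a (k * t + j)%N])%:E.
Proof.
set E := (X in block_measure X).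
(* The N consecutive blocks sit at the scattered digits [code k]. The other digits below L are
   unconstrained and each contributes a factor 1 to the product of sums. *)
pose code k : nat := pickle (m + k%:Z).
have codeI k l : code k = code l -> k = l.
  by move/(pcan_inj (@pickleK int)) => h; lia.
pose bl k : B := [ffun j : 'I_t => a (k * t + j)%N].
pose L := (\max_(k < N) (code k).+1)%N.
have codeL (k : 'I_N) : (code k < L)%N by rewrite /L; exact: (leq_bigmax_cond k).
pose Q (i : 'I_L) (b : B) := [forall k : 'I_N, (val i == code k) ==> (b == bl k)].
pose P : pred {ffun 'I_L -> B} := fun v => [forall i, Q i (v i)].
have EB w : (bseqx w \in E) = [forall k : 'I_N, w (code k) == bl k].
  apply/idP/forallP => [|h].
    rewrite inE /= => h k; apply/eqP/ffunP => j; rewrite ffunE -h ?bseqx_block //.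
    by have := ltn_ord k; have := ltn_ord j; nia.
  rewrite inE /= => j jN.
  have jt : (j %/ t < N)%N by rewrite ltn_divLR.
  have jm : (j %% t < t)%N by rewrite ltn_mod.
  have ej : j = (j %/ t * t + Ordinal jm)%N by rewrite /= -divn_eq.
  rewrite {1}ej bseqx_block; have /eqP -> := h (Ordinal jt).
  by rewrite ffunE /= -divn_eq.
have EP w : (bseqx w \in E) = P [ffun i : 'I_L => w i].
  rewrite EB; apply/forallP/forallP => h.
    move=> i; apply/forallP => k; apply/implyP => /eqP e; rewrite ffunE e; exact: h.
  by move=> k; have /forallP /(_ k) := h (Ordinal (codeL k)); rewrite ffunE /= eqxx.
have mE : measurable E.
  have -> : E = winset (m * t%:Z + 1) (fun v : cfg A (N * t) => [forall i, v i == a i]).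
    apply/seteqP; split => x h.
      by apply/forallP => i; rewrite ffunE h.
    move=> j jN; have /forallP /(_ (Ordinal jN)) := (h : is_true _); by rewrite ffunE => /eqP.
  exact: measurable_winset.
have -> : block_measure E = lebesgue_measure (dsets b0 pi P).
  transitivity (unitprob (blockmap @^-1` E)); first by [].
  rewrite unitprobE; congr (lebesgue_measure _); apply/seteqP; split => x.
    case=> hx ux; split => //; rewrite -EP; move: hx; rewrite /preimage /= /blockmap.
    by have /unitIP -> := ux; move=> hx; rewrite inE.
  case=> ux; rewrite -EP inE => hx; split => //.
  by rewrite /preimage /= /blockmap; have /unitIP -> := ux.
rewrite leb_dsets //; congr EFin.
transitivity (\sum_(f in family Q) \prod_i pi (f i)).
  apply: eq_bigl => v; apply/forallP/familyP => h i; exact: h.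
rewrite -(bigA_distr_big_dep Q (fun i b => pi b)).
have cL : injective (fun k : 'I_N => Ordinal (codeL k)).
  by move=> k l /(congr1 val) /= /codeI h; exact: val_inj.
have S1 (k : 'I_N) : \sum_(b | Q (Ordinal (codeL k)) b) pi b = pi (bl k).
  rewrite (bigD1 (bl k)) /=; last first.
    by apply/forallP => l; apply/implyP => /eqP /= /codeI ->.
  rewrite big1 ?addr0 // => b /andP[/forallP /(_ k)]; rewrite /= eqxx /= => /eqP ->.
  by rewrite eqxx.
rewrite (bigID (fun i => i \in [set Ordinal (codeL k) | k in 'I_N]%SET)) /=.
rewrite [X in _ * X]big1 ?mulr1; last first.
  move=> i ni; rewrite -pi1; apply: eq_bigl => b; apply/forallP => k.
  apply/implyP => /eqP e; case/negP: ni; apply/imsetP; exists k => //; exact: val_inj.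
rewrite big_imset /=; last by move=> k l _ _; exact: cL.
by apply: eq_bigr => k _; exact: S1.
Qed.

End BlockMeasure.

Lemma periodic_product_exists (R : realType) (A : finType) (a0 : A) t (pi : cfg A t -> R) :
  (0 < t)%N -> (forall b, 0 <= pi b) -> \sum_b pi b = 1 ->
  exists p : probability (SA a0) R, forall (m : int) (N : nat) (a : nat -> A),
    p [set x : SA a0 | forall j : nat, (j < N * t)%N -> x (m * t%:Z + 1 + j%:Z) = a j]
    = (\prod_(k < N) pi [ffun j : 'I_t => a (k * t + j)%N])%:E.
Proof.
by move=> t0 pi0 pi1; exists (block_measure a0 pi0 pi1) => m N a; exact: block_measureE.
Qed.

(** * Mixing and the zero-one law for periodic products *)

Section Ergodicity.
Variables (R : realType) (A : finType) (a0 : A).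
Local Notation SA := (SA a0).
Implicit Types p q : probability SA R.

Lemma shn_inv (E : set SA) : @shiftx A @^-1` E = E -> forall N : nat, shn N%:Z @^-1` E = E.
Proof.
move=> invE; elim=> [|N IH].
  by apply/funext => x; rewrite /preimage /mkset; congr E; apply/funext => i; rewrite /shn addr0.
rewrite -[RHS]invE -{2}IH; apply/funext => x; rewrite /preimage /mkset; congr E.
by apply/funext => i; rewrite /shn /shiftx; congr (x _); lia.
Qed.

(** For a measure dominated by p, the error of cutting a disjoint union at n is bounded by the tail
    under p alone. This uniformity lets the limit over shifts pass through countable unions in
    [mix_bigcup]. *)
Lemma measure_tail p (m : {measure set SA -> \bar R}) (F : nat -> set SA) n :
  (forall X, measurable X -> (m X <= p X)%E) ->
  (forall i, measurable (F i)) -> trivIset setT F ->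
  `|fine (m (\bigcup_i F i)) - \sum_(i < n) fine (m (F i))| <=
    prb p (\bigcup_i F i) - \sum_(i < n) prb p (F i).
Proof.
move=> dom mF tF; set D := \bigcup_i F i.
have mD : measurable D by exact: bigcup_measurable.
pose U := \big[setU/set0]_(i < n) F i.
have mU : measurable U by exact: bigsetU_measurable.
have UD : U `<=` D.
  rewrite /U -(bigcup_mkord n F) => x [i _ Fx]; by exists i.
have mDU : measurable (D `\` U) by exact: measurableD.
have K (q : {measure set SA -> \bar R}) : (forall X, measurable X -> (q X <= p X)%E) ->
    fine (q D) - \sum_(i < n) fine (q (F i)) = fine (q (D `\` U)).
  move=> dq; have fq X : measurable X -> q X \is a fin_num.
    move=> mX; rewrite ge0_fin_numE //; apply: le_lt_trans (dq X mX) _.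
    by apply: le_lt_trans (probability_le1 p mX) _; rewrite ltry.
  have -> : fine (q D) = fine (q U) + fine (q (D `\` U)).
    rewrite -fineD ?fq // -measureU //; last by rewrite setDE setICA setICr setI0.
    by rewrite setDUK.
  have -> : fine (q U) = \sum_(i < n) fine (q (F i)).
    by rewrite /U measure_bigsetU // sum_fine // => i _; exact: fq.
  by rewrite addrAC subrr add0r.
rewrite (K m dom) /prb (K p) // ger0_norm ?fine_ge0 //.
rewrite -lee_fin !fineK; first exact: dom.
  by rewrite fin_num_measure.
rewrite ge0_fin_numE //; apply: le_lt_trans (dom _ mDU) _.
by apply: le_lt_trans (probability_le1 p mDU) _; rewrite ltry.
Qed.

Lemma prb_bigcup_cvg p (F : nat -> set SA) : (forall i, measurable (F i)) -> trivIset setT F ->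
  (\sum_(i < n) prb p (F i)) @[n --> \oo] --> prb p (\bigcup_i F i).
Proof.
move=> mF tF; have mD : measurable (\bigcup_i F i) by exact: bigcup_measurable.
suff : (EFin \o (fun n => \sum_(i < n) prb p (F i))) n @[n --> \oo] --> (prb p (\bigcup_i F i))%:E.
  by move/fine_cvgP => [_]; exact.
rewrite -(prbE p mD).
have -> : EFin \o (fun n => \sum_(i < n) prb p (F i)) = (fun n => \sum_(0 <= i < n) p (F i))%E.
  by apply/funext => n /=; rewrite big_mkord -sumEFin; apply: eq_bigr => i _; rewrite prbE.
exact: (@measure_semi_sigma_additive _ _ _ p F mF tF mD).
Qed.

Section Mixing.
Variables (p : probability SA R) (t : nat) (pi : cfg A t -> R).
Hypothesis t0 : (0 < t)%N.
Hypothesis Hpp : forall (m : int) (N : nat) (a : nat -> A),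
  p [set x : SA | forall j : nat, (j < N * t)%N -> x (m * t%:Z + 1 + j%:Z) = a j]
      = (\prod_(k < N) pi [ffun j : 'I_t => a (k * t + j)%N])%:E.

Lemma shnD (y z : int) (E : set SA) : shn y @^-1` (shn z @^-1` E) = shn (y + z) @^-1` E.
Proof.
apply/funext => x; rewrite /preimage /mkset; congr E; apply/funext => i.
by rewrite /shn; congr (x _); ring.
Qed.

Lemma inv_mul (N : nat) E : measurable E -> p (shn (N * t)%N%:Z @^-1` E) = p E.
Proof.
move=> mE; elim: N => [|N IH].
  by congr (p _); apply/funext => x; rewrite /preimage /mkset; congr E; apply/funext => i; rewrite /shn addr0.
have -> : shn (N.+1 * t)%N%:Z @^-1` E = shn t%:Z @^-1` (shn (N * t)%N%:Z @^-1` E).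
  by rewrite shnD; congr (shn _ @^-1` _); lia.
by rewrite (pp_inv t0 Hpp) //; exact: measurable_shn_pre.
Qed.

(** The shift by 2 K t carries the window [1 - K t, K t] to the window right after it, so that two
    aligned events become independent. *)
Definition mixK (E : set SA) K (D : set SA) : R := prb p ((shn ((K + K) * t)%N%:Z @^-1` D) `&` E).

Lemma mix_winsets E D : winsets E -> winsets D ->
  mixK E K D @[K --> \oo] --> prb p E * prb p D.
Proof.
move=> hE hD; have [K1 h1] := winsets_aligned t0 hE; have [K2 h2] := winsets_aligned t0 hD.
apply: cvg_near_cst; near=> K.
have hK1 : (K1 <= K)%N by near: K; exact: nbhs_infty_ge.
have hK2 : (K2 <= K)%N by near: K; exact: nbhs_infty_ge.
have [P EP] := h1 K hK1; have [Q DQ] := h2 K hK2.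
rewrite /mixK setIC.
have eD : prb p D = prb p (shn ((K + K) * t)%N%:Z @^-1` D).
  by rewrite /prb inv_mul //; exact: winsets_measurable.
rewrite eD DQ EP (@shn_winset A a0).
have -> : 1 - (K * t)%N%:Z + ((K + K) * t)%N%:Z = (- K%:Z) * t%:Z + 1 + (K * t + K * t)%N%:Z by lia.
have -> : 1 - (K * t)%N%:Z = (- K%:Z) * t%:Z + 1 by lia.
by rewrite (pp_indep t0 Hpp (- K%:Z) (N:=(K + K)%N) (M:=(K + K)%N)) // mulnDl.
Unshelve. all: by end_near.
Qed.

Lemma cvg_sum_ord (n : nat) (f : nat -> nat -> R) (l : nat -> R) :
  (forall i, f i K @[K --> \oo] --> l i) ->
  (\sum_(i < n) f i K) @[K --> \oo] --> \sum_(i < n) l i.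
Proof.
move=> h; elim: n => [|n IH].
  have -> : (fun K => \sum_(i < 0) f i K) = (fun=> 0) by apply/funext => K; rewrite big_ord0.
  by rewrite big_ord0; exact: cvg_cst.
have -> : (fun K => \sum_(i < n.+1) f i K) = (fun K => \sum_(i < n) f i K + f n K).
  by apply/funext => K; rewrite big_ord_recr.
by rewrite big_ord_recr /=; apply: cvgD.
Qed.

Lemma mix_bigcup E (F : nat -> set SA) : measurable E -> (forall i, measurable (F i)) ->
  trivIset setT F ->
  (forall i, mixK E K (F i) @[K --> \oo] --> prb p E * prb p (F i)) ->
  mixK E K (\bigcup_i F i) @[K --> \oo] --> prb p E * prb p (\bigcup_i F i).
Proof.
move=> mE mF tF h; apply/cvgrPdist_le => e e0.
have e3 : 0 < e / 3 by rewrite divr_gt0.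
have cS := @prb_bigcup_cvg p F mF tF.
have [n _ hn] := (cvgrPdist_le _ _).1 cS _ e3.
have {hn} := hn n (leqnn n) => /= hn.
have hs := @cvg_sum_ord n _ _ h.
have hs' := (cvgrPdist_le _ _).1 hs _ e3.
near=> K.
have s1 : `|\sum_(i < n) prb p E * prb p (F i) - \sum_(i < n) mixK E K (F i)| <= e / 3.
  by near: K; exact: hs'.
have dm X : measurable X -> (pushforward (mrestr p mE) (shn ((K + K) * t)%N%:Z) X <= p X)%E.
  move=> mX; rewrite /pushforward /mrestr -(inv_mul (K + K) mX).
  apply: le_measure; rewrite ?inE; [|exact: measurable_shn_pre|exact: subIsetl].
  by apply: measurableI => //; exact: measurable_shn_pre.
have s2 := @measure_tail p (pushforward (mrestr p mE) (shn ((K + K) * t)%N%:Z)) F n dm mF tF.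
have {}s2 : `|mixK E K (\bigcup_i F i) - \sum_(i < n) mixK E K (F i)| <=
   prb p (\bigcup_i F i) - \sum_(i < n) prb p (F i) := s2 (measurable_shn _).
have pE0 := prb_ge0 p E; have pE1 := prb_le1 p mE.
rewrite -mulr_sumr in s1.
move: hn s1 s2; set S := \sum_(i < n) prb p (F i); set T := \sum_(i < n) mixK E K (F i).
set d := prb p (\bigcup_i F i); set x := mixK E K _; set c := prb p E => hn s1 s2.
have d0 : 0 <= d - S by apply: le_trans s2; exact: normr_ge0.
rewrite ger0_norm // in hn.
have c1 : c * (d - S) <= d - S by rewrite ler_piMl.
have c0 : 0 <= c * (d - S) by rewrite mulr_ge0.
have -> : c * d - x = c * (d - S) + (c * S - T) - (x - T) by ring.
apply: le_trans (ler_normB _ _) _; apply: le_trans (lerD (ler_normD _ _) (lexx _)) _.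
rewrite (ger0_norm c0).
have : c * (d - S) + `|c * S - T| + `|x - T| <= e / 3 + e / 3 + e / 3.
  by apply: lerD; [apply: lerD => //; exact: le_trans c1 hn|exact: le_trans s2 hn].
by move/le_trans; apply; lra.
Unshelve. all: by end_near.
Qed.

(** Dynkin induction in D for a fixed window event E. On window events the sequence is eventually
    constant; complements and disjoint unions preserve the limit. *)
Lemma mix_measurable E D : winsets E -> measurable D ->
  mixK E K D @[K --> \oo] --> prb p E * prb p D.
Proof.
move=> hE; rewrite winsets_gen => hD; have mE := winsets_measurable hE.
apply: (@dynkin_induction _ SA (@winsets A a0)
  (fun D => mixK E K D @[K --> \oo] --> prb p E * prb p D)) hD => //.
- exact: winsets_gen.
- exact: winsets_setI.
- exact: mix_winsets hE (@winsetsT A a0).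
- by move=> X hX; exact: mix_winsets.
- move=> X mX hX.
  have eC K : mixK E K (~` X) = prb p E - mixK E K X.
    rewrite /mixK -[in prb p E](setIT E) -(setUv (shn ((K + K) * t)%N%:Z @^-1` X)) setIUr.
    rewrite prbU.
    - by rewrite [E `&` _]setIC addrAC subrr add0r [E `&` _]setIC.
    - by apply: measurableI => //; exact: measurable_shn_pre.
    - by apply: measurableI => //; apply: measurableC; exact: measurable_shn_pre.
    - by rewrite setIACA setICr setI0.
  have eD : prb p (~` X) = 1 - prb p X.
    rewrite -(prbT p) -(setUv X) prbU //; [by rewrite addrAC subrr add0r|exact: measurableC|].
    exact: setICr.
  rewrite eD mulrBr mulr1.
  have -> : (fun K => mixK E K (~` X)) = (fun K => prb p E - mixK E K X) by apply/funext.
  by apply: cvgB => //; exact: cvg_cst.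
- by move=> F mF tF hF; exact: mix_bigcup.
Qed.

(** An invariant E makes the mixing sequence constant, so E is independent of all window events. By
    uniqueness of measures it is independent of all events, itself included, whence p E = (p
    E)^2. *)
Lemma pp_zero_one (E : set SA) : measurable E -> @shiftx A @^-1` E = E -> p E = 0%E \/ p E = 1%E.
Proof.
move=> mE invE.
have invN := shn_inv invE.
have ind C0 : winsets C0 -> prb p (E `&` C0) = prb p C0 * prb p E.
  move=> hC; have := mix_measurable hC mE.
  have -> : (fun K => mixK C0 K E) = (fun=> prb p (E `&` C0)).
    by apply/funext => K; rewrite /mixK invN.
  by move/cvg_lim => <- //; rewrite lim_cst.
have mul D : measurable D -> p (D `&` E) = ((prb p E)%:E * p D)%E.
  move=> mD.
  pose k : {nonneg R} := NngNum (prb_ge0 p E).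
  have := @measure_unique _ R SA (@winsets A a0) (fun=> setT) (@winsets_gen A a0) (@winsets_setI A a0)
    (fun=> @winsetsT A a0) _ (mrestr p mE) (mscale k p) _ _ D mD; apply.
  - by apply/seteqP; split => // x _; exists 0%N.
  - move=> F hF; have mF := winsets_measurable hF.
    have mFE : measurable (F `&` E) by exact: measurableI.
    rewrite /mrestr /mscale /=; apply: etrans (prbE p mFE) _.
    rewrite setIC ind // mulrC EFinM; congr (_ * _)%E; exact/esym/prbE.
  - move=> _; rewrite /mrestr; apply: le_lt_trans (probability_le1 p _) _; last by rewrite ltry.
    by rewrite setTI.
have e := mul E mE; rewrite setIid (prbE p mE) -EFinM in e.
have {}e : prb p E = prb p E * prb p E by case: e.
have : prb p E * (1 - prb p E) == 0 by rewrite mulrBr mulr1 -e subrr.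
rewrite mulf_eq0 (prbE p mE) => /orP[/eqP ->|]; first by left.
by rewrite subr_eq0 => /eqP <-; right.
Qed.

End Mixing.
End Ergodicity.

(** * Averaging a periodic law over its shifts *)

Section ShiftAverage.
Variables (R : realType) (A : finType) (a0 : A).
Local Notation toC := (real_complex R).
Local Notation SA := (SA a0).
Implicit Types p q : probability SA R.

Definition shift_law p (j : nat) : probability SA R :=
  distribution p (shn j%:Z : {mfun SA >-> SA}).

Definition avg_shift p (t : nat) : probability SA R :=
  mnormalize (msum (shift_law p) t) p.

Lemma avg_shiftE p t E : (0 < t)%N -> measurable E ->
  avg_shift p t E = ((t%:R^-1)%:E * \sum_(j < t) shift_law p j E)%E.
Proof.
move=> t0 mE.
have e1 : msum (shift_law p) t setT = (t%:R)%:E.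
  rewrite /msum.
  apply: etrans (eq_bigr (fun=> 1%:E) (fun j _ => @probability_setT _ _ _ (shift_law p (j : 'I_t)))) _.
  by rewrite sumEFin sumr_const card_ord.
rewrite /avg_shift /= /mnormalize; case: ifPn => [/orP[]/eqP h|_].
- have /eqP := etrans (esym e1) h; rewrite eqe pnatr_eq0 => /eqP t00; by rewrite t00 in t0.
- by have := etrans (esym e1) h.
apply: etrans (congr1 (fun z => (msum (shift_law p) t E * ((fine z)^-1)%:E)%E) e1) _.
by rewrite /= muleC.
Qed.

Lemma shift_lawE p j E : shift_law p j E = p (shn j%:Z @^-1` E).
Proof. by []. Qed.

Lemma stationary_inv p : stationary p <-> inv_under p 1.
Proof.
have e (x : SA) : shn 1 x = shiftx x by [].
by split => h E mE; have := h E mE.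
Qed.

(** One more shift permutes the t summands cyclically; periodicity identifies the last with the
    first. *)
Lemma avg_shift_stationary p t : (0 < t)%N -> inv_under p t%:Z -> stationary (avg_shift p t).
Proof.
move=> t0 hp E mE.
have mE' : measurable (shn 1 @^-1` E) by exact: measurable_shn_pre.
rewrite !avg_shiftE //; congr (_ * _)%E.
have e j : shift_law p j (@shiftx A @^-1` E) = shift_law p j.+1 E.
  rewrite !shift_lawE; congr (p _); apply/funext => x; rewrite /preimage /mkset; congr E.
  by apply/funext => i; rewrite /shn /shiftx; congr (x _); lia.
under eq_bigr do rewrite e.
case: t t0 hp => // t _ hp; rewrite big_ord_recr [RHS]big_ord_recl /= addeC; congr (_ + _)%E.
rewrite !shift_lawE hp //; congr (p _); apply/funext => x; rewrite /preimage /mkset; congr E.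
by apply/funext => i; rewrite /shn addr0.
Qed.

(** All shifts of p give an invariant event the same probability, so the zero-one law passes to the
    average. *)
Lemma avg_shift_ergodic p t : (0 < t)%N ->
  (forall E : set SA, measurable E -> @shiftx A @^-1` E = E -> p E = 0%E \/ p E = 1%E) ->
  ergodic (avg_shift p t).
Proof.
move=> t0 hp E mE invE.
have invN := shn_inv invE.
have -> : avg_shift p t E = p E.
  rewrite avg_shiftE //; under eq_bigr do rewrite shift_lawE invN (prbE p mE).
  rewrite sumEFin sumr_const card_ord -EFinM -[prb p E *+ t]mulr_natl mulrA mulVf ?mul1r.
    by rewrite -prbE.
  by rewrite pnatr_eq0 -lt0n.
exact: hp.
Qed.

Section Info.
Variables (I : finType) (W : chan R A I).
Arguments W : clear implicits.
Hypothesis cq : cq_channel a0 W.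
Hypothesis stW : stationary_channel W.
Variables (p : probability SA R) (t : nat).
Hypotheses (t0 : (0 < t)%N) (hp : inv_under p t%:Z).
Let pb := avg_shift p t.
Let w : R := t%:R^-1.

Lemma DJ_avg n N n' k u v :
  DJ W pb n N n' k u v = \sum_(j < t) toC w * DJ W p (n + (j : nat)%:Z) N (n' + (j : nat)%:Z) k u v.
Proof.
rewrite -mulr_sumr /DJ /dens /wstate (cint_mix (P := shift_law p) t0).
- congr (_ * _); apply: eq_bigr => j _.
  exact: (wstate_shn cq stW p j n n' (munit R v u)).
- by move=> E mE; exact: avg_shiftE.
- exact: (bmC_Ww cq n' n (fun w s t => munit R v u (w, s) (w, t))).
Qed.

Lemma DA_avg n N a a' : DA pb n N a a' = \sum_(j < t) toC w * DA p (n + (j : nat)%:Z) N a a'.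
Proof.
rewrite (DAE cq pb n N n 0); under eq_bigr do rewrite DJ_avg.
rewrite exchange_big /=; apply: eq_bigr => j _.
by rewrite (DAE cq p (n + (j : nat)%:Z) N (n + (j : nat)%:Z) 0) mulr_sumr.
Qed.

Lemma DB_avg n k s s' : DB W pb n k s s' = \sum_(j < t) toC w * DB W p (n + (j : nat)%:Z) k s s'.
Proof.
rewrite (DBE cq pb n 0 n k); under eq_bigr do rewrite DJ_avg.
rewrite exchange_big /=; apply: eq_bigr => j _.
by rewrite (DBE cq p (n + (j : nat)%:Z) 0 (n + (j : nat)%:Z) k) mulr_sumr.
Qed.

Let w0 : 0 <= w. Proof. by rewrite invr_ge0. Qed.
Let sw : \sum_(j < t) w = 1.
Proof. by rewrite sumr_const card_ord -[LHS]mulr_natl divff // pnatr_eq0 -lt0n. Qed.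

(** Input and output entropies are concave; the joint entropy of a mixture exceeds the mean by at
    most ln t, the entropy of the uniform choice of a shift. *)
Lemma IW_avg n k : \sum_(j < t) w * IW W p (n + (j : nat)%:Z) k - ln t%:R <= IW W pb n k.
Proof.
have hA : \sum_(j < t) w * SI p (n + (j : nat)%:Z) k <= SI pb n k.
  have := @ent_concave R _ 'I_t (fun=> w) (fun j => DA p (n + (j : nat)%:Z) k) (fun=> w0)
    (fun j => psd_DA cq p _ _) (fun j => trR_DA cq p _ _) sw.
  congr (_ <= ent _); apply: opP => a a'; by rewrite DA_avg.
have hB : \sum_(j < t) w * SO W p (n + (j : nat)%:Z) k <= SO W pb n k.
  have := @ent_concave R _ 'I_t (fun=> w) (fun j => DB W p (n + (j : nat)%:Z) k) (fun=> w0)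
    (fun j => psd_DB cq p _ _) (fun j => trR_DB cq p _ _) sw.
  congr (_ <= ent _); apply: opP => a a'; by rewrite DB_avg.
have hJ : SJ W pb n k <= \sum_(j < t) w * SJ W p (n + (j : nat)%:Z) k + ln t%:R.
  have -> : SJ W pb n k = ent (fun u v => \sum_(j < t)
      toC w * DJ W p (n + (j : nat)%:Z) k (n + (j : nat)%:Z) k u v).
    by congr ent; apply: opP => u v; rewrite DJ_avg.
  have pF (j : 'I_t) : psd (fun u v => toC w * DJ W p (n + (j : nat)%:Z) k (n + (j : nat)%:Z) k u v).
    apply: psdZ => //; exact: psd_DJ.
  apply: le_trans (ent_mix_sum _ pF) _.
  have e (j : 'I_t) : ent (fun u v => toC w * DJ W p (n + (j : nat)%:Z) k (n + (j : nat)%:Z) k u v) =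
      w * SJ W p (n + (j : nat)%:Z) k - w * ln w.
    by rewrite (ent_scale w0 (psd_DJ cq p _ _ _ _)) trR_DJ // mulr1.
  under eq_bigr do rewrite e.
  rewrite sumrB lerD2l sumr_const card_ord -[_ *+ t]mulr_natl /w lnV ?posrE ?ltr0n //.
  by rewrite !mulrN opprK mulrA divff ?mul1r // pnatr_eq0 -lt0n.
rewrite /IW; under eq_bigr do rewrite mulrBr mulrDr.
by rewrite sumrB big_split /=; lra.
Qed.

(** By [IW_cvg] the windows at all t phases have the same rate under p, and ln t / k tends to 0. *)
Lemma info_avg : info p W <= info pb W.
Proof.
have pb1 : inv_under pb 1 by apply/stationary_inv; exact: avg_shift_stationary.
have l2 := @ln2_gt0 R; rewrite -(ler_pM2r l2).
have cb := @IW_cvg R A a0 I W cq stW pb 1 isT pb1 1.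
have cp : (\sum_(j < t) w * (IW W p (1 + (j : nat)%:Z) k / k%:R)) @[k --> \oo] -->
    \sum_(j < t) w * (info p W * ln 2).
  apply: (@cvg_sum_ord R t (fun j k => w * (IW W p (1 + j%:Z) k / k%:R)) (fun=> w * (info p W * ln 2))).
  by move=> j; apply: cvgM; [exact: cvg_cst|exact: (IW_cvg cq stW t0 hp)].
rewrite -mulr_suml sw mul1r in cp.
apply/ler_addgt0Pr => e e0.
have cd : (IW W pb 1 k / k%:R - \sum_(j < t) w * (IW W p (1 + (j : nat)%:Z) k / k%:R))
    @[k --> \oo] --> info pb W * ln 2 - info p W * ln 2 by exact: cvgB cb cp.
suff : - e <= info pb W * ln 2 - info p W * ln 2 by rewrite lerBrDr addrC lerBlDr.
apply: (cvgr_to_ge cd).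
have lt0 : 0 <= ln (t%:R : R) by rewrite ln_ge0 // ler1n.
have lim1 := nbhs_infty_ger (ln t%:R / e).
near=> k.
have k0 : (0 < k)%N by near: k; exact: nbhs_infty_gt.
have kp : 0 < (k%:R : R) by rewrite ltr0n.
have k1 : ln t%:R / e <= k%:R by near: k.
rewrite ler_pdivrMr // in k1.
have h := IW_avg 1 k.
have -> : \sum_(j < t) w * (IW W p (1 + (j : nat)%:Z) k / k%:R) =
   (\sum_(j < t) w * IW W p (1 + (j : nat)%:Z) k) / k%:R.
  by rewrite mulr_suml; apply: eq_bigr => j _; rewrite mulrA.
rewrite -mulrBl ler_pdivlMr //; lra.
Unshelve. all: by end_near.
Qed.

End Info.
End ShiftAverage.

(** * Information of a single block against the rate *)

Section BlockInformation.
Variables (R : realType) (A : finType) (a0 : A) (I : finType) (W : chan R A I).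
Local Notation SA := (SA a0).
Arguments W : clear implicits.
Hypothesis cq : cq_channel a0 W.
Hypothesis stW : stationary_channel W.
Variables (p : probability SA R) (t : nat) (pi : cfg A t -> R).
Hypothesis t0 : (0 < t)%N.
Hypothesis Hpp : forall (m : int) (N : nat) (a : nat -> A),
  p [set x : SA | forall j : nat, (j < N * t)%N -> x (m * t%:Z + 1 + j%:Z) = a j]
      = (\prod_(k < N) pi [ffun j : 'I_t => a (k * t + j)%N])%:E.

Lemma IW_superadd q : q%:R * IW W p 1 t <= IW W p 1 (q * t).
Proof.
have hp := pp_inv t0 Hpp.
have hC : SJ W p 1 (q * t) + q%:R * SO W p 1 t <= SO W p 1 (q * t) + q%:R * SJ W p 1 t.
  elim: q => [|q IH].
    rewrite !mul0r !addr0; apply: le_trans (SJ_le_marg cq p 1 _) _.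
    by rewrite gerDr; apply: le_trans (SI_le cq p 1 _) _; rewrite mul0r.
  have := SJ_cond cq p 1 t (q * t).
  rewrite (SO_per cq stW hp) (SJ_per cq stW hp) mulSn -natr1 !mulrDl !mul1r; lra.
rewrite /IW (pp_SI t0 Hpp cq stW) mulrBr mulrDr; lra.
Qed.

(** Along lengths q t superadditivity keeps the normalised information above that of the first
    block, and the rate is also the limit along these lengths. *)
Lemma info_block_ge : IW W p 1 t / t%:R <= info p W * ln 2.
Proof.
have hp := pp_inv t0 Hpp; have tp : 0 < (t%:R : R) by rewrite ltr0n.
apply/ler_addgt0Pr => e e0.
have [n _ hn] := (cvgrPdist_le _ _).1 (IW_cvg cq stW t0 hp 1) _ e0.
have nt : (n <= n.+1 * t)%N by apply: leq_trans (leqnSn n) (leq_pmulr _ t0).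
have := hn _ nt; rewrite ler_norml => /andP[h _].
have h2 := IW_superadd n.+1.
have np : 0 < ((n.+1 * t)%:R : R) by rewrite ltr0n muln_gt0.
have h3 : IW W p 1 t / t%:R <= IW W p 1 (n.+1 * t) / (n.+1 * t)%:R.
  rewrite ler_pdivlMr // natrM [n.+1%:R * _]mulrC mulrA divfK ?gt_eqF //.
  by rewrite mulrC.
by apply: le_trans h3 _; move: h; rewrite lerBrDr addrC lerBlDr.
Qed.

Lemma pp_marginal a : prb p (winset 1 (pred1 a)) = pi a.
Proof.
have := @pp_window R A a0 p t pi Hpp 0 1 t a; rewrite mul0r add0r mul1n => -> //.
rewrite /bw big_ord1; congr pi; apply/ffunP => j; rewrite ffunE mul0n add0n; exact: wextE.
Qed.

End BlockInformation.

(** * A code viewed as a test of the joint state *)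

Section CodeBound.
Variables (R : realType) (A : finType) (a0 : A) (I : finType) (W : chan R A I).
Local Notation C := R[i].
Local Notation toC := (real_complex R).
Local Notation SA := (SA a0).
Arguments W : clear implicits.
Hypothesis cq : cq_channel a0 W.
Variables (p : probability SA R) (n M : nat) (u : 'I_M -> cfg A n) (b : 'I_M -> bop R I n).
Hypotheses (M0 : (0 < M)%N) (cd : is_code u b).

Definition nword (a : cfg A n) : R := \sum_(j | u j == a) 1.
Hypothesis Hp : forall a, prb p (winset 1 (pred1 a)) = nword a / M%:R.

(** Code words may repeat, and the joint state remembers the word but not its index. Averaging the
    decoder operators over all indices of a word keeps the test below the identity; a word outside
    the code is rejected. *)
Definition decT : op R (cfg A n * cfg I n)%type := fun v w =>
  (\sum_(j | u j == v.1) toC (nword v.1)^-1 * b j v.2 w.2) *+ (v.1 == w.1).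

Lemma nword_ge0 a : 0 <= nword a. Proof. by apply: sumr_ge0. Qed.

Lemma psd_filter (J T : finType) (P : pred T) (F : T -> op R J) :
  (forall i, psd (F i)) -> psd (fun s s' => \sum_(i | P i) F i s s').
Proof.
move=> h.
have -> : (fun s s' => \sum_(i | P i) F i s s') =
   (fun s s' => \sum_(i <- [seq i <- index_enum T | P i]) F i s s').
  by apply: opP => s s'; rewrite big_filter.
exact: psd_sum.
Qed.

Lemma psd_blockdiag (P Q : finType) (F : P -> op R Q) : (forall a, psd (F a)) ->
  psd (fun v w : P * Q => F v.1 v.2 w.2 *+ (v.1 == w.1)).
Proof.
move=> h v; have -> : \sum_s \sum_s' (v s)^* * (F s.1 s.2 s'.2 *+ (s.1 == s'.1)) * v s' =
    \sum_a qf (fun s => v (a, s)) (F a).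
  rewrite pair_sum; apply: eq_bigr => a _; apply: eq_bigr => s _.
  rewrite pair_sum (bigD1 a) //= [X in _ + X]big1 ?addr0; last first.
    by move=> a' /negbTE na; rewrite big1 // => s' _; rewrite eq_sym na mulr0n mulr0 mul0r.
  by apply: eq_bigr => s' _; rewrite eqxx mulr1n.
by apply: sumr_ge0 => a _; exact: h.
Qed.

Lemma code_psd j : psd (b j). Proof. by case: cd => h _; exact: h. Qed.

Lemma code_le1 j : psd (fun s s' => idop R s s' - b j s s').
Proof.
case: cd => h1 h2.
have -> : (fun s s' => idop R s s' - b j s s') =
   (fun s s' => (idop R s s' - \sum_i b i s s') + \sum_(i | i != j) b i s s').
  by apply: opP => s s'; rewrite (bigD1 j) //= opprD addrA subrK.
by apply: psdD => //; exact: psd_filter.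
Qed.

Lemma psd_idop (J : finType) : psd (@idop R J).
Proof.
move=> v; apply: sumr_ge0 => s _; rewrite (bigD1 s) //= big1 ?addr0.
  by rewrite /idop eqxx mulr1 mulrC mulCJ toC_ge0 nsq_ge0.
by move=> t /negbTE nt; rewrite /idop eq_sym nt mulr0 mul0r.
Qed.

Lemma decT_psd : psd decT.
Proof.
apply: (@psd_blockdiag _ _ (fun a s s' => \sum_(j | u j == a) toC (nword a)^-1 * b j s s')) => a.
apply: psd_filter => j; apply: psdZ; last exact: code_psd.
by rewrite invr_ge0 nword_ge0.
Qed.

Lemma decT_le1 : psd (fun v w => idop R v w - decT v w).
Proof.
have -> : (fun v w => idop R v w - decT v w) = (fun v w : cfg A n * cfg I n =>
  (idop R v.2 w.2 - \sum_(j | u j == v.1) toC (nword v.1)^-1 * b j v.2 w.2) *+ (v.1 == w.1)).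
  apply: opP => -[a s] [a' s']; rewrite /decT /idop -pair_eqE /=.
  by case: (a == a'); rewrite ?mulr1n ?mulr0n ?subr0.
apply: (@psd_blockdiag _ _ (fun a s s' => idop R s s' - \sum_(j | u j == a) toC (nword a)^-1 * b j s s')) => a.
have [z|nz] := eqVneq (nword a) 0.
  have -> : (fun s s' => idop R s s' - \sum_(j | u j == a) toC (nword a)^-1 * b j s s') = @idop R _.
    by apply: opP => s s'; rewrite z invr0 big1 ?subr0 // => j _; rewrite mul0r.
  exact: psd_idop.
have -> : (fun s s' => idop R s s' - \sum_(j | u j == a) toC (nword a)^-1 * b j s s') =
   (fun s s' => \sum_(j | u j == a) toC (nword a)^-1 * (idop R s s' - b j s s')).
  apply: opP => s s'; under [RHS]eq_bigr do rewrite mulrBr.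
  rewrite sumrB; congr (_ - _).
  rewrite -mulr_suml -rmorph_sum /=.
  have -> : \sum_(j | u j == a) (nword a)^-1 = 1.
    by rewrite -[RHS](mulfV nz) {2}/nword mulr_suml; apply: eq_bigr => j _; rewrite mul1r.
  by rewrite mul1r.
apply: psd_filter => j; apply: psdZ; last exact: code_le1.
by rewrite invr_ge0 nword_ge0.
Qed.

Lemma bstate_sub1 (om : bfamily R I) k0 k (T : op R (cfg I k)) : is_bstate om ->
  om k0 k (fun s t => idop R s t - T s t) = 1 - om k0 k T.
Proof.
move=> st; rewrite -(bstate1 st k0 k) -[RHS]addrC -mulN1r -(bstate_lin st).
by congr om; apply: opP => s t; rewrite mulN1r addrC.
Qed.

Lemma bstate_Re_le1 (om : bfamily R I) k0 k (T : op R (cfg I k)) : is_bstate om ->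
  psd (fun s t => idop R s t - T s t) -> complex.Re (om k0 k T) <= 1.
Proof.
move=> st h; have := ge0_Re (bstate_pos st k0 k _ h).
by rewrite (bstate_sub1 k0 T st) cReB /= subr_ge0.
Qed.

Lemma tr_opm_DB k0 k (T : op R (cfg I k)) :
  tr (opm (DB W p k0 k) T) = cint p (fun x => W x k0 k T).
Proof.
rewrite -(@lin_op_tr R _ (fun T => cint p (fun x => W x k0 k T))) // => c b1 b2.
rewrite -cint_lin; [|exact: bmC_W|exact: bmC_W].
by congr cint; apply/funext => x; rewrite -(bstate_lin (W_st cq x) _ _).
Qed.

Definition cerr j : R :=
  sup [set complex.Re (1 - W x 1 n (b j)) | x in [set x : int -> A | window x 1 n = u j]].

Lemma cerr_ge x j : window x 1 n = u j -> 1 - complex.Re (W x 1 n (b j)) <= cerr j.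
Proof.
move=> e; apply: sup_upper_bound.
  split; first by exists (complex.Re (1 - W x 1 n (b j))), x.
  exists 1 => _ [y _ <-]; rewrite cReB /= gerBl.
  exact: ge0_Re (bstate_pos (W_st cq y) 1 n _ (code_psd j)).
by exists x => //; rewrite cReB.
Qed.

Lemma nword_pos j : 0 < nword (u j).
Proof. by rewrite /nword (bigD1 j) //= ltr_pwDl // sumr_ge0. Qed.

(** The lower bound depends on x only through indicators of words, so it integrates to word
    probabilities; the supremum in [cerr] absorbs the rest of the input. *)
Lemma decT_pointwise (x : int -> A) :
  complex.Re (\sum_j toC ((nword (u j))^-1 * (1 - cerr j)) * (pred1 (u j) (window x 1 n))%:R) <=
  complex.Re (W x 1 n (fun s t => decT (window x 1 n, s) (window x 1 n, t))).
Proof.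
have -> : W x 1 n (fun s t => decT (window x 1 n, s) (window x 1 n, t)) =
   \sum_(j | u j == window x 1 n) toC (nword (window x 1 n))^-1 * W x 1 n (b j).
  rewrite -big_filter -(lin_op_sum _ _ _ (bstate_lin (W_st cq x) 1 n)).
  by congr (W x 1 n _); apply: opP => s t; rewrite /decT /= eqxx mulr1n -big_filter.
rewrite !cRe_sum [X in _ <= X]big_mkcond /=; apply: ler_sum => j _.
rewrite [window _ _ _ == _]eq_sym; case: eqP => e; last by rewrite mulr0.
rewrite mulr1 -e Re_toCl /=; apply: ler_wpM2l; first by rewrite invr_ge0 nword_ge0.
by have := cerr_ge (esym e); lra.
Qed.

Lemma decT_success : 1 - avg_err W u b <= trR (opm (DJ W p 1 n 1 n) decT).
Proof.
rewrite /trR (DJ_test cq) /wstate.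
pose c j : C := toC ((nword (u j))^-1 * (1 - cerr j)).
have hc : \sum_j c j * cint p (fun x => (pred1 (u j) (window x 1 n))%:R) = toC (1 - avg_err W u b).
  rewrite /avg_err -/cerr.
  transitivity (toC (M%:R^-1 * \sum_j (1 - cerr j))).
    rewrite mulr_sumr rmorph_sum /=; apply: eq_bigr => j _.
    rewrite (etrans (cint_ind p 1 (pred1 (u j))) (congr1 toC (Hp (u j)))) /c -rmorphM /=; congr toC.
    by field; rewrite pnatr_eq0 -lt0n M0 gt_eqF ?nword_pos.
  congr toC; rewrite sumrB mulrBr sumr_const card_ord mulVf //.
  by rewrite pnatr_eq0 -lt0n.
have -> : 1 - avg_err W u b = complex.Re (toC (1 - avg_err W u b)) by [].
rewrite -hc -cint_sum; last by move=> j; exact: bmC_ind.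
refine (cint_Re_le _ (bmC_sum _ _) (bmC_Ww cq 1 1 (fun w s t => decT (w, s) (w, t))) _).
  by move=> j; apply: bmCM; [exact: bmC_cst|exact: bmC_ind].
by move=> x; exact: decT_pointwise.
Qed.

(** Each index j has weight (nword / M) (1 / nword) = 1 / M, and the operators [b j] together accept
    with probability at most 1 in any output state. *)
Lemma decT_product : trR (opm (tens (DA p 1 n) (DB W p 1 n)) decT) <= M%:R^-1.
Proof.
rewrite /trR; have -> : tr (opm (tens (DA p 1 n) (DB W p 1 n)) decT) =
   toC M%:R^-1 * tr (opm (DB W p 1 n) (fun s t => \sum_j b j s t)).
  transitivity (\sum_a \sum_(j | u j == a) toC M%:R^-1 * tr (opm (DB W p 1 n) (b j))); last first.
    transitivity (\sum_j toC M%:R^-1 * tr (opm (DB W p 1 n) (b j))).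
      by rewrite [RHS](partition_big u xpredT).
    rewrite -mulr_sumr; congr (_ * _); rewrite /tr exchange_big /=; apply: eq_bigr => s _.
    rewrite /opm exchange_big /=; apply: eq_bigr => s' _; by rewrite mulr_sumr.
  rewrite /tr pair_sum; apply: eq_bigr => a _.
  transitivity (\sum_s \sum_s' toC (nword a / M%:R) * DB W p 1 n s s' *
      \sum_(j | u j == a) toC (nword a)^-1 * b j s' s).
    apply: eq_bigr => s _; rewrite /opm pair_sum (bigD1 a) //= [X in _ + X]big1 ?addr0; last first.
      by move=> a' /negbTE na; rewrite big1 // => s' _; rewrite /decT /= na mulr0n mulr0.
    by apply: eq_bigr => s' _; rewrite /tens /decT /= DAE_prb Hp eqxx !mulr1n.
  under eq_bigr do (under eq_bigr do rewrite mulr_sumr).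
  under eq_bigr do rewrite exchange_big /=.
  rewrite exchange_big /=; apply: eq_bigr => j /eqP ej.
  rewrite /opm mulr_sumr; apply: eq_bigr => s _; rewrite mulr_sumr; apply: eq_bigr => s' _.
  have -> : toC M%:R^-1 = toC (nword a / M%:R) * toC (nword a)^-1.
    by rewrite -rmorphM /=; congr toC; field; rewrite pnatr_eq0 -lt0n M0 -ej gt_eqF ?nword_pos.
  by rewrite -!mulrA; congr (_ * _); rewrite mulrCA.
rewrite Re_toCl tr_opm_DB ler_piMr ?invr_ge0 //.
have -> : (1 : R) = complex.Re (cint p (fun=> 1)) by rewrite cint_cst.
apply: cint_Re_le; [exact: bmC_W|exact: bmC_cst|] => x.
by apply: bstate_Re_le1 (W_st cq x) _; case: cd.
Qed.

Lemma code_info : (1 - avg_err W u b) * ln M%:R - ln 2 <= IW W p 1 n.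
Proof.
have Mp : 0 < (M%:R : R) by rewrite ltr0n.
have := @test_bound R _ _ (DJ W p 1 n 1 n) decT M%:R^-1 (psd_DJ cq p 1 n 1 n) (trR_DJ cq p 1 n 1 n)
  decT_psd decT_le1.
rewrite (ptr1_DJ cq) (ptr2_DJ cq) invr_gt0 => /(_ Mp decT_product).
rewrite lnV ?posrE // mulrN opprK; apply: le_trans; rewrite lerD2r ler_wpM2r ?decT_success //.
by rewrite ln_ge0 // ler1n.
Qed.

End CodeBound.

(** * Comparing two input laws through DIMA *)

Section FiniteMemoryApproximation.
Variables (R : realType) (A : finType) (a0 : A) (I : finType) (W : chan R A I).
Local Notation toC := (real_complex R).
Local Notation SA := (SA a0).
Arguments W : clear implicits.
Hypothesis cq : cq_channel a0 W.
Variables (e : R) (m0 a1 : nat).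
Hypothesis dimaW : forall (n : int) (k : nat) (b : bop R I k.+1),
      psd b -> ople b (@idop R _) ->
      forall m a : nat, (m0 <= m)%N -> (a1 <= a)%N ->
      forall x x' : int -> A,
        (forall i : int, n - m%:Z <= i <= n + k%:Z + a%:Z -> x i = x' i) ->
        `|W x n k.+1 b - W x' n k.+1 b| <= (Complex e 0).

(** A reference input with the prescribed word: by DIMA, outputs inside the window can be evaluated
    on it in place of the true input. *)
Definition word_seq n N (w : cfg A N) : int -> A := fun i => wext a0 w `|i - n|%N.

Lemma window_word_seq n N (w : cfg A N) : window (word_seq n w) n N = w.
Proof.
apply/ffunP => i; rewrite ffunE /word_seq.
have -> : absz (n + (i : nat)%:Z - n)%R = i by rewrite addrC addKr.
exact: wextE.
Qed.

Lemma window_eq_at (x y : int -> A) n N : window x n N = window y n N ->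
  forall i : int, n <= i < n + N%:Z -> x i = y i.
Proof.
move=> h i /andP[h1 h2]; have iN : (`|i - n| < N)%N by lia.
have := congr1 (fun f : cfg A N => f (Ordinal iN)) h; rewrite !ffunE /=.
by have -> : n + `|i - n|%N%:Z = i by lia.
Qed.

Local Notation N k := (m0 + (k.+1 + a1))%N.

Lemma dima_word n k (b : bop R I k.+1) (x : int -> A) (w : cfg A (N k)) :
  psd b -> psd (fun s t => idop R s t - b s t) -> window x n (N k) = w ->
  `|complex.Re (W x (n + m0%:Z) k.+1 b) - complex.Re (W (word_seq n w) (n + m0%:Z) k.+1 b)| <= e.
Proof.
move=> pb pb1 hw.
have h := dimaW (n := n + m0%:Z) pb pb1 (leqnn _) (leqnn _) (x := x) (x' := word_seq n w).
rewrite -cReB -lecR; apply: le_trans (normc_ge_Re _) (h _) => i hi.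
by apply: (@window_eq_at _ _ n (N k)); [rewrite window_word_seq|lia].
Qed.

Variables (p q : probability SA R) (n : int) (k : nat).
Hypothesis pq : forall w, prb p (winset n (pred1 w)) = prb q (winset n (pred1 (w : cfg A (N k)))).

Lemma cint_words (r : probability SA R) K (G : cfg A K -> R) :
  cint r (fun x => \sum_w toC (G w) * (pred1 w (window x n K))%:R) =
  toC (\sum_w G w * prb r (winset n (pred1 w))).
Proof.
rewrite cint_sum; last by move=> w; exact: bmC_ind.
by rewrite rmorph_sum /=; apply: eq_bigr => w _; rewrite (cint_ind r n (pred1 w)) -rmorphM.
Qed.

Lemma sum_prb_words (r : probability SA R) m K :
  \sum_(w : cfg A K) prb r (winset m (pred1 w)) = 1.
Proof. by rewrite -(prb_winset r m predT) -(prbT r); congr prb; apply/seteqP. Qed.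

Lemma sum_words (x : int -> A) K (G : cfg A K -> R) :
  \sum_w toC (G w) * (pred1 w (window x n K))%:R = toC (G (window x n K)).
Proof.
rewrite (bigD1 (window x n K)) //= eqxx mulr1 big1 ?addr0 // => w /negbTE nw.
by rewrite eq_sym nw mulr0.
Qed.

Lemma bmC_words K (G : cfg A K -> R) :
  bmC (fun x : SA => \sum_w toC (G w) * (pred1 w (window x n K))%:R).
Proof. by apply: bmC_sum => w; apply: bmCM; [exact: bmC_cst|exact: bmC_ind]. Qed.

(** Each integral differs by at most e from the same average of a function of the word, on which p
    and q agree; hence 2 e. The test may depend on the word, as the joint state requires. *)
Lemma dima_cint (F : cfg A (N k) -> bop R I k.+1) :
  (forall w, psd (F w)) -> (forall w, psd (fun s t => idop R s t - F w s t)) ->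
  complex.Re (cint p (fun x => W x (n + m0%:Z) k.+1 (F (window x n (N k)))))
  - complex.Re (cint q (fun x => W x (n + m0%:Z) k.+1 (F (window x n (N k))))) <= 2 * e.
Proof.
move=> pF pF1.
pose G w := complex.Re (W (word_seq n w) (n + m0%:Z) k.+1 (F w)).
have hG x w : window x n (N k) = w -> `|complex.Re (W x (n + m0%:Z) k.+1 (F w)) - G w| <= e.
  by move=> hw; exact: dima_word.
have up : complex.Re (cint p (fun x => W x (n + m0%:Z) k.+1 (F (window x n (N k))))) <=
    \sum_w (G w + e) * prb p (winset n (pred1 w)).
  rewrite -[leRHS]/(complex.Re (toC _)) -cint_words.
  apply: (cint_Re_le _ (bmC_Ww cq _ _ F) (bmC_words _)) => x.
  rewrite (sum_words x (fun w => G w + e)) /=.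
  by have := hG x _ erefl; rewrite ler_norml => /andP[_]; rewrite lerBlDl.
have lo : \sum_w (G w - e) * prb q (winset n (pred1 w)) <=
    complex.Re (cint q (fun x => W x (n + m0%:Z) k.+1 (F (window x n (N k))))).
  rewrite -[leLHS]/(complex.Re (toC _)) -cint_words.
  apply: (cint_Re_le _ (bmC_words _) (bmC_Ww cq _ _ F)) => x.
  rewrite (sum_words x (fun w => G w - e)) /=.
  by have := hG x _ erefl; rewrite ler_norml => /andP[+ _]; rewrite lerBrDl addrC.
have -> : 2 * e = \sum_w (G w + e) * prb p (winset n (pred1 w)) - \sum_w (G w - e) * prb q (winset n (pred1 w)).
  transitivity (\sum_(w : cfg A (N k)) 2 * e * prb q (winset n (pred1 w))).
    by rewrite -mulr_sumr sum_prb_words mulr1.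
  by rewrite -sumrB; apply: eq_bigr => w _; rewrite pq; ring.
exact: lerB.
Qed.

Hypothesis e01 : 0 <= 2 * e <= 1.

Lemma SO_dima : SO W p (n + m0%:Z) k.+1 <=
  SO W q (n + m0%:Z) k.+1 + 2 * e * (k.+1%:R * ln #|I|%:R) + 3.
Proof.
rewrite -(ln_card_cfg R I k.+1).
apply: fannes (psd_DB cq _ _ _) (psd_DB cq _ _ _) (trR_DB cq _ _ _) (trR_DB cq _ _ _) e01 _ => b pb pb1.
by rewrite !(tr_opm_DB cq); exact: (dima_cint (F := fun=> b)).
Qed.

Lemma DJ_dima : ent (DJ W p n (N k) (n + m0%:Z) k.+1) <= ent (DJ W q n (N k) (n + m0%:Z) k.+1)
  + 2 * e * ((N k)%:R * ln #|A|%:R + k.+1%:R * ln #|I|%:R) + 3.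
Proof.
have lc : ln #|{: cfg A (N k) * cfg I k.+1}|%:R <= (N k)%:R * ln #|A|%:R + k.+1%:R * ln #|I|%:R :> R.
  have cA : (0 < #|cfg A (N k)|)%N by apply/card_gt0P; exists [ffun=> a0].
  rewrite -!ln_card_cfg card_prod natrM; have [->|cI] := posnP #|cfg I k.+1|.
    by rewrite mulr0 ln0 // addr0 ln_ge0 // ler1n.
  by rewrite lnM ?posrE ?ltr0n.
have [e0 _] := andP e01.
apply: le_trans (fannes (psd_DJ cq _ _ _ _ _) (psd_DJ cq q n (N k) (n + m0%:Z) k.+1)
  (trR_DJ cq _ _ _ _ _) (trR_DJ cq _ _ _ _ _) e01 _) _; last by rewrite lerD2r lerD2l ler_wpM2l.
move=> b pb pb1; rewrite !(DJ_test cq).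
apply: (dima_cint (F := fun w s t => b (w, s) (w, t))) => w; first exact: psd_block.
have := psd_block w pb1; congr psd; apply: opP => s t.
by rewrite /idop -pair_eqE /= eqxx.
Qed.

End FiniteMemoryApproximation.

Lemma ln_nat_ge0 (R : realType) (n : nat) : 0 <= ln (n%:R : R).
Proof. by case: n => [|n]; [rewrite ln0|rewrite ln_ge0 // ler1n]. Qed.

(** * Stationary inputs do not beat periodic products *)

Section ErgodicLePeriodic.
Variables (R : realType) (A : finType) (a0 : A) (I : finType) (W : chan R A I).
Local Notation SA := (SA a0).
Arguments W : clear implicits.
Hypothesis cq : cq_channel a0 W.
Hypothesis stW : stationary_channel W.
Hypothesis dimaW : dima W.
Variables (p : probability SA R) (K : R).
Hypothesis hp : inv_under p 1.
Hypothesis KP : forall q : probability SA R, periodic_product q -> info q W * ln 2 <= K.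

Lemma nonpos_of_bounded_multiples (x c : R) (n : nat) :
  (forall k, (n <= k)%N -> k%:R * x <= c) -> x <= 0.
Proof.
move=> h; rewrite leNgt; apply/negP => x0.
have [k hk] : exists k : nat, c / x < k%:R.
  by exists (Num.trunc `|c / x|).+1; apply: le_lt_trans (ler_norm _) (truncnS_gt _).
have := h (maxn n k) (leq_maxl _ _); rewrite -ler_pdivlMr // leNgt => /negP; apply.
by apply: lt_le_trans hk _; rewrite ler_nat leq_maxr.
Qed.

Lemma inv1 (z : nat) : inv_under p z%:Z.
Proof.
elim: z => [|z IH] E mE.
  by congr (p _); apply/seteqP; split => x; rewrite /= (_ : shn 0 x = x) //;
    apply/funext => i; rewrite /shn addr0.
rewrite -(IH E mE) -(hp (measurable_shn_pre z%:Z mE)); congr (p _).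
have e (x : SA) : shn z%:Z (shn 1 x) = shn z.+1%:Z x.
  by apply/funext => i; rewrite /shn -addrA; congr (x (i + _)); lia.
by apply/seteqP; split => x /=; rewrite e.
Qed.

(** q is the periodic product with the t-site marginal of p as block law. Only the inner k + 1
    outputs are kept, and d = m0 + a1 counts the outer sites. The two continuity bounds give 4 e and
    6 = 3 + 3; the outer inputs cost d ln |A|. *)
Lemma block_info_le (e : R) : 0 <= 2 * e <= 1 -> 0 < e -> exists d : nat, forall k,
  SI p 1 (d + k.+1) + SO W p 1 k.+1 - SJ W p 1 k.+1 <=
  (d + k.+1)%:R * (K + 4 * e * (ln #|A|%:R + ln #|I|%:R)) + (d%:R * ln #|A|%:R + 6).
Proof.
move=> e01 e0; have [m0 [a1 hd]] := dimaW e0; exists (m0 + a1)%N => k.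
pose t := (m0 + (k.+1 + a1))%N; have t0 : (0 < t)%N by rewrite /t; lia.
have [e2 _] := andP e01.
have kt : (k.+1%:R : R) <= t%:R by rewrite ler_nat /t; lia.
have lI := ln_nat_ge0 R #|I|.
have h5 : 2 * e * (k.+1%:R * ln #|I|%:R) <= 2 * e * (t%:R * ln #|I|%:R).
  by apply: ler_wpM2l => //; exact: ler_wpM2r.
have h7 : 2 * e * (t%:R * ln #|A|%:R) >= 0.
  by rewrite mulr_ge0 // mulr_ge0 // ln_nat_ge0.
have KPt (q : probability SA R) : periodic_product q ->
    IW W q 1 t / t%:R <= info q W * ln 2 -> IW W q 1 t <= t%:R * K.
  by move=> PQ ib; rewrite mulrC -ler_pdivrMr ?ltr0n //; exact: le_trans ib (KP PQ).
have et : (m0 + a1 + k.+1)%N = t by rewrite /t -addnA [(a1 + _)%N]addnC.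
have [pi hpi] : exists pi : cfg A t -> R, forall w, pi w = prb p (winset 1 (pred1 w)) by eexists.
have pi0 w : 0 <= pi w by rewrite hpi prb_ge0.
have pi1 : \sum_w pi w = 1 by under eq_bigr do rewrite hpi; exact: sum_prb_words.
have [q Hpp] := periodic_product_exists a0 t0 pi0 pi1.
have mq (w : cfg A t) : prb q (winset 1 (pred1 w)) = prb p (winset 1 (pred1 w)).
  rewrite -hpi; refine (pp_marginal Hpp w).
have PQ : periodic_product q by exists t, pi.
have ib := @info_block_ge R A a0 I W cq stW q t pi t0 Hpp.
have eSI : SI q 1 t = SI p 1 t.
  by rewrite /SI; congr ent; apply: opP => w w'; rewrite !DAE_prb mq.
have h1 := SJ_restrict_out cq q 1 m0 k.+1 a1.
(* The output entropy is carried from p to q and the joint entropy from q to p, in accordance with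
   their opposite signs in [IW]. *)
have h2 := SO_dima cq hd (fun w => esym (mq w)) e01.
have h3 := DJ_dima cq hd mq e01.
have h4 := SJ_inner_le cq p 1 m0 k.+1 a1.
have pO := SO_per cq stW (inv1 m0) 1 k.+1.
have pJ := SJ_per cq stW (inv1 m0) 1 k.+1.
have h6 := KPt q PQ ib.
rewrite et; move: h1 h2 h3 h4 h5 h6 h7; rewrite /IW eSI pO pJ -/t.
move: (SJ W q 1 t) (SO W q (1 + m0%:Z) k.+1) (ent (DJ W q 1 t (1 + m0%:Z) k.+1)) (SO W q 1 t)
  (SO W p 1 k.+1) (ent (DJ W p 1 t (1 + m0%:Z) k.+1)) (SJ W p 1 k.+1) (SI p 1 t).
move: (t%:R : R) ((m0 + a1)%:R : R); clear => *; lra.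
Qed.

Lemma info_le_of_periodic : info p W * ln 2 <= K.
Proof.
set c2 : R := ln #|A|%:R + ln #|I|%:R.
have c20 : 0 <= c2 by rewrite addr_ge0 // ln_nat_ge0.
(* The coefficient 4 c2 comes from [block_info_le], the 2 from approximating two limits within e. *)
have main e : 0 < e -> 2 * e <= 1 -> info p W * ln 2 <= K + (4 * c2 + 2) * e.
  move=> e0 e1; have e01 : 0 <= 2 * e <= 1 by rewrite e1 mulr_ge0 // ltW.
  have [d hd] := block_info_le e01 e0.
  (* In [block_info_le] the input window is d sites longer than the output window, so the rate h of
     [SI] is separated from the rate g of [SO - SJ]. *)
  have [h hh] := @SI_cvg R A a0 I W cq stW p 1 isT hp 1.
  set g := info p W * ln 2 - h.
  have hg : ((SO W p 1 k - SJ W p 1 k) / k%:R) @[k --> \oo] --> g.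
    have -> : (fun k : nat => (SO W p 1 k - SJ W p 1 k) / k%:R) =
       (fun k => IW W p 1 k / k%:R - SI p 1 k / k%:R).
      by apply/funext => k; rewrite /IW !mulrBl mulrDl; ring.
    exact: (cvgB (@IW_cvg R A a0 I W cq stW p 1 isT hp 1) hh).
  have [n1 _ hn1] := (cvgrPdist_le _ _).1 hh _ e0.
  have [n2 _ hn2] := (cvgrPdist_le _ _).1 hg _ e0.
  rewrite -subr_le0.
  apply: (@nonpos_of_bounded_multiples _ (d%:R * ln #|A|%:R + 6 + d%:R * (g - e)) (n1 + n2 + d).+1) => k hk.
  have [j ej] : exists j, k = (d + j.+1)%N by exists (k - d.+1)%N; lia.
  have := hd j; rewrite -ej.
  have : k%:R * (h - e) <= SI p 1 k.
    have n1k : (n1 <= k)%N by lia.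
    have k0 : 0 < (k%:R : R) by rewrite ltr0n; lia.
    rewrite mulrC -ler_pdivlMr // lerBlDr -lerBlDl.
    by have := hn1 k n1k; rewrite /= ler_norml => /andP[].
  have : j.+1%:R * (g - e) <= SO W p 1 j.+1 - SJ W p 1 j.+1.
    have n2k : (n2 <= j.+1)%N by lia.
    have k0 : 0 < (j.+1%:R : R) by rewrite ltr0n.
    rewrite mulrC -ler_pdivlMr // lerBlDr -lerBlDl.
    by have := hn2 j.+1 n2k; rewrite /= ler_norml => /andP[].
  have -> : (j.+1%:R : R) = k%:R - d%:R by rewrite ej natrD; ring.
  rewrite -/c2 /g; lra.
apply/ler_addgt0Pr => e' e'0.
have c0 : 0 < 4 * c2 + 2 by lra.
have e0 : 0 < Num.min (1 / 2) (e' / (4 * c2 + 2)) by rewrite lt_min divr_gt0 // divr_gt0.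
apply: le_trans (main _ e0 _) _.
  by have : Num.min (1 / 2) (e' / (4 * c2 + 2)) <= 1 / 2; [rewrite ge_min lexx|lra].
rewrite lerD2l mulrC -ler_pdivlMr //.
by rewrite ge_min lexx orbT.
Qed.

End ErgodicLePeriodic.

(** * The two capacities and the bound for codes *)

Section Capacities.
Variables (R : realType) (A : finType) (a0 : A) (I : finType) (W : chan R A I).
Local Notation SA := (SA a0).
Arguments W : clear implicits.
Hypothesis cq : cq_channel a0 W.
Hypothesis stW : stationary_channel W.

Lemma info_ub (p : probability SA R) t : (0 < t)%N -> inv_under p t%:Z ->
  info p W <= (ln #|A|%:R + ln #|I|%:R) / ln 2.
Proof. by move=> t0 hp; rewrite ler_pdivlMr ?ln2_gt0 //; exact: (info_le cq stW t0 hp). Qed.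

Lemma periodic_product_zero_one (p : probability SA R) (E : set SA) : periodic_product p ->
  measurable E -> (@shiftx A @^-1` E)%classic = E -> p E = 0%E \/ p E = 1%E.
Proof. by move=> [t [pi [t0 [_ [_ Hpp]]]]]; exact: (pp_zero_one t0 Hpp). Qed.

Lemma periodic_product_inv (p : probability SA R) : periodic_product p ->
  exists2 t, (0 < t)%N & inv_under p t%:Z.
Proof. by move=> [t [pi [t0 [_ [_ Hpp]]]]]; exists t => //; exact: (pp_inv t0 Hpp). Qed.

Lemma periodic_product_nonempty : exists p : probability SA R, periodic_product p.
Proof.
pose w0 : cfg A 1 := [ffun=> a0].
have h0 w : 0 <= ((w == w0)%:R : R) by [].
have h1 : \sum_w ((w == w0)%:R : R) = 1.
  by rewrite (bigD1 w0) //= eqxx big1 ?addr0 // => w /negbTE ->.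
have [p hp] := periodic_product_exists a0 (isT : (0 < 1)%N) h0 h1.
by exists p, 1%N, (fun w => (w == w0)%:R).
Qed.

(** [sup] bounds its set only if that set is bounded; [info_ub] provides a dimension bound
    independent of the period. *)
Lemma info_le_C_pp (p : probability SA R) : periodic_product p -> info p W <= C_pp a0 W.
Proof.
move=> hp; apply: sup_upper_bound; last by exists p.
split; first by exists (info p W), p.
exists ((ln #|A|%:R + ln #|I|%:R) / ln 2) => _ [q [hq ->]].
by have [t t0 iq] := periodic_product_inv hq; exact: info_ub t0 iq.
Qed.

Lemma info_le_C_erg (p : probability SA R) : stationary p -> ergodic p -> info p W <= C_erg a0 W.
Proof.
move=> sp ep; apply: sup_upper_bound; last by exists p.
split; first by exists (info p W), p.
exists ((ln #|A|%:R + ln #|I|%:R) / ln 2) => _ [q [sq [_ ->]]].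
by apply: (@info_ub q 1%N) => //; exact/stationary_inv.
Qed.

Lemma C_pp_le_C_erg : C_pp a0 W <= C_erg a0 W.
Proof.
have [p0 hp0] := periodic_product_nonempty.
apply: ge_sup; first by exists (info p0 W), p0.
move=> _ [p [hp ->]]; have [t t0 ip] := periodic_product_inv hp.
apply: le_trans (info_avg cq stW t0 ip) _; apply: info_le_C_erg.
  exact: avg_shift_stationary.
by apply: avg_shift_ergodic => // E; exact: periodic_product_zero_one.
Qed.

Lemma C_erg_le_C_pp : dima W -> C_erg a0 W <= C_pp a0 W.
Proof.
move=> dW; have [p0 hp0] := periodic_product_nonempty.
have [t0 t00 ip0] := periodic_product_inv hp0.
apply: ge_sup.
  (* The shift average of a periodic product shows that stationary ergodic inputs exist, so the
     supremum is over a nonempty set. *)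
  exists (info (avg_shift p0 t0) W), (avg_shift p0 t0); split; first exact: avg_shift_stationary.
  by split => //; apply: avg_shift_ergodic => // E; exact: periodic_product_zero_one.
move=> _ [p [/stationary_inv sp [_ ->]]]; rewrite -(ler_pM2r (ln2_gt0 R)).
apply: (info_le_of_periodic cq stW dW sp) => q hq.
by rewrite (ler_pM2r (ln2_gt0 R)); exact: info_le_C_pp.
Qed.

(** The law of a uniformly chosen code word serves as block law, linking [code_info],
    [info_block_ge] and the supremum. The sign of [C_pp], needed for the final division, follows
    from the same input. *)
Lemma code_success_le n M (u : 'I_M -> cfg A n) (b : 'I_M -> bop R I n) : (0 < n)%N -> (0 < M)%N ->
  is_code u b ->
  0 <= C_pp a0 W /\ (1 - avg_err W u b) * ln M%:R <= (n%:R * C_pp a0 W + 1) * ln 2.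
Proof.
move=> n0 M0 cd; have Mp : (M%:R : R) != 0 by rewrite pnatr_eq0 -lt0n.
have np : 0 < (n%:R : R) by rewrite ltr0n.
have [pi hpi] : exists pi : cfg A n -> R, forall w, pi w = nword R u w / M%:R by eexists.
have pi0 w : 0 <= pi w by rewrite hpi divr_ge0 ?nword_ge0.
have pi1 : \sum_w pi w = 1.
  under eq_bigr do rewrite hpi; rewrite -mulr_suml; have -> : \sum_w nword R u w = \sum_(j < M) 1 by rewrite [RHS](partition_big u xpredT).
  by rewrite sumr_const card_ord mulfV.
have [p Hpp] := periodic_product_exists a0 n0 pi0 pi1.
have h1 := code_info cq M0 cd (fun w => etrans (pp_marginal Hpp w) (hpi w)).
have h2 := info_block_ge cq stW n0 Hpp.
have h3 : info p W <= C_pp a0 W by apply: info_le_C_pp; exists n, pi.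
have h4 := IW_ge0 cq p 1 n.
have l2 := ln2_gt0 R.
have h5 : info p W * ln 2 <= C_pp a0 W * ln 2 by rewrite ler_pM2r.
split; first by rewrite -(pmulr_lge0 _ l2); apply: le_trans (le_trans h2 h5); rewrite divr_ge0.
have : IW W p 1 n <= C_pp a0 W * ln 2 * n%:R by rewrite -ler_pdivrMr //; exact: le_trans h2 h5.
lra.
Qed.

End Capacities.

Theorem theorem8 (R : realType) (A : finType) (a0 : A) (I : finType)
    (W : chan R A I) :
  cq_channel a0 W -> stationary_channel W -> dima W -> ergodic_channel a0 W ->
  C_pp a0 W = C_erg a0 W /\
  forall eps : R, 0 < eps ->
  forall (n M : nat) (u : 'I_M -> cfg A n) (b : 'I_M -> bop R I n),
    (0 < n)%N -> is_code u b ->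
    2 `^ (n%:R * (C_pp a0 W + eps)) <= M%:R ->
    1 - (C_pp a0 W + n%:R^-1) / (C_pp a0 W + eps) <= avg_err W u b.
Proof.
move=> cq stW dW _; split.
  by apply/le_anti; rewrite C_pp_le_C_erg ?C_erg_le_C_pp.
move=> eps eps0 n M u b n0 cd hM.
have p2 : 0 < 2 `^ (n%:R * (C_pp a0 W + eps)) by rewrite powR_gt0.
have M0 : (0 < M)%N by rewrite -(ltr0n R); exact: lt_le_trans hM.
have [C0 h] := code_success_le cq stW n0 M0 cd.
have np : 0 < (n%:R : R) by rewrite ltr0n.
have Ce : 0 < C_pp a0 W + eps by rewrite ltr_wpDl.
have l2 := ln2_gt0 R.
have hL : n%:R * (C_pp a0 W + eps) * ln 2 <= ln M%:R.
  by rewrite -ln_powR ler_ln ?posrE // (lt_le_trans p2).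
rewrite lerBlDr -lerBlDl ler_pdivlMr //.
(* The lower bound on ln M may be multiplied by the success probability only if that is positive;
   otherwise the claim compares a nonpositive with a nonnegative number. *)
have [e1|e1] := lerP (1 - avg_err W u b) 0.
  apply: (@le_trans _ _ 0); first by rewrite mulr_le0_ge0 // ltW.
  by rewrite addr_ge0 // invr_ge0 ltW.
have h2 : (1 - avg_err W u b) * (n%:R * (C_pp a0 W + eps) * ln 2) <= (n%:R * C_pp a0 W + 1) * ln 2.
  by apply: le_trans h; rewrite ler_pM2l.
have e3 : n%:R * (C_pp a0 W + n%:R^-1) = n%:R * C_pp a0 W + 1 by field; rewrite gt_eqF.
rewrite -(ler_pM2l np) e3 -(ler_pM2r l2); apply: le_trans h2.
by rewrite le_eqVlt; apply/orP; left; apply/eqP; ring.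
Qed.
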